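(* Let $\theta \in \pi \mathbb{Q} \cap (0,\frac{\pi}{2}]$, let $n \in \mathbb{N}$ be the smallest integer such that $\theta n \in \pi \mathbb{N}$, and let $f,g$ be entire functions of finite order, neither identically zero. Then $|f| = |g|$ on $\mathbb{R} \cup e^{i\theta} \mathbb{R}$ if and only if $f$ and $g$ factor as $$f(z) = e^{Q_f(z)} P_{\mathrm c}(z) \prod_{\substack{a \in \operatorname{supp}(M_{\mathrm d}) \\ \arg a \in (-\theta,\theta]}} \prod_{k = 1}^n E\left( \frac{z}{\rho_{2 \theta}^k a} ; p \right)^{M_{\mathrm d}(a)},$$ $$g(z) = e^{Q_g(z)} P_{\mathrm c}(z) \prod_{\substack{a \in \operatorname{supp}(M_{\mathrm d}) \\ \arg a \in (-\theta,\theta]}} \prod_{k = 1}^n E\left( \frac{z}{\rho_{2 \theta}^k \overline a} ; p \right)^{M_{\mathrm d}(a)}.$$ Here, $p \in \mathbb{N}_0$ is the genus of the canonical product formed with the zeroes of $f$, $P_{\mathrm c}$ is the canonical product formed with the common zeroes of $f$ and $g$, and $Q_f, Q_g \in \mathbb{C}[z]$ are polynomials of the same order (degree) $d \in \mathbb{N}_0$, whose coefficients have the same real parts and whose imaginary parts $(\lambda_k)_{k=0}^d$ (for $Q_f$) and $(\mu_k)_{k=0}^d$ (for $Q_g$), all real, satisfy $\lambda_k = \mu_k$ for $k \notin n\mathbb{Z}$.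
   Context: $\mathbb{N} = \{1,2,\dots\}$, $\mathbb{N}_0 = \mathbb{N}\cup\{0\}$; $\arg$ takes values in $(-\pi,\pi]$; $\rho_{2\theta}$ denotes the rotation $z \mapsto e^{2 i \theta} z$ of $\mathbb{C}$. An entire function $f$ is of finite order if $f(z) = O(\exp(|z|^c))$ as $z\to\infty$ for some $c>0$. For a nonzero entire function $f$, $M_f : \mathbb{C} \to \mathbb{N}_0$ maps $z$ to the multiplicity of $z$ as a zero of $f$ (and to $0$ if $f(z) \neq 0$). For $f,g$ put $M_{\mathrm c} := \min\{M_f, M_g\}$ (common zeroes) and $M_{\mathrm d} := \max\{M_f - M_g, 0\}$ (zeroes of $f$ that are not zeroes of $g$), pointwise; $\operatorname{supp}$ denotes the support of a function (here, the set where it is nonzero). Primary factors: $E(z;0) = 1-z$ and $E(z;p) = (1-z)\exp\big(\sum_{j=1}^p z^j/j\big)$ for $p \in \mathbb{N}$. The genus of the canonical product formed with the zeroes of a finite order $f$ is the smallest $p \in \mathbb{N}_0$ such that $\sum_{a \in \operatorname{supp}(M_f)\setminus\{0\}} M_f(a)/|a|^{p+1} < \infty$. With this $p$ and with $m = M_f(0)$ the multiplicity of the zero of $f$ at the origin, the canonical product formed with the common zeroes of $f$ and $g$ is $P_{\mathrm c}(z) := z^m \prod_{a \in \operatorname{supp}(M_{\mathrm c})\setminus\{0\}} E(z/a;p)^{M_{\mathrm c}(a)}$.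
   Formalization: The sector arg a ∈ (-θ,θ] is replaced by (-π/n,π/n] (the same if θ=π/n; otherwise the claim fails, e.g. θ=2π/5), and ''same degree d'' means a common bound d on both degrees, as exact degrees can differ (f=exp(iz²), g=1, θ=π/2). *)

(* Defs.v *)
(* MathComp-Analysis, over an arbitrary [R : realType]; the complex numbers are
   R[i], with the topology of the regular normed module R[i]^o. *)
From HB Require Import structures.
From mathcomp Require Import all_boot all_order all_algebra.
From mathcomp Require Import finmap complex.
From mathcomp Require Import all_classical all_reals all_analysis.
From mathcomp Require Import summability.

Set Implicit Arguments.
Unset Strict Implicit.
Unset Printing Implicit Defensive.
Import Order.TTheory GRing.Theory Num.Theory.
Import numFieldNormedType.Exports.

Local Open Scope classical_set_scope.
Local Open Scope complex_scope.
Local Open Scope ring_scope.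

Section Complex.
Context {R : realType}.
Local Notation C := R[i].

Definition cabs (z : C) : R := Normc.normc z.

Definition cexp (z : C) : C :=
  (expR (complex.Re z))%:C * (cos (complex.Im z) +i* sin (complex.Im z)).

(* The argument in ]-pi, pi] of [z != 0]; the value at 0 is meaningless. *)
Definition carg (z : C) : R :=
  let t := acos (complex.Re z / cabs z) in
  if 0 <= complex.Im z then t else - t.

Definition rotation (t : R) (z : C) : C := cexp (t *i) * z.

(* Complex differentiability: the increments range over R[i]. *)
Definition entire (f : C -> C) : Prop :=
  forall z : C, derivable (f : C^o -> C^o) z 1.

Definition finite_order (f : C -> C) : Prop :=
  exists c K r : R, 0 < c /\
    forall z, r <= cabs z -> cabs (f z) <= K * expR (cabs z `^ c).

(* For a nonzero entire [f], exactly one [m] satisfies the condition. *)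
Definition mult (f : C -> C) (z : C) : nat :=
  xget 0%N [set m | exists h : C -> C,
    [/\ entire h, h z != 0 & forall w, f w = (w - z) ^+ m * h w]].

Definition mult_common (f g : C -> C) (z : C) : nat :=
  minn (mult f z) (mult g z).

(* Truncated subtraction, i.e., max (M_f - M_g, 0). *)
Definition mult_diff (f g : C -> C) (z : C) : nat :=
  (mult f z - mult g z)%N.

(* At [p = 0] the exponential factor is [cexp 0 = 1]. *)
Definition primary_factor (p : nat) (z : C) : C :=
  (1 - z) * cexp (\sum_(1 <= j < p.+1) z ^+ j / j%:R).

Definition zero_sum (f : C -> C) (p : nat) : \bar R :=
  (\esum_(a in [set a : C | mult f a != 0%N /\ a != 0%R])
     ((mult f a)%:R / cabs a ^+ p.+1)%:E)%E.

(* The least [p] with a finite [zero_sum]; one exists when [f] is a nonzero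
   entire function of finite order. *)
Definition genus (f : C -> C) : nat :=
  xget 0%N [set p | (zero_sum f p < +oo)%E /\
                    forall q, (zero_sum f q < +oo)%E -> (p <= q)%N].

(* Infinite products over a set of complex numbers carry no order on the
   factors: they are limits along the directed set of finite subsets. *)
Definition partial_prod (S : set C) (F : C -> C) (A : {fset C}) : C^o :=
  \prod_(a <- A | a \in S) F a.

Definition infprod_cvg (S : set C) (F : C -> C) : Prop :=
  cvg (partial_prod S F @ totally).

Definition infprod (S : set C) (F : C -> C) : C :=
  lim (partial_prod S F @ totally).

Definition common_support (f g : C -> C) : set C :=
  [set a | mult_common f g a != 0%N /\ a != 0].

Definition common_factor (f g : C -> C) (z a : C) : C :=
  primary_factor (genus f) (z / a) ^+ mult_common f g a.

Definition common_product (f g : C -> C) (z : C) : C :=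
  z ^+ mult f 0 * infprod (common_support f g) (common_factor f g z).

(* One representative of each orbit, in supp M_d \ {0}, of the rotation group of
   order [n]: the sector ]-pi/n, pi/n] has opening 2 pi/n.  If [theta = pi/n]
   this is the sector ]-theta, theta].  If [theta = m pi/n] with [m > 1], then
   ]-theta, theta] meets each such orbit [m] times, and a product over it would
   not have the multiplicities [mult_diff f g]. *)
Definition diff_sector (f g : C -> C) (n : nat) : set C :=
  [set a | [/\ mult_diff f g a != 0%N, a != 0
             & - (pi / n%:R) < carg a <= pi / n%:R]].

(* [tau] is the identity for the zeros of [f], the conjugation for those
   of [g]. *)
Definition orbit_factor (f g : C -> C) (theta : R) (n : nat) (tau : C -> C)
    (z a : C) : C :=
  \prod_(1 <= k < n.+1)
    primary_factor (genus f) (z / iter k (rotation (2 * theta)) (tau a))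
      ^+ mult_diff f g a.

(* An equation involving infinite products includes their convergence. *)
Definition factors_as (f g : C -> C) (theta : R) (n : nat) (tau : C -> C)
    (Q : {poly C}) (h : C -> C) : Prop :=
  forall z,
    [/\ infprod_cvg (common_support f g) (common_factor f g z),
        infprod_cvg (diff_sector f g n) (orbit_factor f g theta n tau z)
      & h z = cexp Q.[z] * common_product f g z *
              infprod (diff_sector f g n) (orbit_factor f g theta n tau z)].

End Complex.

(* Main.v *)
Require Import Defs.
From HB Require Import structures.
From mathcomp Require Import all_boot all_order all_algebra.
From mathcomp Require Import finmap complex ring lra zify.
From mathcomp Require Import all_classical all_reals all_analysis.
From mathcomp Require Import summability.
Set Implicit Arguments.
Unset Strict Implicit.
Unset Printing Implicit Defensive.
Import Order.TTheory GRing.Theory Num.Theory.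
Import numFieldNormedType.Exports.
Local Open Scope classical_set_scope.
Local Open Scope complex_scope.
Local Open Scope ring_scope.

(** Let [f^#] be the reflected function, whose value at [w] is the conjugate of
    [f (w^* )].  If [|f| = |g|] on the real line then [f f^# = g g^#] there, hence
    everywhere, because the zeros of a nonzero entire function are isolated; on
    the other line the same holds with the reflection [w |-> e^{2 i theta} w^*].
    Comparison of the multiplicities of the zeros ([mult_sym_real],
    [mult_sym_line]) shows that [M_f - M_g] changes sign under conjugation and is
    invariant under the rotation by [2 theta].  So the zeros of [f] are the common
    zeros and some orbits of this rotation, and those of [g] are the common zeros
    and the conjugate orbits.  As [theta = pi m / n] with [m] prime to [n], the
    orbits are those of the group of all rotations by multiples of [2 pi / n], and
    each orbit outside the origin meets the sector [-pi/n < arg a <= pi/n] exactly once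
    ([sector_exists], [sector_unique]).  Hadamard's factorizations of [f] and [g],
    in which the unordered products are grouped by orbits ([regroup_cvg]), are
    then the two formulas ([factors_as_hadamard]).

    On the two lines the products over orbits for [g] are the conjugates of those
    for [f] ([orbit_factor_line]).  So, when the formulas hold, [|f| = |g|] on the
    lines exactly if the polynomial [q = Q_f - Q_g] has real part zero there.  On
    the line through [u] the real part of [q] is the polynomial in the real
    coordinate whose coefficients are the numbers [Re (q_k u^k)].  For [u = 1]
    these vanish if and only if the [q_k] are imaginary, and then they vanish for
    [u = e^{i theta}] if and only if [q_k = 0] or [sin (k theta) = 0], that is,
    [n] divides [k] ([line_coefP]).

    The complex analysis behind this uses sums in place of contour integrals.
    Goursat's bisection shows that trapezoid sums around a parallelogram tend to
    zero ([discrete_goursat]); after the substitution [w = e^zeta] this says that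
    the means of a function that is differentiable off the origin, over the
    vertices of regular [2^m]-gons inscribed in two circles around the origin, have
    the same limit ([has_mean_indep]), where limits are taken along an
    ultrafilter.  Together with the Fejer kernel it makes an entire
    function the sum of a power series whose coefficients are such means
    ([power_series]).  Cauchy's estimates, the division by a zero, the bound on
    the number of zeros and the Borel-Caratheodory inequality follow.

    Hadamard's theorem is proved without lower bounds for canonical products.
    Divide [f] by its zeros in a disc of large radius [rho].  In a much smaller
    disc the logarithm of the quotient [h] is nearly a polynomial of fixed degree
    ([entire_log]): the Taylor polynomials of [h] are products of factors
    [1 - b z] with [b rho] in the unit disc, the coefficients of the logarithm of
    such a product are, up to constants, the power sums of the [b]'s, which
    depend only on the first coefficients of the product by Newton's identities
    and are bounded in terms of its maximum by the Borel-Caratheodory inequality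
    ([power_sum_le]).  As [rho] grows, [f] becomes the exponential of a polynomial
    times the canonical product ([hadamard1]). *)

(** * Modulus and limits of complex numbers *)

Section Modulus.
Context {R : realType}.
Local Notation C := R[i].
Implicit Types z w : C.

Lemma ReD z w : complex.Re (z + w) = complex.Re z + complex.Re w.
Proof. by case: z; case: w. Qed.

Lemma ImD z w : complex.Im (z + w) = complex.Im z + complex.Im w.
Proof. by case: z; case: w. Qed.

Lemma ReN z : complex.Re (- z) = - complex.Re z.
Proof. by case: z. Qed.

Lemma ImN z : complex.Im (- z) = - complex.Im z.
Proof. by case: z. Qed.

Lemma ReB z w : complex.Re (z - w) = complex.Re z - complex.Re w.
Proof. by rewrite ReD ReN. Qed.

Lemma ImB z w : complex.Im (z - w) = complex.Im z - complex.Im w.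
Proof. by rewrite ImD ImN. Qed.

Lemma ReM z w : complex.Re (z * w) =
  complex.Re z * complex.Re w - complex.Im z * complex.Im w.
Proof. by case: z; case: w. Qed.

Lemma ImM z w : complex.Im (z * w) =
  complex.Re z * complex.Im w + complex.Im z * complex.Re w.
Proof. by case: z => a b; case: w => c d /=. Qed.

Lemma Re_conj z : complex.Re z^* = complex.Re z. Proof. by case: z. Qed.

Lemma Im_conj z : complex.Im z^* = - complex.Im z. Proof. by case: z. Qed.

Lemma eq_ReIm z w : complex.Re z = complex.Re w ->
  complex.Im z = complex.Im w -> z = w.
Proof. by case: z => a b; case: w => c d /= -> ->. Qed.

Lemma Re_sum (I : Type) (s : seq I) (P : pred I) (F : I -> C) :
  complex.Re (\sum_(i <- s | P i) F i) = \sum_(i <- s | P i) complex.Re (F i).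
Proof. by elim/big_rec2: _ => [//|i x y _ <-]; rewrite ReD. Qed.

Lemma cabs_ge0 z : 0 <= cabs z.
Proof. by case: z => a b; rewrite /cabs /= sqrtr_ge0. Qed.

Lemma sqr_cabs z : cabs z ^+ 2 = complex.Re z ^+ 2 + complex.Im z ^+ 2.
Proof. by case: z => a b; rewrite /cabs /= sqr_sqrtr // addr_ge0 ?sqr_ge0. Qed.

Lemma normC_cabs z : `|z| = (cabs z)%:C.
Proof. by case: z => a b; rewrite normc_def. Qed.

Lemma cabsM z w : cabs (z * w) = cabs z * cabs w.
Proof. exact: Normc.normcM. Qed.

Lemma cabsD z w : cabs (z + w) <= cabs z + cabs w.
Proof. exact: le_normcD. Qed.

Lemma cabsN z : cabs (- z) = cabs z.
Proof. exact: normcN. Qed.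

Lemma cabsB z w : cabs (z - w) <= cabs z + cabs w.
Proof. by rewrite -(cabsN w) cabsD. Qed.

Lemma cabsC z w : cabs (z - w) = cabs (w - z).
Proof. by rewrite -cabsN opprB. Qed.

Lemma cabs_real (x : R) : cabs x%:C = `|x|.
Proof. by rewrite /cabs /= expr0n addr0 sqrtr_sqr. Qed.

Lemma cabs0 : cabs (0 : C) = 0.
Proof. by rewrite -[0]/(0%:C) cabs_real normr0. Qed.

Lemma cabs1 : cabs (1 : C) = 1.
Proof. by rewrite -[1]/(1%:C) cabs_real normr1. Qed.

Lemma cabs_nat n : cabs (n%:R : C) = n%:R.
Proof. by rewrite -(rmorph_nat (real_complex R)) cabs_real normr_nat. Qed.

Lemma cabs_eq0 z : (cabs z == 0) = (z == 0).
Proof.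
apply/eqP/eqP => [/Normc.eq0_normc //|->]; exact: cabs0.
Qed.

Lemma cabs_gt0 z : (0 < cabs z) = (z != 0).
Proof. by rewrite lt_def cabs_eq0 cabs_ge0 andbT. Qed.

Lemma cabsV z : cabs z^-1 = (cabs z)^-1.
Proof. exact: Normc.normcV. Qed.

Lemma cabsX z n : cabs (z ^+ n) = cabs z ^+ n.
Proof. by elim: n => [|n IH]; rewrite ?cabs1 // !exprS cabsM IH. Qed.

Lemma cabs_conj z : cabs z^* = cabs z.
Proof. by case: z => a b; rewrite /cabs /= sqrrN. Qed.

Lemma cabs_sum (I : Type) (s : seq I) (P : pred I) (F : I -> C) :
  cabs (\sum_(i <- s | P i) F i) <= \sum_(i <- s | P i) cabs (F i).
Proof.
elim/big_rec2: _ => [|i y x _ le]; first by rewrite cabs0.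
by apply: le_trans (cabsD _ _) _; rewrite lerD2l.
Qed.

Lemma cabs_prod (I : Type) (s : seq I) (P : pred I) (F : I -> C) :
  cabs (\prod_(i <- s | P i) F i) = \prod_(i <- s | P i) cabs (F i).
Proof.
by elim/big_rec2: _ => [|i y x _ <-]; rewrite ?cabs1 // cabsM.
Qed.

Lemma cabs_sub_ge z w : cabs z - cabs w <= cabs (z - w).
Proof. by rewrite lerBlDr -{1}(subrK w z) cabsD. Qed.

Lemma cabs_triangle u z w : cabs (z - w) <= cabs (z - u) + cabs (u - w).
Proof.
have -> : z - w = (z - u) + (u - w) by ring.
exact: cabsD.
Qed.

Lemma abs_Re_le z : `|complex.Re z| <= cabs z.
Proof.
rewrite -(@ler_pXn2r _ 2) ?nnegrE ?cabs_ge0 // sqr_cabs real_normK ?num_real //.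
by rewrite lerDl sqr_ge0.
Qed.

Lemma abs_Im_le z : `|complex.Im z| <= cabs z.
Proof.
rewrite -(@ler_pXn2r _ 2) ?nnegrE ?cabs_ge0 // sqr_cabs real_normK ?num_real //.
by rewrite lerDr sqr_ge0.
Qed.

Lemma Re_le_cabs z : complex.Re z <= cabs z.
Proof. exact: le_trans (ler_norm _) (abs_Re_le z). Qed.

Lemma cabs_le_ReIm z : cabs z <= `|complex.Re z| + `|complex.Im z|.
Proof.
rewrite -(@ler_pXn2r _ 2) ?nnegrE ?cabs_ge0 ?addr_ge0 // sqr_cabs.
rewrite sqrrD !real_normK ?num_real // lerD2r lerDl.
by rewrite mulrn_wge0 // mulr_ge0.
Qed.

Lemma mul_conj_cabs z : z * z^* = (cabs z ^+ 2)%:C.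
Proof.
by apply: eq_ReIm; rewrite ?ReM ?ImM ?Re_conj ?Im_conj /= ?sqr_cabs; ring.
Qed.

End Modulus.

Section Limits.
Context {R : realType}.
Local Notation C := R[i].
Local Notation Co := (R[i]^o).

(** The uniform structure of [R[i]^o] has complex radii; the order of [R[i]]
    makes the positive ones real. *)
Lemma cvgcP (T : Type) (F : set_system T) {FF : Filter F} (u : T -> C) (l : C) :
  (u x : Co) @[x --> F] --> (l : Co) <->
  forall e : R, 0 < e -> \forall x \near F, cabs (u x - l) < e.
Proof.
split=> [/cvgrPdistC_lt h e e0|h].
  have := h e%:C; rewrite ltcR => /(_ e0); apply: filterS => x.
  by rewrite normC_cabs ltcR.
apply/cvgrPdistC_lt => -[a b]; rewrite ltcE /= => /andP[/eqP -> a0].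
by apply: filterS (h a a0) => x; rewrite normC_cabs => ?; rewrite ltcR.
Qed.

Lemma nbhscP (z : C) (P : C -> Prop) :
  (\forall w \near (z : Co), P w) <->
  exists2 d : R, 0 < d & forall w, cabs (w - z) < d -> P w.
Proof.
split=> [/nbhs_ballP[[a b]]|[d d0 h]].
  rewrite /= ltcE /= => /andP[/eqP -> a0] h; exists a => // w wz.
  by apply: h; rewrite /ball /= normC_cabs ltcR cabsC.
apply/nbhs_ballP; exists d%:C; first by rewrite /= ltcR.
by move=> w; rewrite /ball /= normC_cabs ltcR cabsC => /h.
Qed.

Lemma cvgc_squeeze (T : Type) (F : set_system T) {FF : Filter F} (u : T -> C)
    (l : C) (b : T -> R) :
  (\forall x \near F, cabs (u x - l) <= b x) -> b @ F --> (0 : R) ->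
  (u x : Co) @[x --> F] --> (l : Co).
Proof.
move=> ub /cvgrPdistC_lt b0; apply/cvgcP => e e0.
near=> x.
apply: (@le_lt_trans _ _ (b x)); first by near: x.
by rewrite (le_lt_trans (ler_norm _)) // -[b x]subr0; near: x; apply: b0.
Unshelve. all: by end_near. Qed.

Lemma cvgc_unique (T : Type) (F : set_system T) {FF : ProperFilter F}
    (u : T -> C) (l l' : C) :
  (u x : Co) @[x --> F] --> (l : Co) -> (u x : Co) @[x --> F] --> (l' : Co) ->
  l = l'.
Proof.
by move=> h h'; apply: (cvg_unique (@norm_hausdorff _ Co) h h').
Qed.

Lemma cvgc_lim (T : Type) (F : set_system T) {FF : ProperFilter F}
    (u : T -> Co) (l : C) : u @ F --> (l : Co) -> lim (u @ F) = l.
Proof. by move=> h; apply: (cvg_lim (@norm_hausdorff _ Co) h). Qed.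

Lemma cvgc_ext (T : Type) (F : set_system T) {FF : Filter F}
    (u v : T -> C) (l : C) : (forall x, u x = v x) ->
  (u x : Co) @[x --> F] --> (l : Co) -> (v x : Co) @[x --> F] --> (l : Co).
Proof. by move=> /funext ->. Qed.

Lemma cvgcD (T : Type) (F : set_system T) {FF : Filter F} (u v : T -> C)
    (l m : C) :
  (u x : Co) @[x --> F] --> (l : Co) -> (v x : Co) @[x --> F] --> (m : Co) ->
  ((u x + v x : C) : Co) @[x --> F] --> ((l + m : C) : Co).
Proof. exact: cvgD. Qed.

Lemma cvgcN (T : Type) (F : set_system T) {FF : Filter F} (u : T -> C)
    (l : C) :
  (u x : Co) @[x --> F] --> (l : Co) ->
  ((- u x : C) : Co) @[x --> F] --> ((- l : C) : Co).
Proof. exact: cvgN. Qed.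

Lemma cvgcM (T : Type) (F : set_system T) {FF : Filter F} (u v : T -> C)
    (l m : C) :
  (u x : Co) @[x --> F] --> (l : Co) -> (v x : Co) @[x --> F] --> (m : Co) ->
  ((u x * v x : C) : Co) @[x --> F] --> ((l * m : C) : Co).
Proof. exact: (@cvgM C T F FF u v l m). Qed.

Lemma cvgc_cst (T : Type) (F : set_system T) {FF : Filter F} (l : C) :
  (l : Co) @[x --> F] --> (l : Co).
Proof. exact: cvg_cst. Qed.

Lemma cvgcV (T : Type) (F : set_system T) {FF : Filter F} (u : T -> C)
    (l : C) : l != 0 ->
  (u x : Co) @[x --> F] --> (l : Co) ->
  (((u x)^-1 : C) : Co) @[x --> F] --> ((l^-1 : C) : Co).
Proof. exact: (@cvgV C T F FF u l). Qed.

Lemma cvgc_sum (T I : Type) (F : set_system T) {FF : Filter F} (s : seq I)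
    (u : I -> T -> C) (l : I -> C) :
  (forall i, (u i x : Co) @[x --> F] --> (l i : Co)) ->
  ((\sum_(i <- s) u i x : C) : Co) @[x --> F] --> ((\sum_(i <- s) l i : C) : Co).
Proof.
move=> h; elim: s => [|i s IH].
  rewrite big_nil; apply: (@cvgc_ext _ F FF (fun=> 0)); last exact: cvgc_cst.
  by move=> x; rewrite big_nil.
rewrite big_cons; apply: (@cvgc_ext _ F FF) (cvgcD (h i) IH) => x.
by rewrite big_cons.
Qed.

Lemma cvgc_conj (T : Type) (F : set_system T) {FF : Filter F} (u : T -> C)
    (l : C) :
  (u x : Co) @[x --> F] --> (l : Co) ->
  ((u x)^* : Co) @[x --> F] --> (l^* : Co).
Proof.
move=> /cvgcP h; apply/cvgcP => e /h; apply: filterS => x.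
by rewrite -rmorphB cabs_conj.
Qed.

Lemma cvg_cabs (T : Type) (F : set_system T) {FF : Filter F} (u : T -> C)
    (l : C) :
  (u x : Co) @[x --> F] --> (l : Co) -> cabs (u x) @[x --> F] --> cabs l.
Proof.
move=> /cvgcP h; apply/cvgrPdistC_lt => e /h; apply: filterS => x xe.
apply: le_lt_trans xe; rewrite ler_norml cabs_sub_ge andbT.
by rewrite lerNl opprB cabsC cabs_sub_ge.
Qed.

Lemma cvgc_ReIm (T : Type) (F : set_system T) {FF : Filter F} (u : T -> C)
    (l : C) :
  complex.Re (u x) @[x --> F] --> complex.Re l ->
  complex.Im (u x) @[x --> F] --> complex.Im l ->
  (u x : Co) @[x --> F] --> (l : Co).
Proof.
move=> /cvgrPdistC_lt hr /cvgrPdistC_lt hi; apply/cvgcP => e e0.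
have e20 : 0 < e / 2 by rewrite divr_gt0.
near=> x; apply: le_lt_trans (cabs_le_ReIm _) _.
rewrite ReB ImB (splitr e) ltrD //; near: x; [exact: hr | exact: hi].
Unshelve. all: by end_near. Qed.

Lemma cvgc_Re (T : Type) (F : set_system T) {FF : Filter F} (u : T -> C)
    (l : C) :
  (u x : Co) @[x --> F] --> (l : Co) ->
  complex.Re (u x) @[x --> F] --> complex.Re l.
Proof.
move=> /cvgcP h; apply/cvgrPdistC_lt => e /h; apply: filterS => x.
by apply: le_lt_trans; rewrite -ReB abs_Re_le.
Qed.

(** Completeness, transported from the real line coordinatewise. *)
Lemma cauchyc_cvg (T : Type) (F : set_system T) {FF : ProperFilter F}
    (u : T -> C) :
  (forall e : R, 0 < e -> exists x0, \forall x \near F, cabs (u x - u x0) < e) ->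
  exists l : C, (u x : Co) @[x --> F] --> (l : Co).
Proof.
move=> h.
have key (p : C -> R) : (forall z w, `|p z - p w| <= cabs (z - w)) ->
    cvg (p (u x) @[x --> F]).
  move=> hp; apply: cauchy_cvg; apply: cauchy_exP => e e0.
  have [x0 hx0] := h e e0; exists (p (u x0)).
  rewrite /fmap/=; apply: filterS hx0 => x; rewrite /ball /= => hx.
  by rewrite distrC (le_lt_trans (hp _ _)).
have /cvg_ex[/= a ha] := key (@complex.Re R)
  ltac:(by move=> z w; rewrite -ReB abs_Re_le).
have /cvg_ex[/= b hb] := key (@complex.Im R)
  ltac:(by move=> z w; rewrite -ImB abs_Im_le).
by exists (a +i* b); apply: cvgc_ReIm.
Qed.

End Limits.

(** * The complex exponential and the argument *)

Section Exponential.
Context {R : realType}.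
Local Notation C := R[i].
Implicit Types (z w : C) (t : R).

Lemma Re_cexp z : complex.Re (cexp z) = expR (complex.Re z) * cos (complex.Im z).
Proof. by rewrite /cexp ReM /= mul0r subr0. Qed.

Lemma Im_cexp z : complex.Im (cexp z) = expR (complex.Re z) * sin (complex.Im z).
Proof. by rewrite /cexp ImM /= mul0r addr0. Qed.

Lemma cexpD z w : cexp (z + w) = cexp z * cexp w.
Proof.
apply: eq_ReIm.
  by rewrite [RHS]ReM !Re_cexp !Im_cexp ReD ImD expRD cosD; ring.
by rewrite [RHS]ImM !Re_cexp !Im_cexp ReD ImD expRD sinD; ring.
Qed.

Lemma cexp0 : cexp (0 : C) = 1.
Proof.
by apply: eq_ReIm; rewrite ?Re_cexp ?Im_cexp /= expR0 ?cos0 ?sin0 ?mulr1 ?mulr0.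
Qed.

Lemma cabs_cexp z : cabs (cexp z) = expR (complex.Re z).
Proof.
apply/eqP; rewrite -(@eqrXn2 _ 2) ?cabs_ge0 ?expR_ge0 // sqr_cabs Re_cexp Im_cexp.
by rewrite !exprMn -mulrDr cos2Dsin2 mulr1.
Qed.

Lemma cexp_neq0 z : cexp z != 0.
Proof. by rewrite -cabs_gt0 cabs_cexp expR_gt0. Qed.

Lemma cexpN z : cexp (- z) = (cexp z)^-1.
Proof.
apply: (mulfI (cexp_neq0 z)); rewrite -cexpD subrr cexp0 divff ?cexp_neq0 //.
Qed.

Lemma cexp_conj z : cexp z^* = (cexp z)^*.
Proof.
apply: eq_ReIm; rewrite ?Re_conj ?Im_conj ?Re_cexp ?Im_cexp Re_conj Im_conj.
  by rewrite cosN.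
by rewrite sinN mulrN.
Qed.

Lemma cexp_sum (I : Type) (s : seq I) (P : pred I) (F : I -> C) :
  cexp (\sum_(i <- s | P i) F i) = \prod_(i <- s | P i) cexp (F i).
Proof. by elim/big_rec2: _ => [|i x y _ <-]; rewrite ?cexp0 // cexpD. Qed.

Lemma cexpX z n : cexp z ^+ n = cexp (n%:R * z).
Proof.
elim: n => [|n IH]; first by rewrite mul0r cexp0.
by rewrite exprS IH -cexpD mulrSr mulrDl mul1r addrC.
Qed.

Lemma cexp_real t : cexp t%:C = (expR t)%:C.
Proof.
by apply: eq_ReIm; rewrite ?Re_cexp ?Im_cexp /= ?cos0 ?sin0 ?mulr1 ?mulr0.
Qed.

Lemma cexp_i t : cexp (t *i) = cos t +i* sin t.
Proof. by apply: eq_ReIm; rewrite ?Re_cexp ?Im_cexp /= expR0 mul1r. Qed.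

Lemma imagD t u : (t + u) *i = t *i + u *i :> C.
Proof. by apply: eq_ReIm; rewrite ?ReD ?ImD /= ?addr0. Qed.

Lemma imagMn n t : n%:R * t *i = (n%:R * t) *i :> C.
Proof.
elim: n => [|n IH]; first by rewrite !mul0r.
by rewrite !mulrSr !mulrDl IH !mul1r imagD.
Qed.

Lemma cexp_2pi : cexp ((2 * pi) *i) = 1 :> C.
Proof. by rewrite cexp_i mulrC mulr_natr cos2pi sin2pi. Qed.

Lemma cexp_2pi_nat k : cexp ((2 * pi * k%:R) *i) = 1 :> C.
Proof. by rewrite mulrC -imagMn -cexpX cexp_2pi expr1n. Qed.

Lemma cabs_cexp_i t : cabs (cexp (t *i)) = 1.
Proof. by rewrite cabs_cexp /= expR0. Qed.

Lemma cexp_i_neq1 t : 0 < t < 2 * pi -> cexp (t *i) != 1 :> C.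
Proof.
move=> /andP[t0 tp]; apply/eqP => /(congr1 (@complex.Re R)).
rewrite cexp_i /= => ct.
have s0 : 0 < sin (t / 2) by apply: sin_gt0_pi; lra.
have := cos_mulr2n (t / 2).
rewrite (_ : t / 2 *+ 2 = t) ?ct; last by rewrite -mulr_natr divfK.
rewrite cos2sin2 => h.
have : sin (t / 2) ^+ 2 = 0 by rewrite -mulr_natr in h; lra.
by move/eqP; rewrite sqrf_eq0 gt_eqF.
Qed.

Lemma acos_range (z : C) : z != 0 -> -1 <= complex.Re z / cabs z <= 1.
Proof.
rewrite -cabs_gt0 => z0; have := abs_Re_le z.
by rewrite ler_norml ler_pdivlMr // ler_pdivrMr // mul1r mulN1r.
Qed.

Lemma carg_range z : z != 0 -> - pi < carg z <= pi.
Proof.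
move=> z0; have r := acos_range z0.
have h1 := acos_ge0 r; have h2 := acos_lepi r; have p0 := pi_gt0 R.
rewrite /carg; case: ifPn => [_|]; first by apply/andP; split; lra.
rewrite -ltNge => im0.
suff : acos (complex.Re z / cabs z) < pi by move=> h; apply/andP; split; lra.
apply: acos_ltpi; case/andP: r => r1 ->; rewrite andbT lt_def r1 andbT.
apply/eqP => e.
have z1 : 0 < cabs z by rewrite cabs_gt0.
have e1 : complex.Re z = - cabs z by rewrite -[LHS](divfK (lt0r_neq0 z1)) e mulN1r.
have := sqr_cabs z; rewrite e1 sqrrN => h.
have /eqP : complex.Im z ^+ 2 = 0 by lra.
by rewrite sqrf_eq0 lt_eqF.
Qed.

Lemma cexp_carg z : z != 0 -> z = (cabs z)%:C * cexp ((carg z) *i).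
Proof.
move=> z0; have r := acos_range z0.
have z1 : 0 < cabs z by rewrite cabs_gt0.
have zn := lt0r_neq0 z1.
have sq : 1 - (complex.Re z / cabs z) ^+ 2 = (complex.Im z / cabs z) ^+ 2.
  have n2 : complex.Re z ^+ 2 + complex.Im z ^+ 2 != 0.
    by rewrite -sqr_cabs expf_neq0.
  by rewrite !expr_div_n sqr_cabs; field.
have s : sin (carg z) = complex.Im z / cabs z.
  rewrite /carg; case: ifPn => im0.
    rewrite sin_acos // sq sqrtr_sqr ger0_norm //.
    by rewrite divr_ge0 // ltW.
  rewrite sinN sin_acos // sq sqrtr_sqr ltr0_norm ?opprK //.
  by rewrite pmulr_llt0 ?invr_gt0 // ltNge.
have c : cos (carg z) = complex.Re z / cabs z.
  have r' : complex.Re z / cabs z \in `[(-1 : R), 1] by rewrite in_itv.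
  by rewrite /carg; case: ifPn => im0; rewrite ?cosN acosK.
apply: eq_ReIm.
  by rewrite [RHS]ReM cexp_i /= c mul0r subr0 mulrC divfK.
by rewrite [RHS]ImM cexp_i /= s mul0r addr0 mulrC divfK.
Qed.

Lemma clog_exists z : z != 0 -> exists w, cexp w = z.
Proof.
move=> z0; exists ((ln (cabs z))%:C + (carg z) *i).
by rewrite cexpD cexp_real lnK ?posrE ?cabs_gt0 // -cexp_carg.
Qed.

Lemma cexp_i_inj t u : - (2 * pi) < t - u < 2 * pi ->
  cexp (t *i) = cexp (u *i) :> C -> t = u.
Proof.
move=> /andP[h1 h2] e.
wlog le : t u h1 h2 e / u <= t.
  move=> H; case: (leP u t) => [|/ltW] le; first exact: H.
  by apply/esym; apply: H => //; lra.
apply/eqP; case: (ltgtP u t) le => // ut _.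
have : cexp ((t - u) *i) = 1 :> C.
  rewrite imagD cexpD e -cexpD -imagD subrr.
  by rewrite -[0 *i]/(0 : C) cexp0.
by move/eqP; rewrite (negbTE (cexp_i_neq1 _)) // subr_gt0 ut.
Qed.

Lemma carg_unique (r t : R) : 0 < r -> - pi < t <= pi ->
  carg (r%:C * cexp (t *i)) = t.
Proof.
move=> r0 /andP[t1 t2]; set z := _ * _.
have az : cabs z = r by rewrite cabsM cabs_cexp_i mulr1 cabs_real gtr0_norm.
have z0 : z != 0 by rewrite -cabs_gt0 az.
have /andP[c1 c2] := carg_range z0.
apply: cexp_i_inj; first by apply/andP; split; lra.
have := cexp_carg z0; rewrite az {1}/z => /mulfI ->//.
by apply/eqP => -[] /eqP; rewrite gt_eqF.
Qed.

Lemma quotient_le (K : numFieldType) (h A d e : K) : h != 0 ->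
  (`|h^-1 * A - d| <= e) = (`|A - h * d| <= e * `|h|).
Proof.
move=> h0; have -> : A - h * d = (h^-1 * A - d) * h by field.
by rewrite normrM ler_pM2r ?normr_gt0.
Qed.

(** Differentiability without quotients, the form in which it is compared with
    [cdiff] below. *)
Lemma derivable_local (K : numFieldType) (f : K^o -> K^o) (x : K) :
  derivable f x 1 <-> exists d : K, forall e : K, 0 < e ->
    exists2 D : K, 0 < D &
      forall h : K, `|h| < D -> `|f (h + x) - f x - h * d| <= e * `|h|.
Proof.
have scale1 (h : K) : h *: (1 : K^o) = h by rewrite -[LHS]/(h * 1) mulr1.
split=> [/cvg_ex[/= d /cvgrPdistC_le hd]|[d hd]].
  exists d => e e0; have [/= D D0 hD] := hd e e0.
  exists D => // h hh; have [->|h0] := eqVneq h 0.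
    by rewrite add0r subrr mul0r subrr !normr0 mulr0.
  have := hD h; rewrite /ball_ /= sub0r normrN => /(_ hh h0).
  by rewrite scale1 (quotient_le _ _ _ h0).
apply/cvg_ex; exists d; apply/cvgrPdistC_le => e e0.
have [D D0 hD] := hd e e0; exists D => //= h; rewrite /ball_ /= sub0r normrN.
move=> hh h0; have := hD h hh.
by rewrite scale1 (quotient_le _ _ _ h0).
Qed.

Lemma is_derive_local (f : R -> R) (x d : R) : is_derive x 1 f d ->
  forall e : R, 0 < e -> exists2 D : R, 0 < D &
    forall h : R, `|h| < D -> `|f (h + x) - f x - h * d| <= e * `|h|.
Proof.
move=> [/cvg_ex[/= d' hd']] dd.
have hd : (h^-1 *: (f (h *: (1 : R) + x) - f x)) @[h --> 0^'] --> d.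
  by rewrite -dd /derive (cvg_lim _ hd').
move/cvgrPdistC_le : hd => hd e e0; have [/= D D0 hD] := hd e e0.
exists D => // h hh; have [->|h0] := eqVneq h 0.
  by rewrite add0r subrr mul0r subrr !normr0 mulr0.
have := hD h; rewrite /ball_ /= sub0r normrN => /(_ hh h0).
have -> : h *: (1 : R) = h by rewrite -[LHS]/(h * 1) mulr1.
by rewrite (quotient_le _ _ _ h0).
Qed.

(** The exponential is its own linearization at the origin: the product of the
    first-order expansions of [expR], [cos] and [sin]. *)
Lemma cexp_local (e : R) : 0 < e -> exists2 D : R, 0 < D &
  forall h : C, cabs h < D -> cabs (cexp h - 1 - h) <= e * cabs h.
Proof.
move=> e0.
have [e' e'0 [ge8 ge1]] : exists2 e', 0 < e' & e' <= e / 16 /\ e' <= 1.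
  exists (Num.min (e / 16) 1); first by rewrite lt_min ltr01 andbT divr_gt0.
  by rewrite !ge_min !lexx orbT.
have [D1 D10 h1] := is_derive_local (is_derive_expR 0) e'0.
have [D2 D20 h2] := is_derive_local (is_derive_cos 0) e'0.
have [D3 D30 h3] := is_derive_local (is_derive_sin 0) e'0.
exists (Num.min (Num.min D1 e') (Num.min D2 D3)).
  by rewrite !lt_min D10 e'0 D20 D30.
move=> h; rewrite !lt_min => /andP[/andP[l1 l4] /andP[l2 l3]].
have hx := abs_Re_le h; have hy := abs_Im_le h.
have {h1} := h1 _ (le_lt_trans hx l1).
have {h2} := h2 _ (le_lt_trans hy l2).
have {h3} := h3 _ (le_lt_trans hy l3).
rewrite !addr0 expR0 cos0 sin0 oppr0 mulr0 !mulr1 subr0 addr0.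
set x := complex.Re h in hx *; set y := complex.Im h in hy *.
set a := cabs h in hx hy l1 l2 l3 l4 *.
set X := expR x - 1 - x; set Y := cos y - 1; set S := sin y - y.
move=> hS hY hX.
have a0 : 0 <= a := cabs_ge0 h.
have ea : 0 <= e * a by rewrite mulr_ge0 // ltW.
have e'a : e' * a <= e / 16 * a by rewrite ler_wpM2r.
have a1 : a <= 1 by rewrite (le_trans (ltW l4)).
have bS : `|S| <= e' * a by apply: le_trans hS _; rewrite ler_wpM2l // ltW.
have bY : `|Y| <= e' * a by apply: le_trans hY _; rewrite ler_wpM2l // ltW.
have bX : `|X| <= e' * a by apply: le_trans hX _; rewrite ler_wpM2l // ltW.
have eR : complex.Re (cexp h - 1 - h) = X + Y * (1 + x + X).
  by rewrite !ReB Re_cexp /= -/x -/y /X /Y; ring.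
have eI : complex.Im (cexp h - 1 - h) = S + (x + X) * (y + S).
  by rewrite !ImB Im_cexp /= -/x -/y /X /S; ring.
apply: le_trans (cabs_le_ReIm _) _; rewrite eR eI.
have bx1 : `|x + X| <= a + e' * a by rewrite (le_trans (ler_normD _ _)) // lerD.
have by1 : `|y + S| <= a + e' * a by rewrite (le_trans (ler_normD _ _)) // lerD.
have e'a1 : e' * a <= a by rewrite ler_piMl.
have b3 : `|1 + x + X| <= 3.
  rewrite -addrA (le_trans (ler_normD _ _)) // normr1; lra.
have bYp : `|Y * (1 + x + X)| <= e' * a * 3 by rewrite normrM ler_pM.
have bSp : `|(x + X) * (y + S)| <= 2 * e' * (2 * a).
  rewrite normrM ler_pM //; last lra.
  by rewrite (le_trans bx1) //; lra.
have := ler_normD X (Y * (1 + x + X)); have := ler_normD S ((x + X) * (y + S)).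
lra.
Qed.

End Exponential.

(** * Complex differentiability *)

Section Differentiability.
Context {R : realType}.
Local Notation C := R[i].
Local Notation Co := (R[i]^o).
Implicit Types (f g : C -> C) (z w : C).

Lemma realcD (x y : R) : x%:C + y%:C = (x + y)%:C :> C.
Proof. by rewrite -(rmorphD (real_complex R)). Qed.

Lemma realcM (x y : R) : x%:C * y%:C = (x * y)%:C :> C.
Proof. by rewrite -(rmorphM (real_complex R)). Qed.

Lemma conjcD z w : (z + w)^* = z^* + w^*. Proof. exact: rmorphD. Qed.
Lemma conjcN z : (- z)^* = - z^*. Proof. exact: rmorphN. Qed.
Lemma conjcM z w : (z * w)^* = z^* * w^*. Proof. exact: rmorphM. Qed.

Lemma conjcI z : z^*^* = z. Proof. exact: conjcK. Qed.

Lemma conjcR (x : R) : (x%:C)^* = x%:C :> C.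
Proof. by apply: eq_ReIm; rewrite ?Re_conj ?Im_conj //= oppr0. Qed.

Lemma conjc_sum (I : Type) (s : seq I) (P : pred I) (F : I -> C) :
  (\sum_(i <- s | P i) F i)^* = \sum_(i <- s | P i) (F i)^*.
Proof. exact: rmorph_sum. Qed.

Lemma conjcX (z : C) n : (z ^+ n)^* = z^* ^+ n.
Proof. exact: rmorphXn. Qed.

Lemma conjcV (z : C) : (z^-1)^* = (z^*)^-1.
Proof. exact: fmorphV. Qed.

Lemma conjcZ0 : (0 : C)^* = 0. Proof. exact: rmorph0. Qed.
Lemma conjcO1 : (1 : C)^* = 1. Proof. exact: rmorph1. Qed.

Lemma conjc_prod (I : Type) (s : seq I) (P : pred I) (F : I -> C) :
  (\prod_(i <- s | P i) F i)^* = \prod_(i <- s | P i) (F i)^*.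
Proof. exact: rmorph_prod. Qed.

Lemma cvgc_at (u : C -> C) z (l : C) :
  (u w : Co) @[w --> (z : Co)] --> (l : Co) <->
  forall e : R, 0 < e -> exists2 D : R, 0 < D &
    forall w, cabs (w - z) < D -> cabs (u w - l) < e.
Proof.
split=> [/cvgcP h e /h /nbhscP //|h].
by apply: (proj2 (@cvgcP R Co (nbhs (z : Co)) _ u l)) => e /h /nbhscP.
Qed.

(** Continuity at a point, as an inductive predicate so that conversion never
    looks through it. *)
Variant ccts (u : C -> C) z : Prop :=
  Ccts of (u w : Co) @[w --> (z : Co)] --> (u z : Co).

Lemma cctsP (u : C -> C) z : ccts u z <-> forall e : R, 0 < e ->
  exists2 D : R, 0 < D & forall w, cabs (w - z) < D -> cabs (u w - u z) < e.
Proof.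
split=> [[h]|h]; first exact: (proj1 (cvgc_at u z (u z)) h).
exact: (Ccts (proj2 (cvgc_at u z (u z)) h)).
Qed.

Lemma ccts_cst (c : C) z : ccts (fun=> c) z.
Proof. constructor; exact: (@cvgc_cst R Co (nbhs (z : Co)) _). Qed.

Lemma ccts_id z : ccts (fun w => w) z.
Proof. constructor; exact: cvg_id. Qed.

Lemma cctsD (u v : C -> C) z : ccts u z -> ccts v z -> ccts (fun w => u w + v w) z.
Proof.
move=> [hu] [hv]; constructor.
exact: (@cvgcD R Co (nbhs (z : Co)) _ u v (u z) (v z) hu hv). Qed.

Lemma cctsN (u : C -> C) z : ccts u z -> ccts (fun w => - u w) z.
Proof.
move=> [hu]; constructor.
exact: (@cvgcN R Co (nbhs (z : Co)) _ u (u z) hu). Qed.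

Lemma cctsM (u v : C -> C) z : ccts u z -> ccts v z -> ccts (fun w => u w * v w) z.
Proof.
move=> [hu] [hv]; constructor.
exact: (@cvgcM R Co (nbhs (z : Co)) _ u v (u z) (v z) hu hv). Qed.

Lemma cctsV (u : C -> C) z : u z != 0 -> ccts u z -> ccts (fun w => (u w)^-1) z.
Proof.
move=> uz [hu]; constructor.
exact: (@cvgcV R Co (nbhs (z : Co)) _ u (u z) uz hu). Qed.

Lemma ccts_comp (u v : C -> C) z : ccts v z -> ccts u (v z) ->
  ccts (fun w => u (v w)) z.
Proof.
move=> hv /cctsP hu; apply/cctsP => e /hu[D1 D10 h1].
have /cctsP/(_ _ D10)[D D0 h] := hv; exists D => // w /h; exact: h1.
Qed.

Lemma ccts_ext (u v : C -> C) z : u =1 v -> ccts u z -> ccts v z.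
Proof. by move=> /funext ->. Qed.

Lemma ccts_conj z : ccts (@conjc R) z.
Proof. by apply/cctsP => e e0; exists e => // w; rewrite -rmorphB cabs_conj. Qed.

(** Complex differentiability in the form of Caratheodory, in which sums,
    products and compositions are differentiated without quotients. *)
Definition cdiff f z : Prop :=
  exists2 phi : C -> C, ccts phi z & forall w, f w = f z + (w - z) * phi w.

Lemma cdiff_local f z : cdiff f z <-> exists d : C, forall e : R, 0 < e ->
  exists2 D : R, 0 < D & forall w, cabs (w - z) < D ->
    cabs (f w - f z - (w - z) * d) <= e * cabs (w - z).
Proof.
split=> [[phi /cctsP hphi fE]|[d hd]].
  exists (phi z) => e /hphi[D D0 hD]; exists D => // w /hD h.
  have -> : f w - f z - (w - z) * phi z = (phi w - phi z) * (w - z).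
    by rewrite fE; ring.
  by rewrite cabsM ler_wpM2r ?cabs_ge0 // ltW.
pose phi w := if w == z then d else (f w - f z) / (w - z).
exists phi; last first.
  move=> w; rewrite /phi; case: eqVneq => [->|wz]; first by rewrite subrr mul0r addr0.
  by rewrite mulrC divfK ?subr_eq0 // addrC subrK.
apply/cctsP => e e0; have [|D D0 hD] := hd (e / 2); first by rewrite divr_gt0.
exists D => // w /hD; rewrite /phi eqxx.
case: eqVneq => [-> _|wz]; first by rewrite subrr cabs0.
have wz0 : w - z != 0 by rewrite subr_eq0.
have -> : f w - f z - (w - z) * d = ((f w - f z) / (w - z) - d) * (w - z) by field.
rewrite cabsM ler_pM2r ?cabs_gt0 // => h; apply: le_lt_trans h _; lra.
Qed.

Lemma entireP f : entire f <-> forall z, cdiff f z.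
Proof.
split=> h z.
  apply/cdiff_local; have /derivable_local[d hd] := h z.
  exists d => e e0; have [|D D0 hD] := hd e%:C; first by rewrite ltcR.
  have [rD iD] : 0 < complex.Re D /\ D = (complex.Re D)%:C.
    by case: D D0 {hD} => a b; rewrite ltcE /= => /andP[/eqP -> ].
  exists (complex.Re D) => // w wz.
  have := hD (w - z); rewrite subrK normC_cabs iD ltcR => /(_ wz).
  by rewrite !normC_cabs realcM lecR.
have /cdiff_local[d hd] := h z; apply/derivable_local; exists d => e.
case: e => a b; rewrite ltcE /= => /andP[/eqP -> a0].
have [D D0 hD] := hd a a0; exists D%:C; first by rewrite ltcR.
move=> k; rewrite !normC_cabs ltcR => kD; have := hD (k + z).
by rewrite addrK realcM lecR; apply.
Qed.

Lemma cdiff_cts f z : cdiff f z -> ccts f z.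
Proof.
move=> [phi hphi fE]; apply: ccts_ext (fun w => esym (fE w)) _.
apply: cctsD; first exact: ccts_cst.
by apply: cctsM hphi; apply: cctsD; [exact: ccts_id | exact: ccts_cst].
Qed.

Lemma cdiff_cst (c : C) z : cdiff (fun=> c) z.
Proof. by exists (fun=> 0) => [|w]; [apply: ccts_cst | rewrite mulr0 addr0]. Qed.

Lemma cdiff_id z : cdiff (fun w => w) z.
Proof. by exists (fun=> 1) => [|w]; [apply: ccts_cst | rewrite mulr1 addrC subrK]. Qed.

Lemma cdiffD f g z : cdiff f z -> cdiff g z -> cdiff (fun w => f w + g w) z.
Proof.
move=> [p hp fE] [q hq gE]; exists (fun w => p w + q w); first exact: cctsD.
by move=> w; rewrite fE gE; ring.
Qed.

Lemma cdiffN f z : cdiff f z -> cdiff (fun w => - f w) z.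
Proof.
move=> [p hp fE]; exists (fun w => - p w); first exact: cctsN.
by move=> w; rewrite fE; ring.
Qed.

Lemma cdiffB f g z : cdiff f z -> cdiff g z -> cdiff (fun w => f w - g w) z.
Proof. by move=> hf hg; apply: cdiffD => //; apply: cdiffN. Qed.

Lemma cdiffM f g z : cdiff f z -> cdiff g z -> cdiff (fun w => f w * g w) z.
Proof.
move=> hf hg; move: (hf) (hg) => [p hp fE] [q hq gE].
exists (fun w => p w * g w + f z * q w).
  apply: cctsD; first exact: cctsM hp (cdiff_cts hg).
  by apply: cctsM hq; apply: ccts_cst.
by move=> w; rewrite fE gE; ring.
Qed.

Lemma cdiffV f z : f z != 0 -> cdiff f z -> cdiff (fun w => (f w)^-1) z.
Proof.
move=> fz0 hf; apply/cdiff_local; move: (hf) => [p hp fE].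
pose q w := - p w / (f w * f z).
have hq : ccts q z.
  apply: cctsM (cctsN hp) _; apply: cctsV; first by rewrite mulf_neq0.
  by apply: cctsM (cdiff_cts hf) _; apply: ccts_cst.
exists (q z) => e e0.
have /cctsP/(_ _ e0)[D1 D10 h1] := hq.
have fz00 : 0 < cabs (f z) by rewrite cabs_gt0.
have /cctsP/(_ _ fz00)[D2 D20 h2] := cdiff_cts hf.
exists (Num.min D1 D2); first by rewrite lt_min D10.
move=> w; rewrite lt_min => /andP[/h1 l1 /h2 l2].
have fw0 : f w != 0.
  apply/eqP => fw0; move: l2; rewrite fw0 sub0r cabsN; lra.
have -> : (f w)^-1 - (f z)^-1 - (w - z) * q z = (q w - q z) * (w - z).
  have E : (f w)^-1 - (f z)^-1 = (w - z) * q w.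
    rewrite /q; have -> : (w - z) * (- p w / (f w * f z)) =
      - ((w - z) * p w) / (f w * f z) by ring.
    have -> : (w - z) * p w = f w - f z by rewrite fE; ring.
    by field; rewrite fw0 fz0.
  by rewrite E; ring.
by rewrite cabsM ler_wpM2r ?cabs_ge0 // ltW.
Qed.

Lemma cdiff_comp f g z : cdiff g z -> cdiff f (g z) -> cdiff (fun w => f (g w)) z.
Proof.
move=> hg; move: (hg) => [q hq gE] [p hp fE]; exists (fun w => q w * p (g w)).
  exact: cctsM hq (ccts_comp (cdiff_cts hg) hp).
by move=> w; rewrite fE [in g w - g z]gE; ring.
Qed.

Lemma cdiff_conj f z : cdiff f z^* -> cdiff (fun w => (f w^*)^*) z.
Proof.
move=> [p hp fE]; exists (fun w => (p w^*)^*); last first.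
  by move=> w; rewrite fE; rewrite !(conjcD, conjcM, conjcN); rewrite !conjcI.
have h : ccts (fun w => p w^*) z by apply: ccts_comp hp; apply: ccts_conj.
exact: (@ccts_comp (@conjc R) _ z h (@ccts_conj _)).
Qed.

Lemma cdiffX f z n : cdiff f z -> cdiff (fun w => f w ^+ n) z.
Proof.
move=> h; elim: n => [|n IH]; first exact: cdiff_cst.
rewrite (_ : (fun w => f w ^+ n.+1) = (fun w => f w * f w ^+ n)).
  exact: cdiffM.
by apply/funext => w; rewrite exprS.
Qed.

Lemma cdiff_prod (I : Type) (s : seq I) (F : I -> C -> C) z :
  (forall i, cdiff (F i) z) -> cdiff (fun w => \prod_(i <- s) F i w) z.
Proof.
move=> h; elim: s => [|i s IH].
  rewrite (_ : (fun w => _) = (fun=> 1)); first exact: cdiff_cst.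
  by apply/funext => w; rewrite big_nil.
rewrite (_ : (fun w => _) = (fun w => F i w * \prod_(i <- s) F i w)).
  exact: cdiffM.
by apply/funext => w; rewrite big_cons.
Qed.

Lemma cdiff_cexp z : cdiff (@cexp R) z.
Proof.
apply/cdiff_local; exists (cexp z) => e e0.
have [|D D0 hD] := @cexp_local R (e / cabs (cexp z)).
  by rewrite divr_gt0 // cabs_gt0 cexp_neq0.
exists D => // w /hD h.
have -> : cexp w - cexp z - (w - z) * cexp z =
    cexp z * (cexp (w - z) - 1 - (w - z)).
  by rewrite -{1}(subrK z w) (cexpD (w - z) z); ring.
rewrite cabsM mulrC -ler_pdivlMr ?cabs_gt0 ?cexp_neq0 //.
by rewrite mulrAC.
Qed.

Lemma cdiff_near f g z : (\forall w \near (z : Co), f w = g w) ->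
  cdiff f z -> cdiff g z.
Proof.
move=> /nbhscP[D1 D10 fg] /cdiff_local[d hd]; apply/cdiff_local; exists d => e e0.
have [D2 D20 hD] := hd e e0; exists (Num.min D1 D2); first by rewrite lt_min D10.
move=> w; rewrite lt_min => /andP[l1 l2].
by rewrite -!fg ?hD // subrr cabs0.
Qed.

End Differentiability.

(** * Bisection and the mean value inequality *)

Section Dyadic.
Context {R : realType}.
Local Notation C := R[i].

Local Notation h k := ((2 : R) ^- k).

Lemma dyadic_half k : h k = h k.+1 + h k.+1.
Proof. by rewrite exprSr invfM; lra. Qed.

Lemma dyadic_gt0 k : 0 < h k.
Proof. by rewrite invr_gt0 exprn_gt0. Qed.

Lemma dyadic_small (L D : R) : 0 <= L -> 0 < D ->
  exists K, forall k, (K <= k)%N -> h k * L < D.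
Proof.
move=> L0 D0.
have /cvgrPdist_lt/(_ _ D0) : h k * L @[k --> \oo] --> (0 : R).
  rewrite -(mul0r L); apply: cvgMr_tmp.
  apply: (@cvg_trans _ ((1 / 2 : R) ^+ k @[k --> \oo])); last first.
    by apply: cvg_expr; rewrite ger0_norm; lra.
  by apply: near_eq_cvg; apply: nearW => k; rewrite expr_div_n expr1n mul1r.
move=> [K _ hK]; exists K => k /hK /=; rewrite sub0r normrN ger0_norm //.
by rewrite mulr_ge0 // ltW ?dyadic_gt0.
Qed.

(** Compactness in the form of bisection: if a property of dyadic squares
    passes from the four quarters to the whole and holds for all small squares
    around any given point, then a failure at the unit square would propagate
    to a nested sequence of squares, and contradict the property of small
    squares at their common point. *)
Lemma dyadic_squares (P : nat -> R -> R -> Prop) :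
  (forall k x y, P k.+1 x y -> P k.+1 (x + h k.+1) y -> P k.+1 x (y + h k.+1) ->
     P k.+1 (x + h k.+1) (y + h k.+1) -> P k x y) ->
  (forall x y, 0 <= x <= 1 -> 0 <= y <= 1 -> exists K, forall k x' y', (K <= k)%N ->
     x' <= x <= x' + h k -> y' <= y <= y' + h k -> P k x' y') ->
  P 0%N 0 0.
Proof.
move=> glue loc; apply: contrapT => nP.
pose T := {p : nat * (R * R) | ~ P p.1 p.2.1 p.2.2}.
have next (p : T) : exists q : T, [/\ (sval q).1 = (sval p).1.+1,
    (sval p).2.1 <= (sval q).2.1 <= (sval p).2.1 + h (sval p).1.+1 &
    (sval p).2.2 <= (sval q).2.2 <= (sval p).2.2 + h (sval p).1.+1].
  case: p => -[k [x y]] /= np.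
  have h0 := dyadic_gt0 k.+1.
  have [a [b [nq ha hb]]] : exists a b, [/\ ~ P k.+1 a b,
      x <= a <= x + h k.+1 & y <= b <= y + h k.+1].
    apply: contrapT => H; apply: np; apply: glue; apply: contrapT => nq; apply: H.
    - by exists x, y; split=> //; apply/andP; split; lra.
    - by exists (x + h k.+1), y; split=> //; apply/andP; split; lra.
    - by exists x, (y + h k.+1); split=> //; apply/andP; split; lra.
    - by exists (x + h k.+1), (y + h k.+1); split=> //; apply/andP; split; lra.
  by exists (exist _ (k.+1, (a, b)) nq).
have [nx hnx] := choice next.
pose s := fix s n := if n is m.+1 then nx (s m) else (exist _ (0%N, (0, 0)) nP : T).
have sk n : (sval (s n)).1 = n by elim: n => //= n IH; case: (hnx (s n)) => ->; rewrite IH.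
have squeeze (X : nat -> R) : X 0%N = 0 ->
    (forall n, X n <= X n.+1 <= X n + h n.+1) ->
    exists2 x, 0 <= x <= 1 & forall n, X n <= x <= X n + h n.
  move=> X0 hX.
  have mono n m : X n <= X (n + m)%N <= X n + h n - h (n + m)%N.
    elim: m => [|m /andP[a b]]; first by rewrite addn0 lexx addrK lexx.
    have /andP[c d] := hX (n + m)%N; have := dyadic_half (n + m).
    by rewrite addnS => e; apply/andP; split; lra.
  have ub n m : X m <= X n + h n.
    have [nm|/ltnW mn] := leqP n m.
      have := mono n (m - n)%N; rewrite subnKC // => /andP[_].
      have := dyadic_gt0 m; lra.
    have := mono m (n - m)%N; rewrite subnKC // => /andP[].
    have := dyadic_gt0 n; lra.
  have hs : has_sup (range X).
    by split; [exists (X 0%N), 0%N | exists (X 0%N + h 0%N) => _ [m _ <-]; apply: ub].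
  have hx n : X n <= sup (range X) <= X n + h n.
    apply/andP; split; first by apply: ub_le_sup; [exact: hs.2 | exists n].
    by apply: ge_sup; [exact: hs.1 | move=> _ [m _ <-]; apply: ub].
  exists (sup (range X)) => //; have := hx 0%N.
  by rewrite X0 expr0 invr1 add0r.
have [n|x x01 hx] := squeeze (fun n => (sval (s n)).2.1) erefl.
  by have [_ + _] := hnx (s n); rewrite sk.
have [n|y y01 hy] := squeeze (fun n => (sval (s n)).2.2) erefl.
  by have [_ _] := hnx (s n); rewrite sk.
have [K hK] := loc x y x01 y01.
by case: (svalP (s K)); rewrite sk; apply: hK.
Qed.

Definition is_cderiv (f : C -> C) (z d : C) : Prop :=
  exists2 phi : C -> C, ccts phi z /\ phi z = d &
    forall w, f w = f z + (w - z) * phi w.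

Lemma is_cderiv_local f z d : is_cderiv f z d -> forall e : R, 0 < e ->
  exists2 D : R, 0 < D & forall w, cabs (w - z) < D ->
    cabs (f w - f z) <= (cabs d + e) * cabs (w - z).
Proof.
move=> [phi [/cctsP hphi pz] fE] e e0; have [D D0 hD] := hphi e e0.
exists D => // w /hD; rewrite pz => h.
have -> : f w - f z = (w - z) * phi w by rewrite fE; ring.
rewrite cabsM mulrC ler_wpM2r ?cabs_ge0 //.
have := cabs_sub_ge (phi w) d; lra.
Qed.

Lemma is_cderiv_ext f z d d' : d = d' -> is_cderiv f z d -> is_cderiv f z d'.
Proof. by move->. Qed.

Lemma is_cderivM f g z d e : is_cderiv f z d -> is_cderiv g z e ->
  is_cderiv (fun w => f w * g w) z (d * g z + f z * e).
Proof.
move=> [p [hp pz] fE] [q [hq qz] gE].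
have hg : ccts g z by apply: cdiff_cts; exists q.
exists (fun w => p w * g w + f z * q w); last by move=> w; rewrite fE gE; ring.
split; last by rewrite pz qz.
apply: cctsD; first exact: cctsM hp hg.
by apply: cctsM hq; apply: ccts_cst.
Qed.

Lemma is_cderivD f g z d e : is_cderiv f z d -> is_cderiv g z e ->
  is_cderiv (fun w => f w + g w) z (d + e).
Proof.
move=> [p [hp pz] fE] [q [hq qz] gE].
exists (fun w => p w + q w); last by move=> w; rewrite fE gE; ring.
by split; [exact: cctsD hp hq | rewrite pz qz].
Qed.

Lemma is_cderiv_affine (a b : C) z : is_cderiv (fun w => a * w + b) z a.
Proof.
by exists (fun=> a); [split=> //; apply: ccts_cst | move=> w; ring].
Qed.

Lemma is_cderivXn n z : is_cderiv (fun w => w ^+ n.+1) z (n.+1%:R * z ^+ n).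
Proof.
elim: n => [|n IH].
  rewrite (_ : (fun w => _) = (fun w => 1 * w + 0)); last first.
    by apply/funext => w; rewrite expr1 mul1r addr0.
  by rewrite expr0 mulr1; apply: is_cderiv_affine.
rewrite (_ : (fun w => _) = (fun w => (1 * w + 0) * w ^+ n.+1)); last first.
  by apply/funext => w; rewrite exprS mul1r addr0.
apply: is_cderiv_ext (is_cderivM (is_cderiv_affine 1 0 z) IH).
by rewrite mul1r addr0 mul1r !exprS (mulrSr _ n.+1); ring.
Qed.

Lemma is_cderiv_cexp f z d : is_cderiv f z d ->
  is_cderiv (fun w => cexp (f w)) z (cexp (f z) * d).
Proof.
move=> [p [hp pz] fE].
have hf : ccts f z by apply: cdiff_cts; exists p.
have [q hq qE] := cdiff_cexp (f z).
have qz : q (f z) = cexp (f z).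
  (* the slope of the exponential at a point is its value there *)
  apply/eqP; rewrite -subr_eq0 -cabs_eq0 eq_le cabs_ge0 andbT.
  apply/ler_addgt0Pr => e e0; rewrite add0r.
  have e20 : 0 < e / 2 by rewrite divr_gt0.
  have /cctsP/(_ _ e20)[D D0 hD] := hq.
  have n0 : 0 < cabs (cexp (f z)) by rewrite cabs_gt0 cexp_neq0.
  have [|D' D'0 hD'] := @cexp_local R (e / 2 / cabs (cexp (f z))).
    by rewrite divr_gt0.
  have [t t0 [tD tD']] : exists2 t : R, 0 < t & t < D /\ t < D'.
    exists (Num.min D D' / 2); first by rewrite divr_gt0 // lt_min D0.
    by split; rewrite ltr_pdivrMr // mulr_natr; rewrite gt_min; apply/orP;
       [left|right]; rewrite mulr2n ltrDl.
  have at0 : cabs t%:C = t by rewrite cabs_real gtr0_norm.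
  have t1 : t%:C != 0 by rewrite -cabs_gt0 at0.
  have e1 : f z + t%:C - f z = t%:C by ring.
  have h1 : cabs (q (f z + t%:C) - q (f z)) < e / 2 by apply: hD; rewrite e1 at0.
  have h2 : cabs (q (f z + t%:C) - cexp (f z)) <= e / 2.
    have -> : q (f z + t%:C) - cexp (f z) = cexp (f z) * (cexp t%:C - 1 - t%:C) / t%:C.
      have := qE (f z + t%:C); rewrite cexpD e1 => E.
      have -> : cexp (f z) * (cexp t%:C - 1 - t%:C) / t%:C =
          (cexp (f z) * cexp t%:C - cexp (f z)) / t%:C - cexp (f z) by field.
      by rewrite E; field.
    have := hD' t%:C; rewrite at0 => /(_ tD') h3.
    rewrite cabsM (cabsM (cexp _)) cabsV at0 ler_pdivrMr // -ler_pdivlMl //.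
    by apply: le_trans h3 _; rewrite le_eqVlt; apply/orP; left; apply/eqP; field; rewrite gt_eqF.
  have := cabs_triangle (q (f z + t%:C)) (q (f z)) (cexp (f z)).
  by rewrite (cabsC (q (f z)) (q (f z + t%:C))); lra.
exists (fun w => q (f w) * p w).
  by rewrite qz pz; split=> //; apply: cctsM hp; apply: ccts_comp hf hq.
by move=> w; rewrite qE [in f w - f z]fE; ring.
Qed.

(** The inequality up to [e] is additive over adjacent segments and holds on
    small ones by the definition of the derivative. The one-dimensional
    bisection is that of [dyadic_squares], applied to a property that does not
    depend on the second coordinate. *)
Lemma mean_value_le (F : C -> C) (u : C) (B : R) :
  (forall t : R, 0 <= t <= 1 ->
     exists2 d, is_cderiv F (t%:C * u) d & cabs d <= B) ->
  cabs (F u - F 0) <= B * cabs u.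
Proof.
move=> hF.
have [->|u0] := eqVneq u 0; first by rewrite subrr cabs0 mulr0.
have au : 0 < cabs u by rewrite cabs_gt0.
apply/ler_addgt0Pr => e e0; pose e' := e / cabs u.
have e'0 : 0 < e' by rewrite divr_gt0.
pose G (x : R) := F (x%:C * u).
pose P k (x y : R) := cabs (G (x + h k) - G x) <= (B + e') * (h k * cabs u).
have := @dyadic_squares P; rewrite /P /G expr0 invr1 add0r !mul1r mul0r.
rewrite mulrDl /e' divfK ?gt_eqF //; apply.
  move=> k x y h1 h2 _ _; rewrite (dyadic_half k) addrA.
  have := cabs_triangle (F ((x + h k.+1)%:C * u)) (F ((x + h k.+1 + h k.+1)%:C * u))
    (F (x%:C * u)).
  by lra.
move=> x y x01 _; have [d hd dB] := hF x x01.
have [D D0 hD] := is_cderiv_local hd e'0.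
have [K hK] := dyadic_small (cabs_ge0 u) D0.
exists K => k x' y' /hK hk /andP[l1 l2] _.
have h0 := dyadic_gt0 k.
have step (t : R) : `|t - x| <= h k -> cabs (F (t%:C * u) - F (x%:C * u)) <=
    (B + e') * (`|t - x| * cabs u).
  move=> tx.
  have E : cabs (t%:C * u - x%:C * u) = `|t - x| * cabs u.
    by rewrite -mulrBl cabsM -rmorphB cabs_real.
  have le : `|t - x| * cabs u < D.
    by apply: le_lt_trans hk; rewrite ler_wpM2r // ltW.
  have := hD (t%:C * u); rewrite E => /(_ le) h1; apply: le_trans h1 _.
  by rewrite ler_wpM2r ?mulr_ge0 ?cabs_ge0 // lerD2r.
have := step (x' + h k); rewrite ger0_norm; last lra.
have := step x'; rewrite ler0_norm; last lra.
have := cabs_triangle (F (x%:C * u)) (F ((x' + h k)%:C * u)) (F (x'%:C * u)).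
rewrite (cabsC (F (x%:C * u)) (F (x'%:C * u))) => a b c.
have {}b : cabs (F (x'%:C * u) - F (x%:C * u)) <= (B + e') * (- (x' - x) * cabs u) by apply: b; lra.
have {}c : cabs (F ((x' + h k)%:C * u) - F (x%:C * u)) <=
   (B + e') * ((x' + h k - x) * cabs u) by apply: c; lra.
apply: le_trans a _; apply: le_trans (lerD c b) _.
by rewrite -mulrDr -mulrDl le_eqVlt; apply/orP; left; apply/eqP; congr (_ * (_ * _)); ring.
Qed.

End Dyadic.

(** * Primary factors *)

Section PrimaryFactors.
Context {R : realType}.
Local Notation C := R[i].
Local Notation Co := (R[i]^o).

(** The truncation of [- log (1 - z)], which is the exponent in a primary
    factor. *)
Definition log_poly (p : nat) (z : C) : C := \sum_(1 <= j < p.+1) z ^+ j / j%:R.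

Lemma primary_factorE p z : primary_factor p z = (1 - z) * cexp (log_poly p z).
Proof. by []. Qed.

Lemma log_polyS p z : log_poly p.+1 z = log_poly p z + z ^+ p.+1 / p.+1%:R.
Proof. by rewrite /log_poly big_nat_recr. Qed.

Lemma log_poly_z0 p : log_poly p 0 = 0.
Proof.
elim: p => [|p IH]; first by rewrite /log_poly big_geq.
by rewrite log_polyS IH exprS !mul0r addr0.
Qed.

Lemma primary_factor_z0 p : primary_factor p (0 : C) = 1.
Proof. by rewrite primary_factorE log_poly_z0 cexp0 subr0 mulr1. Qed.

Lemma primary_factor_eq0 p (z : C) : (primary_factor p z == 0) = (z == 1).
Proof.
by rewrite primary_factorE mulf_eq0 (negbTE (cexp_neq0 _)) orbF subr_eq0 eq_sym.
Qed.

Lemma log_poly_deriv p (z : C) : is_cderiv (log_poly p) z (\sum_(i < p) z ^+ i).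
Proof.
elim: p => [|p IH].
  rewrite big_ord0 (_ : log_poly 0 = (fun w => 0 * w + 0)); last first.
    by apply/funext => w; rewrite /log_poly big_geq // mul0r addr0.
  exact: is_cderiv_affine.
have n0 : p.+1%:R != 0 :> C by rewrite pnatr_eq0.
rewrite (_ : log_poly _ = (fun w => log_poly p w + (0 * w + p.+1%:R^-1) * w ^+ p.+1)); last first.
  by apply/funext => w; rewrite log_polyS mul0r add0r (mulrC (_^-1)).
apply: is_cderiv_ext (is_cderivD IH (is_cderivM (is_cderiv_affine 0 _ z) (is_cderivXn p z))).
by rewrite big_ord_recr /= !mul0r !add0r mulKf.
Qed.

(** The derivative of [log_poly p] is a geometric sum, so that its product
    with [1 - z] is [1 - z ^+ p]. *)
Lemma primary_factor_deriv p (z : C) :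
  is_cderiv (primary_factor p) z (- (z ^+ p * cexp (log_poly p z))).
Proof.
rewrite (_ : primary_factor p = (fun w => (-1 * w + 1) * cexp (log_poly p w))); last first.
  by apply/funext => w; rewrite primary_factorE mulN1r (addrC (- w)).
apply: is_cderiv_ext (is_cderivM (is_cderiv_affine (-1) 1 z) (is_cderiv_cexp (log_poly_deriv p z))).
have := subrX1 z p; set s := \sum_(i < p) _ => e.
have -> : z ^+ p = 1 + (z - 1) * s by rewrite -e addrC subrK.
by ring.
Qed.

Lemma geometric_le (r : R) n : 0 <= r < 1 -> \sum_(i < n) r ^+ i <= (1 - r)^-1.
Proof.
move=> /andP[r0 r1]; have h : 0 < 1 - r by rewrite subr_gt0.
rewrite -[X in _ <= X]mul1r ler_pdivlMr //.
have := subrX1 r n; set s := \sum_(i < n) _ => e.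
have := exprn_ge0 n r0; lra.
Qed.

Lemma geometric_tail (M q : R) n m : 0 <= M -> 0 <= q <= 2^-1 ->
  \sum_(n <= k < m) M * q ^+ k <= 2 * M * q ^+ n.
Proof.
move=> M0 /andP[q0 q1]; have [mn|/ltnW nm] := leqP m n.
  by rewrite big_geq // !mulr_ge0 // exprn_ge0.
rewrite -{1}(subnK nm) -{1}(add0n n) big_addn addnK big_mkord.
rewrite (eq_bigr (fun i : 'I_(m - n) => M * q ^+ n * q ^+ i)); last first.
  by move=> i _; rewrite exprD; ring.
rewrite -mulr_sumr mulrAC ler_wpM2r ?exprn_ge0 // mulrC ler_wpM2r //.
apply: le_trans (geometric_le _ _) _; first by apply/andP; split; lra.
by rewrite -[X in _ <= X]invrK lef_pV2 ?posrE; lra.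
Qed.

Lemma cabs_log_poly_le p (z : C) : cabs z < 1 ->
  cabs (log_poly p z) <= cabs z / (1 - cabs z).
Proof.
move=> z1; have z0 := cabs_ge0 z.
apply: le_trans (cabs_sum _ _ _) _.
rewrite big_add1 /= big_mkord.
apply: (@le_trans _ _ (cabs z * \sum_(i < p) cabs z ^+ i)); last first.
  by rewrite ler_wpM2l // geometric_le // z0.
rewrite mulr_sumr; apply: ler_sum => i _.
rewrite cabsM cabsV cabs_nat cabsX exprS ler_pdivrMr ?ltr0n //.
by rewrite ler_peMr ?mulr_ge0 ?exprn_ge0 // ler1n.
Qed.

(** The derivative of a primary factor is of order [p] at the origin; the mean
    value inequality raises the order by one. *)
Lemma primary_factor_le p (z : C) : cabs z < 1 ->
  cabs (primary_factor p z - 1) <= cabs z ^+ p.+1 * expR (cabs z / (1 - cabs z)).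
Proof.
move=> z1; have z0 := cabs_ge0 z.
rewrite -{1}(primary_factor_z0 p) exprSr mulrAC.
apply: mean_value_le => t /andP[t0 t1].
exists (- ((t%:C * z) ^+ p * cexp (log_poly p (t%:C * z)))).
  exact: primary_factor_deriv.
have le : cabs (t%:C * z) <= cabs z.
  by rewrite cabsM cabs_real ger0_norm // ler_piMl.
rewrite cabsN (cabsM (_ ^+ _)) cabsX cabs_cexp.
apply: ler_pM; rewrite ?exprn_ge0 ?expR_ge0 ?cabs_ge0 //.
  by rewrite lerXn2r ?nnegrE ?cabs_ge0.
rewrite ler_expR; apply: le_trans (Re_le_cabs _) _.
apply: le_trans (cabs_log_poly_le _ (le_lt_trans le z1)) _.
apply: ler_pM; rewrite ?cabs_ge0 ?invr_ge0 //; last first.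
  by rewrite lef_pV2 ?posrE; lra.
by rewrite subr_ge0 ltW // (le_lt_trans le).
Qed.

Lemma cexp_sub1_le (z : C) : cabs (cexp z - 1) <= cabs z * expR (cabs z).
Proof.
rewrite -{1}cexp0 mulrC; apply: mean_value_le => t /andP[t0 t1].
exists (cexp (1 * (t%:C * z) + 0) * 1).
  have := is_cderiv_cexp (is_cderiv_affine 1 0 (t%:C * z)).
  by rewrite (_ : (fun w => _) = @cexp R) //; apply/funext => w; rewrite mul1r addr0.
rewrite mulr1 mul1r addr0 cabs_cexp ler_expR; apply: le_trans (Re_le_cabs _) _.
by rewrite cabsM cabs_real ger0_norm // ler_piMl ?cabs_ge0.
Qed.

Lemma expR_half_le2 : expR (2^-1 : R) <= 2.
Proof.
have : expR (- 2^-1 : R) > 2^-1.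
  have := @expR_gt1Dx R (- 2^-1); rewrite oppr_eq0 invr_eq0 pnatr_eq0 => /(_ isT).
  lra.
by rewrite expRN ltf_pV2 ?posrE // => /ltW; apply; apply: expR_gt0.
Qed.

Lemma expR1_le4 : expR (1 : R) <= 4.
Proof.
have -> : (1 : R) = 2^-1 + 2^-1 by lra.
by rewrite expRD; have := expR_gt0 (2^-1 : R); have := expR_half_le2; nra.
Qed.

Lemma primary_factor_le_half p (z : C) : cabs z <= 2^-1 ->
  cabs (primary_factor p z - 1) <= 4 * cabs z ^+ p.+1.
Proof.
move=> z1; apply: le_trans (primary_factor_le p _) _; first lra.
rewrite mulrC ler_wpM2r ?exprn_ge0 ?cabs_ge0 //.
apply: le_trans expR1_le4; rewrite ler_expR ler_pdivrMr; lra.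
Qed.

Lemma cexp_sub1_le_small (z : C) : cabs z <= 1 -> cabs (cexp z - 1) <= 4 * cabs z.
Proof.
move=> z1; apply: le_trans (cexp_sub1_le z) _.
rewrite mulrC ler_wpM2r ?cabs_ge0 //.
by apply: le_trans expR1_le4; rewrite ler_expR.
Qed.

Lemma cvg_geometric0 (r : R) : 0 <= r < 1 -> r ^+ n @[n --> \oo] --> (0 : R).
Proof. by move=> /andP[r0 r1]; apply: cvg_expr; rewrite ger0_norm. Qed.

Lemma cvg_primary_factor (z : C) : cabs z < 1 ->
  (primary_factor p z : Co) @[p --> \oo] --> (1 : Co).
Proof.
move=> z1; apply: (@cvgc_squeeze _ _ _ _ _ _
  (fun p => cabs z ^+ p.+1 * expR (cabs z / (1 - cabs z)))).
  by apply: nearW => p; apply: primary_factor_le.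
rewrite -(mul0r (expR (cabs z / (1 - cabs z)))); apply: cvgMr_tmp.
have := @cvg_geometric0 (cabs z); rewrite cabs_ge0 => /(_ z1).
by rewrite -(cvg_shiftS (fun p => cabs z ^+ p)).
Qed.

End PrimaryFactors.

(** * Goursat's theorem for trapezoid sums *)

Section DiscreteGoursat.
Context {R : realType}.
Local Notation C := R[i].
Local Notation Co := (R[i]^o).
Local Notation h k := ((2 : R) ^- k).
Implicit Types (phi psi : C -> C) (c s a b : C).

(** A discrete version of the integral of [phi] on the segment from [c] to
    [c + n s]. *)
Definition trapezoid phi c s n : C :=
  \sum_(l < n) (phi (c + l%:R * s) + phi (c + l.+1%:R * s)) / 2 * s.

(** A discrete contour integral around the parallelogram with corner [c] and
    sides [n a], [n b]. *)
Definition boundary_sum phi c a b n : C :=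
  trapezoid phi c a n + trapezoid phi (c + n%:R * a) b n
  - trapezoid phi (c + n%:R * b) a n - trapezoid phi c b n.

Lemma trapezoid_split phi c s n :
  trapezoid phi c s (n + n) = trapezoid phi c s n + trapezoid phi (c + n%:R * s) s n.
Proof.
rewrite /trapezoid big_split_ord /=; congr (_ + _).
by apply: eq_bigr => l _; rewrite -addnS !natrD !mulrDl !addrA.
Qed.

(** The sides shared by two quarters cancel. *)
Lemma boundary_sum_split phi c a b n :
  boundary_sum phi c a b (n + n) =
    boundary_sum phi c a b n + boundary_sum phi (c + n%:R * a) a b n
  + boundary_sum phi (c + n%:R * b) a b n
  + boundary_sum phi (c + n%:R * a + n%:R * b) a b n.
Proof.
rewrite /boundary_sum !trapezoid_split natrD !mulrDl !addrA.
have -> : c + n%:R * b + n%:R * a = c + n%:R * a + n%:R * b by ring.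
have -> : c + n%:R * a + n%:R * b + n%:R * a = c + n%:R * a + n%:R * a + n%:R * b by ring.
have -> : c + n%:R * b + n%:R * b + n%:R * a = c + n%:R * a + n%:R * b + n%:R * b by ring.
ring.
Qed.

Lemma trapezoidB phi psi c s n :
  trapezoid (fun w => phi w - psi w) c s n = trapezoid phi c s n - trapezoid psi c s n.
Proof. by rewrite /trapezoid -sumrB; apply: eq_bigr => l _; ring. Qed.

(** The trapezoid rule gives the increment of the primitive. *)
Lemma trapezoid_affine (u v : C) c s n :
  trapezoid (fun w => u + v * w) c s n =
    (u * (c + n%:R * s) + v * (c + n%:R * s) ^+ 2 / 2) - (u * c + v * c ^+ 2 / 2).
Proof.
elim: n => [|n IH]; first by rewrite /trapezoid big_ord0 mul0r addr0 subrr.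
have -> : trapezoid (fun w => u + v * w) c s n.+1 =
    trapezoid (fun w => u + v * w) c s n +
    (u + v * (c + n%:R * s) + (u + v * (c + n.+1%:R * s))) / 2 * s.
  by rewrite /trapezoid big_ord_recr.
rewrite IH.
have n2 : (2 : C) != 0 by rewrite pnatr_eq0.
by rewrite (mulrSr 1 n); field.
Qed.

Lemma boundary_sum_affine (u v : C) c a b n :
  boundary_sum (fun w => u + v * w) c a b n = 0.
Proof. by rewrite /boundary_sum !trapezoid_affine; ring. Qed.

Lemma trapezoid_le phi c s n (E : R) :
  (forall l, (l <= n)%N -> cabs (phi (c + l%:R * s)) <= E) ->
  cabs (trapezoid phi c s n) <= E * (n%:R * cabs s).
Proof.
move=> hE; apply: le_trans (cabs_sum _ _ _) _.
have -> : E * (n%:R * cabs s) = \sum_(l < n) E * cabs s.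
  by rewrite sumr_const card_ord -mulr_natl; ring.
apply: ler_sum => l _; rewrite cabsM ler_wpM2r ?cabs_ge0 //.
rewrite cabsM cabsV cabs_nat ler_pdivrMr //.
apply: le_trans (cabsD _ _) _.
have := hE l (ltnW (ltn_ord l)); have := hE l.+1 (ltn_ord l); lra.
Qed.

Lemma natC_real n : n%:R = (n%:R : R)%:C :> C.
Proof. by rewrite rmorph_nat. Qed.

(** Goursat's theorem. By bisection it is enough to bound the sums around a
    small parallelogram near a given point: there the linearization of [phi]
    contributes nothing, and the error is small compared with the area. *)
Lemma discrete_goursat phi c (A B : C) : (forall z, cdiff phi z) ->
  forall eta : R, 0 < eta -> exists M, forall m, (M <= m)%N ->
    cabs (boundary_sum phi c (A * (h m)%:C) (B * (h m)%:C) (2 ^ m)%N) <= eta.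
Proof.
move=> dphi eta eta0.
(* on a square of side [2^-k] the sums with mesh [2^-m] have [2 ^ (m - k)]
   steps on each side *)
pose P k (x y : R) := exists2 M, (k <= M)%N & forall m, (M <= m)%N ->
  cabs (boundary_sum phi (c + x%:C * A + y%:C * B) (A * (h m)%:C) (B * (h m)%:C)
    (2 ^ (m - k))%N) <= eta * (h k * h k).
have step k m : (k <= m)%N -> ((2 ^ (m - k))%N%:R : R) * h m = h k.
  move=> km; have e : (2 : R) ^+ m = 2 ^+ (m - k) * 2 ^+ k by rewrite -exprD subnK.
  by rewrite natrX e; field; rewrite !expf_neq0.
have stepC k m X : (k <= m)%N -> (2 ^ (m - k))%N%:R * (X * (h m)%:C) = (h k)%:C * X.
  by move=> km; rewrite mulrCA natC_real realcM step // mulrC.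
have [] : P 0%N 0 0; last first.
  move=> M _ hM; exists M => m /hM; rewrite subn0 expr0 invr1 !mulr1.
  by rewrite !mul0r !addr0.
apply: dyadic_squares => [k x y [M1 k1 h1] [M2 k2 h2] [M3 k3 h3] [M4 k4 h4]|x y _ _].
  exists (maxn (maxn M1 M2) (maxn M3 M4)).
    by rewrite !leq_max (ltnW k1).
  move=> m; rewrite !geq_max => /andP[/andP[l1 l2] /andP[l3 l4]].
  have km : (k.+1 <= m)%N := leq_trans k1 l1.
  have -> : (2 ^ (m - k) = 2 ^ (m - k.+1) + 2 ^ (m - k.+1))%N.
    by rewrite -(subnSK km) expnS mul2n addnn.
  rewrite boundary_sum_split !stepC //.
  have hs := dyadic_half k (R := R).
  have := h4 m l4; have := h3 m l3; have := h2 m l2; have := h1 m l1.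
  have -> : c + (x + h k.+1)%:C * A + y%:C * B =
      c + x%:C * A + y%:C * B + (h k.+1)%:C * A by rewrite rmorphD /=; ring.
  have -> : c + x%:C * A + (y + h k.+1)%:C * B =
      c + x%:C * A + y%:C * B + (h k.+1)%:C * B by rewrite rmorphD /=; ring.
  have -> : c + (x + h k.+1)%:C * A + (y + h k.+1)%:C * B =
      c + x%:C * A + y%:C * B + (h k.+1)%:C * A + (h k.+1)%:C * B.
    by rewrite !rmorphD /=; ring.
  set T1 := boundary_sum _ _ _ _ _; set T2 := boundary_sum _ _ _ _ _.
  set T3 := boundary_sum _ _ _ _ _; set T4 := boundary_sum _ _ _ _ _ => g1 g2 g3 g4.
  rewrite hs; apply: le_trans (cabsD (T1 + T2 + T3) T4) _.
  have := cabsD (T1 + T2) T3; have := cabsD T1 T2; lra.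
pose z := c + x%:C * A + y%:C * B.
pose L := cabs A + cabs B.
have L0 : 0 <= L by rewrite addr_ge0 ?cabs_ge0.
have /cdiff_local[d hd] := dphi z.
pose e := eta / (2 * L ^+ 2 + 1).
have L2 : 0 < 2 * L ^+ 2 + 1 by rewrite ltr_wpDl // mulr_ge0 // exprn_ge0.
have e0 : 0 < e by rewrite divr_gt0.
have [D D0 hD] := hd e e0.
have [K hK] := dyadic_small L0 D0.
exists K => k x' y' /hK hk /andP[x1 x2] /andP[y1 y2]; exists k => // m km.
set c' := c + x'%:C * A + y'%:C * B.
(* the linearization of [phi] at [z], for which the sum is zero *)
pose psi w := (phi z - z * d) + d * w.
have -> : boundary_sum phi c' (A * (h m)%:C) (B * (h m)%:C) (2 ^ (m - k)) =
    boundary_sum (fun w => phi w - psi w) c' (A * (h m)%:C) (B * (h m)%:C) (2 ^ (m - k)).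
  rewrite -[LHS]subr0 -(boundary_sum_affine (phi z - z * d) d c' (A * (h m)%:C)
    (B * (h m)%:C) (2 ^ (m - k))).
  by rewrite /boundary_sum !trapezoidB; ring.
have h0 := dyadic_gt0 (R := R) k.
have pt (s t : R) : 0 <= s <= h k -> 0 <= t <= h k ->
    cabs (phi (c' + s%:C * A + t%:C * B) - psi (c' + s%:C * A + t%:C * B)) <= e * (h k * L).
  move=> /andP[s0 s1] /andP[t0 t1]; set w := c' + _ + _.
  have wz : cabs (w - z) <= h k * L.
    have -> : w - z = (x' - x + s)%:C * A + (y' - y + t)%:C * B.
      by rewrite /w /z /c' !rmorphD !rmorphN /=; ring.
    apply: le_trans (cabsD _ _) _; rewrite !cabsM !cabs_real /L mulrDr.
    by apply: lerD; apply: ler_wpM2r; rewrite ?cabs_ge0 // ler_norml; apply/andP; split; lra.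
  have := hD w (le_lt_trans wz hk).
  have -> : phi w - psi w = phi w - phi z - (w - z) * d by rewrite /psi; ring.
  by move/le_trans; apply; rewrite ler_wpM2l // ltW.
have hm0 := dyadic_gt0 (R := R) m.
have lh (l : nat) : (l <= 2 ^ (m - k))%N -> 0 <= l%:R * h m <= h k.
  move=> le; rewrite mulr_ge0 ?ler0n ?(ltW hm0) //= -(step k m km).
  by rewrite ler_wpM2r ?(ltW hm0) // ler_nat.
have lC (l : nat) X : l%:R * (X * (h m)%:C) = (l%:R * h m)%:C * X :> C.
  by rewrite natC_real -realcM; ring.
have hh : 0 <= h k <= h k by rewrite (ltW h0) lexx.
have z0 : (0 : R) <= 0 <= h k by rewrite lexx (ltW h0).
have side X : (2 ^ (m - k))%N%:R * cabs (X * (h m)%:C) = h k * cabs X.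
  by rewrite cabsM cabs_real gtr0_norm // mulrCA mulrC step // mulrC.
have b1 : cabs (trapezoid (fun w => phi w - psi w) c' (A * (h m)%:C) (2 ^ (m - k)))
    <= e * (h k * L) * (h k * cabs A).
  rewrite -side; apply: trapezoid_le => l /lh le; rewrite lC.
  by have := pt _ _ le z0; rewrite mul0r addr0.
have b2 : cabs (trapezoid (fun w => phi w - psi w) (c' + (2 ^ (m - k))%N%:R * (A * (h m)%:C))
    (B * (h m)%:C) (2 ^ (m - k))) <= e * (h k * L) * (h k * cabs B).
  rewrite -side; apply: trapezoid_le => l /lh le; rewrite stepC // lC.
  exact: pt hh le.
have b3 : cabs (trapezoid (fun w => phi w - psi w) (c' + (2 ^ (m - k))%N%:R * (B * (h m)%:C))
    (A * (h m)%:C) (2 ^ (m - k))) <= e * (h k * L) * (h k * cabs A).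
  rewrite -side; apply: trapezoid_le => l /lh le; rewrite stepC // lC addrAC.
  exact: pt le hh.
have b4 : cabs (trapezoid (fun w => phi w - psi w) c' (B * (h m)%:C) (2 ^ (m - k)))
    <= e * (h k * L) * (h k * cabs B).
  rewrite -side; apply: trapezoid_le => l /lh le; rewrite lC.
  by have := pt _ _ z0 le; rewrite mul0r addr0.
rewrite /boundary_sum.
set T1 := trapezoid _ _ _ _ in b1 *; set T2 := trapezoid _ _ _ _ in b2 *.
set T3 := trapezoid _ _ _ _ in b3 *; set T4 := trapezoid _ _ _ _ in b4 *.
have tri : cabs (T1 + T2 - T3 - T4) <= cabs T1 + cabs T2 + cabs T3 + cabs T4.
  have := cabsB (T1 + T2 - T3) T4; have := cabsB (T1 + T2) T3; have := cabsD T1 T2; lra.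
apply: le_trans tri _.
have : e * (2 * L ^+ 2) <= eta.
  by rewrite /e mulrAC ler_pdivrMr // ler_wpM2l ?(ltW eta0) // lerDl.
move=> he; apply: (@le_trans _ _ (e * (2 * L ^+ 2) * (h k * h k))); last first.
  by rewrite ler_wpM2r // mulr_ge0 // ltW.
have -> : e * (2 * L ^+ 2) * (h k * h k) = 2 * (e * (h k * L) * (h k * (cabs A + cabs B))).
  by rewrite /L; ring.
lra.
Qed.

End DiscreteGoursat.

(** * Means over circles *)

Section CircleMeans.
Context {R : realType}.
Local Notation C := R[i].
Local Notation Co := (R[i]^o).
Local Notation h k := ((2 : R) ^- k).

(** Bounded sequences converge along an ultrafilter. One that is finer than
    the Frechet filter gives a linear, positive notion of limit for the
    discrete means below, without any discussion of their convergence. *)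
Definition free_ultrafilter : set_system nat :=
  sval (cid (@ultraFilterLemma nat \oo _)).
Local Notation U := free_ultrafilter.

Lemma free_ultrafilter_ultra : UltraFilter U.
Proof. by rewrite /U; case: cid => ? []. Qed.

#[global] Instance free_ultrafilter_proper : ProperFilter U.
Proof. exact: (@ultra_proper _ _ free_ultrafilter_ultra). Qed.

#[global] Instance free_ultrafilter_filter : Filter U.
Proof. exact: (@filter_filter _ _ free_ultrafilter_proper). Qed.

Lemma free_ultrafilter_near (P : nat -> Prop) :
  (\forall m \near \oo, P m) -> \forall m \near U, P m.
Proof. by rewrite /U /prop_near1; case: cid => /= ? [_]; apply. Qed.

Lemma ultra_cvg_real (u : nat -> R) (B : R) : (forall m, `|u m| <= B) ->
  exists l : R, u @ U --> l.
Proof.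
move=> uB; pose S := [set x | \forall m \near U, x <= u m].
have SB : S (- B) by apply: nearW => m; have := uB m; rewrite ler_norml => /andP[].
have Sub : ubound S B.
  move=> x xS; have [m hm] := @filter_ex _ _ _ _ xS.
  by apply: le_trans hm _; have := uB m; rewrite ler_norml => /andP[].
have hS : has_sup S by split; [exists (- B) | exists B].
exists (sup S); apply/cvgrPdist_lt => e e0.
have h1 : \forall m \near U, sup S - e < u m.
  have [x xS ex] := sup_adherent e0 hS.
  by apply: filterS xS => m; apply: lt_le_trans.
have h2 : \forall m \near U, u m < sup S + e.
  have [//|h2] := in_ultra_setVsetC [set m | u m < sup S + e] free_ultrafilter_ultra.
  have : S (sup S + e) by apply: filterS h2 => m /=; rewrite leNgt => /negP.
  by move/(ub_le_sup hS.2); rewrite gerDl leNgt e0.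
by apply: filterS2 h1 h2 => m a b; rewrite ltr_distl; apply/andP; split; lra.
Qed.

Definition dyadic_root m j : C := cexp ((2 * pi * j%:R * h m) *i).

Lemma cabs_dyadic_root m j : cabs (dyadic_root m j) = 1.
Proof. exact: cabs_cexp_i. Qed.

Definition circle_mean (g : C -> C) (r : R) m : C :=
  (h m)%:C * \sum_(j < 2 ^ m) g (r%:C * dyadic_root m j).

(** The mean of [g] over the circle of radius [r], i.e., the contour integral
    of [g w / (2 pi i w)]. It is an inductive predicate so that conversion
    never looks through it. *)
Variant has_mean (g : C -> C) (r : R) (l : C) : Prop :=
  HasMean of (circle_mean g r m : Co) @[m --> U] --> (l : Co).

Lemma cabs_circle r m j : 0 <= r -> cabs (r%:C * dyadic_root m j) = r.
Proof.
by move=> r0; rewrite (cabsM r%:C) cabs_dyadic_root mulr1 cabs_real ger0_norm.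
Qed.

Lemma has_mean_unique g r l l' : has_mean g r l -> has_mean g r l' -> l = l'.
Proof. by move=> [a] [b]; exact: (@cvgc_unique R nat U _ (circle_mean g r) l l' a b). Qed.

Lemma circle_mean_le g r m (k : C -> R) : 0 <= r ->
  (forall w, cabs w = r -> cabs (g w) <= k w) ->
  cabs (circle_mean g r m) <= complex.Re (circle_mean (fun w => (k w)%:C) r m).
Proof.
move=> r0 gk; rewrite /circle_mean cabsM cabs_real gtr0_norm ?dyadic_gt0 //.
rewrite ReM /= mul0r subr0 Re_sum ler_wpM2l ?(ltW (dyadic_gt0 _)) //.
apply: le_trans (cabs_sum _ _ _) _; apply: ler_sum => j _ /=.
by apply: gk; rewrite cabs_circle.
Qed.

Lemma circle_mean_cst (c : C) r m : circle_mean (fun=> c) r m = c.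
Proof.
rewrite /circle_mean sumr_const card_ord -(mulr_natl c) natC_real mulrA realcM natrX.
by rewrite mulVf ?mul1r // expf_neq0.
Qed.

(** The bound may vary along the circle, as it does against a kernel that is
    concentrated near a point. *)
Lemma has_mean_le g r l (k : C -> R) l' : 0 <= r ->
  (forall w, cabs w = r -> cabs (g w) <= k w) ->
  has_mean g r l -> has_mean (fun w => (k w)%:C) r l' -> cabs l <= complex.Re l'.
Proof.
move=> r0 gk [hg] [hk].
have h1 := @cvg_cabs R nat U free_ultrafilter_filter _ _ hg.
have h2 := @cvgc_Re R nat U free_ultrafilter_filter _ _ hk.
have := ler_cvg_to h1 h2; apply; apply: nearW => m; exact: circle_mean_le.
Qed.

Lemma has_mean_cst c r : has_mean (fun=> c) r c.
Proof.
constructor; apply: (@cvgc_ext R nat U _ (fun=> c)) => [m|]; last exact: cvgc_cst.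
by rewrite circle_mean_cst.
Qed.

Lemma has_mean_bound g r l (B : R) : 0 <= r ->
  (forall w, cabs w = r -> cabs (g w) <= B) -> has_mean g r l -> cabs l <= B.
Proof.
move=> r0 gB hg.
exact: (@has_mean_le g r l (fun=> B) B%:C r0 gB hg (has_mean_cst _ _)).
Qed.

Lemma has_meanD g g' r l l' : has_mean g r l -> has_mean g' r l' ->
  has_mean (fun w => g w + g' w) r (l + l').
Proof.
move=> [hg] [hg']; constructor.
apply: (@cvgc_ext R nat U _ _ _ _ _ (@cvgcD R nat U _ _ _ _ _ hg hg')) => m.
by rewrite /circle_mean big_split mulrDr.
Qed.

Lemma has_meanZ g r l (c : C) : has_mean g r l -> has_mean (fun w => c * g w) r (c * l).
Proof.
move=> [hg]; constructor.
apply: (@cvgc_ext R nat U _ _ _ _ _ (@cvgcM R nat U _ _ _ _ _ (@cvgc_cst R nat U _ c) hg)) => m.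
by rewrite /circle_mean -mulr_sumr; ring.
Qed.

Lemma has_mean_ext g g' r l : 0 <= r -> (forall w, cabs w = r -> g w = g' w) ->
  has_mean g r l -> has_mean g' r l.
Proof.
move=> r0 e [hg]; constructor.
apply: (@cvgc_ext R nat U _ _ _ _ _ hg) => m; rewrite /circle_mean; congr (_ * _).
by apply: eq_bigr => j _; apply: e; rewrite cabs_circle.
Qed.

Lemma has_mean_sum (I : Type) (s : seq I) (g : I -> C -> C) r (l : I -> C) : 0 <= r ->
  (forall i, has_mean (g i) r (l i)) ->
  has_mean (fun w => \sum_(i <- s) g i w) r (\sum_(i <- s) l i).
Proof.
move=> r0 hg; elim: s => [|i s IH].
  rewrite big_nil; apply: has_mean_ext (has_mean_cst 0 r) => // w _.
  by rewrite big_nil.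
rewrite big_cons; apply: has_mean_ext (has_meanD (hg i) IH) => // w _.
by rewrite big_cons.
Qed.

Lemma has_mean_conj g r l : has_mean g r l -> has_mean (fun w => (g w)^*) r l^*.
Proof.
move=> [hg]; constructor; apply: (@cvgc_ext R nat U _ _ _ _ _ (@cvgc_conj R nat U _ _ _ hg)) => m.
by rewrite /circle_mean conjcM conjc_sum conjcR.
Qed.

Lemma has_mean_exists g r (B : R) : 0 <= r ->
  (forall w, cabs w = r -> cabs (g w) <= B) -> exists l, has_mean g r l.
Proof.
move=> r0 gB.
have b m : cabs (circle_mean g r m) <= B.
  have := @circle_mean_le g r m (fun=> B) r0 gB.
  by rewrite circle_mean_cst.
have [a ha] := @ultra_cvg_real (fun m => complex.Re (circle_mean g r m)) B
  (fun m => le_trans (abs_Re_le _) (b m)).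
have [c hc] := @ultra_cvg_real (fun m => complex.Im (circle_mean g r m)) B
  (fun m => le_trans (abs_Im_le _) (b m)).
by exists (a +i* c); constructor; apply: cvgc_ReIm.
Qed.

Lemma dyadic_rootX m j k : dyadic_root m j ^+ k = dyadic_root m k ^+ j.
Proof.
rewrite /dyadic_root !cexpX !imagMn; congr (cexp (_ *i)); ring.
Qed.

Lemma dyadic_root_neq1 m k : (0 < k < 2 ^ m)%N -> dyadic_root m k != 1.
Proof.
move=> /andP[k0 km]; apply: cexp_i_neq1.
have h0 := dyadic_gt0 (R := R) m; have p0 := pi_gt0 R.
have k0' : 0 < k%:R :> R by rewrite ltr0n.
rewrite !mulr_gt0 //= -[X in _ < X]mulr1 -mulrA ltr_pM2l ?mulr_gt0 //.
by rewrite ltr_pdivrMr ?exprn_gt0 // mul1r -natrX ltr_nat.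
Qed.

(** On more than [k] sample points the discrete mean of [w ^+ k] is a full sum
    of powers of a root of unity other than 1, hence already zero. *)
Lemma has_mean_Xn r k : 0 <= r -> (0 < k)%N -> has_mean (fun w => w ^+ k) r 0.
Proof.
move=> r0 k0; constructor; apply: (@cvgc_squeeze R nat U _ _ _ (fun=> 0)); last exact: cvg_cst.
apply: free_ultrafilter_near; exists k => // m /= km.
have kp : (0 < k < 2 ^ m)%N.
  by rewrite k0 (leq_ltn_trans km) // ltn_expl.
rewrite subr0 /circle_mean.
under eq_bigr => j _ do rewrite exprMn dyadic_rootX.
rewrite -mulr_sumr.
set q := dyadic_root m k.
have : q ^+ (2 ^ m) - 1 = 0.
  rewrite /q /dyadic_root cexpX imagMn natrX.
  have -> : 2 ^+ m * (2 * pi * k%:R * h m) = 2 * pi * k%:R :> R.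
    by field; rewrite expf_neq0.
  by rewrite cexp_2pi_nat subrr.
rewrite subrX1 => /eqP; rewrite mulf_eq0 subr_eq0 (negbTE (dyadic_root_neq1 kp)) /=.
by move=> /eqP ->; rewrite !mulr0 cabs0.
Qed.

Lemma cmul_conj_circle (w : C) : cabs w != 0 -> w^-1 = w^* / (cabs w ^+ 2)%:C.
Proof.
move=> w0; have w1 : w != 0 by rewrite -cabs_eq0.
apply: (mulfI w1); rewrite divff // mulrA mul_conj_cabs divff //.
by rewrite -cabs_eq0 cabs_real normr_eq0 expf_neq0.
Qed.

Lemma has_mean_XnV r k : 0 < r -> (0 < k)%N -> has_mean (fun w => (w ^+ k)^-1) r 0.
Proof.
move=> r0 k0; have := has_meanZ ((r ^+ 2)^-1 ^+ k)%:C (has_mean_conj (has_mean_Xn (ltW r0) k0)).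
rewrite conjcZ0 mulr0; apply: has_mean_ext => [|w wr]; first exact: ltW.
have -> : (w ^+ k)^-1 = (w^* / (r ^+ 2)%:C) ^+ k.
  by rewrite -wr -cmul_conj_circle ?exprVn // wr gt_eqF.
by rewrite exprMn conjcX mulrC rmorphXn /= fmorphV.
Qed.

Lemma has_mean_monomial r i j : 0 < r ->
  has_mean (fun w => w ^+ i / w ^+ j) r (i == j)%:R.
Proof.
move=> r0.
have w0 w : cabs w = r -> w != 0 by move=> wr; rewrite -cabs_gt0 wr.
have [ij|ji|->] := ltngtP i j.
- have := has_mean_XnV r0 (k := (j - i)%N); rewrite subn_gt0 => /(_ ij).
  apply: has_mean_ext => [|w /w0 wn0]; first exact: ltW.
  by rewrite -{2}(subnK (ltnW ij)) exprD invfM mulrCA divff ?mulr1 ?expf_neq0.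
- have := has_mean_Xn (ltW r0) (k := (i - j)%N); rewrite subn_gt0 => /(_ ji).
  apply: has_mean_ext => [|w /w0 wn0]; first exact: ltW.
  by rewrite -{2}(subnK (ltnW ji)) exprD mulfK ?expf_neq0.
- apply: has_mean_ext (has_mean_cst 1 r) => [|w /w0 wn0]; first exact: ltW.
  by rewrite divff ?expf_neq0.
Qed.

(** Cauchy's theorem for the annulus: in the coordinate [log w] the circle
    means of [g] are the trapezoid sums along two opposite sides of a
    rectangle, and the other two sides cancel by periodicity. *)
Lemma has_mean_indep g r0 r1 l : 0 < r0 -> 0 < r1 -> (forall z, z != 0 -> cdiff g z) ->
  has_mean g r0 l -> has_mean g r1 l.
Proof.
move=> r00 r10 dg hl.
pose phi w := g (cexp w).
have dphi z : cdiff phi z.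
  by apply: cdiff_comp (cdiff_cexp z) _; apply: dg; apply: cexp_neq0.
pose B : C := (2 * pi) *i.
pose A : C := (ln r1 - ln r0)%:C.
pose c : C := (ln r0)%:C.
have per w : phi (w + B) = phi w by rewrite /phi cexpD cexp_2pi mulr1.
have B0 : B != 0.
  by rewrite -cabs_gt0; apply: lt_le_trans (abs_Im_le _); rewrite /= normr_gt0 mulf_neq0 ?gt_eqF ?pi_gt0.
have imagMr (t u : R) : t *i * u%:C = (t * u) *i :> C.
  by apply: eq_ReIm; rewrite ?ReM ?ImM /=; ring.
have full m X : (2 ^ m)%N%:R * (X * (h m)%:C) = X :> C.
  rewrite mulrCA natC_real realcM natrX mulfV ?expf_neq0 ?mulr1 //.
(* along a period the trapezoid weights add up to one at each sample point,
   the two ends being identified *)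
have vert x m : 0 < x -> trapezoid phi (ln x)%:C (B * (h m)%:C) (2 ^ m) =
    B * circle_mean g x m.
  move=> x0; pose F (j : nat) := phi ((ln x)%:C + j%:R * (B * (h m)%:C)).
  have -> : trapezoid phi (ln x)%:C (B * (h m)%:C) (2 ^ m) =
      (\sum_(j < 2 ^ m) F j + \sum_(j < 2 ^ m) F j.+1) / 2 * (B * (h m)%:C).
    by rewrite /trapezoid -big_split /= !mulr_suml.
  have -> : \sum_(j < 2 ^ m) F j.+1 = \sum_(j < 2 ^ m) F j.
    have := big_ord_recl (2 ^ m) (op := +%R) (idx := 0) (fun j : 'I_(2 ^ m).+1 => F j).
    rewrite (big_ord_recr (2 ^ m) (fun j : 'I_(2 ^ m).+1 => F j)) /=.
    have -> : F (2 ^ m)%N = F 0%N by rewrite /F full per mul0r addr0.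
    by rewrite addrC => /addrI ->; apply: eq_bigr => j _.
  have -> : \sum_(j < 2 ^ m) F j = \sum_(j < 2 ^ m) g (x%:C * dyadic_root m j).
    apply: eq_bigr => j _; rewrite /F /phi cexpD cexp_real lnK ?posrE //.
    by rewrite /dyadic_root imagMr imagMn; congr (g (_ * cexp (_ *i))); ring.
  rewrite /circle_mean; set S := \sum_(j < _) _.
  have n2 : (2 : C) != 0 by rewrite pnatr_eq0.
  by move: S (h m)%:C => S H; field.
have key m : boundary_sum phi c (A * (h m)%:C) (B * (h m)%:C) (2 ^ m) =
    B * (circle_mean g r1 m - circle_mean g r0 m).
  rewrite /boundary_sum !full.
  have -> : trapezoid phi (c + B) (A * (h m)%:C) (2 ^ m) =
            trapezoid phi c (A * (h m)%:C) (2 ^ m).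
    by apply: eq_bigr => j _; rewrite !(addrAC c B) !per.
  have -> : c + A = (ln r1)%:C by rewrite /c /A -rmorphD addrC subrK.
  by rewrite !vert //; ring.
case: hl => hl; constructor.
have d0 : ((circle_mean g r1 m - circle_mean g r0 m : C) : Co) @[m --> U] --> (0 : Co).
  apply/cvgcP => e e0; apply: free_ultrafilter_near.
  have [|M hM] := @discrete_goursat R phi c A B dphi (cabs B * (e / 2)).
    by rewrite mulr_gt0 ?divr_gt0 // cabs_gt0.
  exists M => // m /= /hM; rewrite key cabsM ler_pM2l ?cabs_gt0 // subr0 => le.
  by apply: le_lt_trans le _; lra.
have := @cvgcD R nat U free_ultrafilter_filter _ _ _ _ d0 hl; rewrite add0r.
by apply: (@cvgc_ext R nat U) => m; rewrite subrK.
Qed.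

End CircleMeans.

(** * Power series of entire functions *)

Section PowerSeries.
Context {R : realType}.
Local Notation C := R[i].
Local Notation Co := (R[i]^o).
Local Notation h k := ((2 : R) ^- k).

Lemma cvg_natV : n%:R^-1 @[n --> \oo] --> (0 : R).
Proof. by have := @cvg_harmonic R; rewrite -(cvg_shiftS (fun n => n%:R^-1 : R)). Qed.

(** Local bounds glue over the four quarters of a square. *)
Lemma disc_bounded (F : C -> R) (r : R) : 0 < r ->
  (forall z, exists2 D : R, 0 < D & exists B, forall w, cabs (w - z) < D ->
     cabs w <= r -> F w <= B) ->
  exists B, forall w, cabs w <= r -> F w <= B.
Proof.
move=> r0 loc.
pose pt (x y : R) : C := (x * (2 * r) - r) +i* (y * (2 * r) - r).
pose P k x y := exists B, forall x' y', x <= x' <= x + h k -> y <= y' <= y + h k ->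
  cabs (pt x' y') <= r -> F (pt x' y') <= B.
have [B hB] : P 0%N 0 0.
  apply: dyadic_squares => [k x y [B1 h1] [B2 h2] [B3 h3] [B4 h4]|x y _ _].
    exists (Num.max (Num.max B1 B2) (Num.max B3 B4)) => x' y'.
    rewrite (dyadic_half k) !addrA => /andP[x1 x2] /andP[y1 y2] le.
    rewrite !le_max.
    have [lx|/ltW lx] := leP x' (x + h k.+1); have [ly|/ltW ly] := leP y' (y + h k.+1).
    - by rewrite h1 ?x1 ?y1.
    - by rewrite (h3 x' y') ?orbT ?x1 ?ly.
    - by rewrite (h2 x' y') ?orbT ?lx ?y1.
    - by rewrite (h4 x' y') ?orbT ?lx ?ly.
  have [D D0 [B hB]] := loc (pt x y).
  have r4 : 0 <= 4 * r by rewrite mulr_ge0 // ltW.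
  have [K hK] := dyadic_small r4 D0.
  exists K => k x1 y1 /hK hk hx hy; exists B => x2 y2 hx2 hy2; apply: hB.
  apply: le_lt_trans hk; apply: le_trans (cabs_le_ReIm _) _ => /=.
  have -> : x2 * (2 * r) - r - (x * (2 * r) - r) = (x2 - x) * (2 * r) by ring.
  have -> : y2 * (2 * r) - r - (y * (2 * r) - r) = (y2 - y) * (2 * r) by ring.
  rewrite (normrM (x2 - x)) (normrM (y2 - y)) (ger0_norm (_ : 0 <= 2 * r)); last by rewrite mulr_ge0 // ltW.
  have -> : h k * (4 * r) = h k * (2 * r) + h k * (2 * r) by ring.
  move: hx hy hx2 hy2 => /andP[? ?] /andP[? ?] /andP[? ?] /andP[? ?].
  by apply: lerD; rewrite ler_wpM2r ?mulr_ge0 ?(ltW r0) // ler_norml; apply/andP; split; lra.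
exists B => w wr.
have E : w = pt ((complex.Re w + r) / (2 * r)) ((complex.Im w + r) / (2 * r)).
  by apply: eq_ReIm; rewrite /pt /=; field; rewrite gt_eqF.
have := abs_Re_le w; have := abs_Im_le w; rewrite !ler_norml => /andP[i1 i2] /andP[j1 j2].
have r20 : 0 < 2 * r by rewrite mulr_gt0.
rewrite E; apply: hB; rewrite -?E // expr0 invr1 add0r divr_ge0 ?ler_pdivrMr ?(ltW r20) //=; lra.
Qed.

Lemma cts_disc_bounded (f : C -> C) (r : R) : 0 < r -> (forall z, ccts f z) ->
  exists2 B, 0 <= B & forall w, cabs w <= r -> cabs (f w) <= B.
Proof.
move=> r0 fc; have [|B hB] := @disc_bounded (fun w => cabs (f w)) r r0.
  move=> z; have /cctsP/(_ _ ltr01)[D D0 hD] := fc z; exists D => //.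
  exists (cabs (f z) + 1) => w /hD wz _; have := cabs_sub_ge (f w) (f z); lra.
by exists B => //; apply: le_trans (cabs_ge0 (f 0)) (hB _ _); rewrite cabs0 ltW.
Qed.

(** The Fejer kernel, as a function of [u = w / z] on the unit circle: the
    averaged squared modulus of a geometric sum. In this form it is a
    combination of monomials, whose means are known. *)
Definition fejer d (u : C) : C :=
  d%:R^-1 * \sum_(i < d) \sum_(j < d) u ^+ i / u ^+ j.

Lemma fejerE d (u : C) : cabs u = 1 ->
  fejer d u = (d%:R^-1 * cabs (\sum_(i < d) u ^+ i) ^+ 2)%:C.
Proof.
move=> u1; rewrite /fejer rmorphM /= fmorphV rmorph_nat -mul_conj_cabs; congr (_ * _).
rewrite conjc_sum big_distrlr /=; apply: eq_bigr => i _; apply: eq_bigr => j _.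
congr (_ * _); rewrite conjcX -exprVn cmul_conj_circle u1 ?oner_eq0 //.
by rewrite expr1n divr1.
Qed.

(** The factor [u - 1] sums the geometric sum to [u ^+ d - 1]. *)
Lemma fejer_concentrated d (u : C) : (0 < d)%N -> cabs u = 1 ->
  cabs (u - 1) ^+ 2 * complex.Re (fejer d u) <= 4 / d%:R.
Proof.
move=> d0 u1; rewrite fejerE //= mulrCA -exprMn -cabsM -subrX1 mulrC.
rewrite ler_wpM2r ?invr_ge0 //.
have : cabs (u ^+ d - 1) <= 2.
  by apply: le_trans (cabsB _ _) _; rewrite cabsX u1 expr1n cabs1.
have := cabs_ge0 (u ^+ d - 1) => a b.
have -> : (4 : R) = 2 ^+ 2 by rewrite expr2; lra.
by rewrite lerXn2r // nnegrE.
Qed.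

(** The first two clauses are Cauchy's integral formulas on circles of every
    radius; they give the uniqueness of the coefficients and Cauchy's
    estimates directly. *)
Definition taylor (f : C -> C) (c : nat -> C) : Prop :=
  [/\ forall (r : R) k, 0 < r -> has_mean (fun w => f w / w ^+ k) r (c k),
      forall (r : R) k, 0 < r -> (0 < k)%N -> has_mean (fun w => f w * w ^+ k) r 0
    & forall z, ((\sum_(k < n) c k * z ^+ k : C) : Co) @[n --> \oo] --> (f z : Co)].

(** The coefficients are circle means, which do not depend on the radius. The
    Cesaro means of the series at [z] are the means of [f] against the Fejer
    kernel, hence tend to [f z]; as the terms decrease geometrically, so do
    the partial sums. Differentiability at the origin is not assumed, so that
    the theorem also removes singularities. *)
Theorem power_series (f : C -> C) : ccts f 0 -> (forall z, z != 0 -> cdiff f z) ->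
  exists c, taylor f c.
Proof.
move=> f0 df.
have fc z : ccts f z.
  by have [->//|/df/cdiff_cts] := eqVneq z 0.
have bd r : 0 < r -> exists2 B, 0 <= B & forall w, cabs w <= r -> cabs (f w) <= B.
  by move=> r0; apply: cts_disc_bounded.
have cnz (r : R) w : 0 < r -> cabs w = r -> w != 0.
  by move=> r0 wr; rewrite -cabs_gt0 wr.
have dV k z : z != 0 -> cdiff (fun w => f w / w ^+ k) z.
  move=> z0; apply: cdiffM; first exact: df.
  by apply: cdiffV; [rewrite expf_neq0 | apply: cdiffX; apply: cdiff_id].
have dM k z : z != 0 -> cdiff (fun w => f w * w ^+ k) z.
  by move=> z0; apply: cdiffM; [exact: df | apply: cdiffX; apply: cdiff_id].
have exV k : exists l, has_mean (fun w => f w / w ^+ k) 1 l.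
  have [B B0 hB] := bd 1 ltr01.
  apply: (@has_mean_exists _ _ 1 B ler01) => w w1.
  by rewrite cabsM cabsV cabsX w1 expr1n invr1 mulr1 hB // w1.
have [c hc] := choice exV.
have cV r k : 0 < r -> has_mean (fun w => f w / w ^+ k) r (c k).
  by move=> r0; apply: has_mean_indep ltr01 r0 (dV k) (hc k).
(* such means do not depend on the radius, and are small on small circles *)
have cM r k : 0 < r -> (0 < k)%N -> has_mean (fun w => f w * w ^+ k) r 0.
  move=> r0 k0; have [B B0 hB] := bd 1 ltr01.
  have [|l hl] := @has_mean_exists _ (fun w => f w * w ^+ k) 1 B ler01.
    by move=> w w1; rewrite cabsM cabsX w1 expr1n mulr1 hB // w1.
  suff l0 : l = 0 by rewrite -l0; apply: has_mean_indep ltr01 r0 (dM k) hl.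
  apply/eqP; rewrite -cabs_eq0 eq_le cabs_ge0 andbT; apply/ler_addgt0Pr => e e0.
  rewrite add0r; have [s s0 [s1 se]] : exists2 s, 0 < s & s <= 1 /\ s <= e / (B + 1).
    exists (Num.min 1 (e / (B + 1))); last by rewrite !ge_min !lexx orbT.
    by rewrite lt_min ltr01 divr_gt0 // ltr_wpDl.
  have B1 : 0 < B + 1 by rewrite ltr_wpDl.
  apply: (@has_mean_bound _ (fun w => f w * w ^+ k) s l); [exact: ltW| |exact: has_mean_indep ltr01 s0 (dM k) hl].
  move=> w ws; rewrite cabsM cabsX ws.
  have fB : cabs (f w) <= B by apply: hB; rewrite ws.
  apply: (@le_trans _ _ (B * s)).
    apply: ler_pM; rewrite ?cabs_ge0 ?exprn_ge0 ?(ltW s0) //.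
    by rewrite -(prednK k0) exprS ler_piMr ?(ltW s0) // exprn_ile1 // ltW.
  apply: (@le_trans _ _ (B * (e / (B + 1)))); first by rewrite ler_wpM2l.
  by rewrite mulrCA ler_piMr ?(ltW e0) // ler_pdivrMr // mul1r lerDl.
exists c; split=> // z.
have cauchy r B k : 0 < r -> (forall w, cabs w = r -> cabs (f w) <= B) ->
    cabs (c k) * r ^+ k <= B.
  move=> r0 hB; rewrite -ler_pdivlMr ?exprn_gt0 //.
  apply: has_mean_bound (cV r k r0); first exact: ltW.
  move=> w wr; rewrite cabsM cabsV cabsX wr ler_wpM2r ?invr_ge0 ?exprn_ge0 ?(ltW r0) //.
  exact: hB.
have [->|z0] := eqVneq z 0.
  have c0 : c 0%N = f 0.
    apply/eqP; rewrite -subr_eq0 -cabs_eq0 eq_le cabs_ge0 andbT; apply/ler_addgt0Pr => e e0.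
    have /cctsP/(_ _ e0)[D D0 hD] := f0.
    have D20 : 0 < D / 2 by rewrite divr_gt0.
    rewrite add0r; apply: has_mean_bound (has_meanD (cV _ 0%N D20) (has_mean_cst (- f 0) _)).
      exact: ltW.
    move=> w wD; rewrite expr0 divr1; apply/ltW/hD; rewrite subr0 wD; lra.
  apply: cvg_near_cst; exists 1%N => // -[//|n] _ /=.
  rewrite big_ord_recl big1 => [|i _]; last by rewrite exprS mul0r mulr0.
  by rewrite expr0 mulr1 addr0 c0.
set r := cabs z; have r0 : 0 < r by rewrite cabs_gt0.
have [|M M0 hM] := bd (2 * r); first by rewrite mulr_gt0.
pose S n := \sum_(k < n) c k * z ^+ k.
(* Cauchy's estimate on the circle of radius [2 r] *)
have term k : cabs (c k * z ^+ k) <= M * (2^-1) ^+ k.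
  have := @cauchy (2 * r) M k; rewrite mulr_gt0 // exprMn => /(_ isT) H.
  rewrite cabsM cabsX exprVn ler_pdivlMr ?exprn_gt0 // -/r -mulrA (mulrC (r ^+ k)).
  by apply: H => w wr; apply: hM; rewrite wr.
(* the Cesaro means of the partial sums are the Fejer means of f *)
pose K d w := fejer d (w / z).
have meanK d : has_mean (fun w => f w * K d w) r (d%:R^-1 * \sum_(j < d) S j.+1).
  have H i j : has_mean (fun w => z ^+ j / z ^+ i * (f w * (w ^+ i / w ^+ j))) r
      (if (i <= j)%N then c (j - i)%N * z ^+ (j - i) else 0).
    have split (x : C) (a b : nat) : (a <= b)%N -> x ^+ b = x ^+ (b - a) * x ^+ a.
      by move=> ab; rewrite -exprD subnK.
    case: leqP => ij.
      rewrite (_ : c _ * _ = z ^+ j / z ^+ i * c (j - i)%N); last first.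
        by rewrite (split z i j ij) mulfK ?expf_neq0 // mulrC.
      apply: has_meanZ; apply: has_mean_ext (cV r (j - i)%N r0); first exact: ltW.
      move=> w /(cnz _ _ r0) w0; congr (_ * _).
      by rewrite (split w i j ij) invfM mulrCA divff ?mulr1 // expf_neq0.
    rewrite -(mulr0 (z ^+ j / z ^+ i)); apply: has_meanZ.
    have := cM r (i - j)%N r0; rewrite subn_gt0 => /(_ ij).
    apply: has_mean_ext; first exact: ltW.
    move=> w /(cnz _ _ r0) w0; congr (_ * _).
    by rewrite (split w j i (ltnW ij)) mulfK // expf_neq0.
  have := has_meanZ d%:R^-1 (has_mean_sum (index_enum 'I_d) (ltW r0)
    (fun i => has_mean_sum (index_enum 'I_d) (ltW r0) (fun j : 'I_d => H i j))).
  rewrite (_ : d%:R^-1 * _ = d%:R^-1 * \sum_(j < d) S j.+1); last first.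
    rewrite exchange_big /=; congr (_ * _); apply: eq_bigr => j _.
    rewrite -big_mkcond /= /S [RHS](reindex_inj rev_ord_inj) /=.
    rewrite [RHS](eq_bigr (fun i : 'I_j.+1 => c (j - i)%N * z ^+ (j - i))); last by [].
    rewrite [LHS](eq_bigl (fun i : 'I_d => (i < j.+1)%N)); last by move=> i; rewrite ltnS.
    by rewrite -(big_ord_widen d (fun i => c (j - i)%N * z ^+ (j - i))).
  apply: has_mean_ext; first exact: ltW.
  move=> w /(cnz _ _ r0) w0; rewrite /K /fejer mulrCA; congr (_ * _).
  rewrite mulr_sumr; apply: eq_bigr => i _; rewrite mulr_sumr; apply: eq_bigr => j _.
  by rewrite !expr_div_n; field; rewrite !expf_neq0.
have uw w : cabs w = r -> cabs (w / z) = 1.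
  by move=> wr; rewrite cabsM cabsV wr divff // gt_eqF.
have K1 d : (0 < d)%N -> has_mean (K d) r 1.
  move=> d0; have := has_meanZ d%:R^-1 (has_mean_sum (index_enum 'I_d) (ltW r0)
    (fun i => has_mean_sum (index_enum 'I_d) (ltW r0) (fun j : 'I_d =>
       has_meanZ (z ^+ j / z ^+ i) (has_mean_monomial i j r0)))).
  rewrite (_ : d%:R^-1 * _ = 1).
    apply: has_mean_ext; first exact: ltW.
    move=> w /(cnz _ _ r0) w0; rewrite /K /fejer; congr (_ * _).
    apply: eq_bigr => i _; apply: eq_bigr => j _.
    by rewrite !expr_div_n; field; rewrite !expf_neq0.
  rewrite (_ : \sum_(i < d) _ = d%:R) ?mulVf ?pnatr_eq0 -?lt0n //.
  rewrite (eq_bigr (fun=> 1)) ?sumr_const ?card_ord // => i _.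
  rewrite (bigD1 i) //= eqxx mulr1 divff ?expf_neq0 // big1 ?addr0 // => j ji.
  by move: ji; rewrite -val_eqE eq_sym /= => /negbTE ->; rewrite mulr0.
have fM w : cabs w = r -> cabs (f w) <= M by move=> wr; apply: hM; rewrite wr; lra.
have fzM : cabs (f z) <= M by apply: fM.
(* the modulus of continuity in a form integrable against the kernel *)
have key e : 0 < e -> exists2 L, 0 <= L & forall d, (0 < d)%N ->
    cabs (d%:R^-1 * (\sum_(j < d) S j.+1) - f z) <= e + L / d%:R.
  move=> e0; have /cctsP/(_ _ e0)[D D0 hD] := fc z.
  pose L := 2 * M * r ^+ 2 / D ^+ 2.
  have L0 : 0 <= L by rewrite !mulr_ge0 ?invr_ge0 ?exprn_ge0 // ltW.
  exists (L * 4) => [|d d0]; first by rewrite mulr_ge0.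
  have hm := has_meanD (meanK d) (has_meanZ (- f z) (K1 d d0)).
  rewrite mulr1 in hm.
  pose k w := e * complex.Re (K d w) + L * 4 / d%:R.
  have KE w : cabs w = r -> K d w = (complex.Re (K d w))%:C.
    by move=> /uw u1; rewrite /K fejerE.
  have hk : has_mean (fun w => (k w)%:C) r (e + L * 4 / d%:R)%:C.
    have := has_meanD (has_meanZ e%:C (K1 d d0)) (has_mean_cst (L * 4 / d%:R)%:C r).
    rewrite mulr1 -rmorphD; apply: has_mean_ext; first exact: ltW.
    by move=> w wr; rewrite {1}(KE w wr) realcM realcD.
  have bound w : cabs w = r -> cabs (f w * K d w + - f z * K d w) <= k w.
    move=> wr; have u1 := uw w wr.
    have K0 : 0 <= complex.Re (K d w).
      by rewrite /K fejerE //= mulr_ge0 ?invr_ge0 // exprn_ge0 // cabs_ge0.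
    have conc := fejer_concentrated d0 u1; rewrite -/(K d w) in conc.
    rewrite -mulrDl (cabsM (_ + _)) /k.
    have -> : cabs (K d w) = complex.Re (K d w).
      by rewrite {1}(KE w wr) cabs_real ger0_norm.
    have sq : cabs (w - z) = r * cabs (w / z - 1).
      by rewrite -cabsM; congr cabs; field.
    have fw : cabs (f w - f z) <= e + L * cabs (w / z - 1) ^+ 2.
      have [wD|wD] := ltP (cabs (w - z)) D.
        by apply: (le_trans (ltW (hD w wD))); rewrite lerDl mulr_ge0 // exprn_ge0 // cabs_ge0.
      apply: (@le_trans _ _ (2 * M)).
        by apply: le_trans (cabsB _ _) _; have := fM w wr; lra.
      have : 2 * M <= L * cabs (w / z - 1) ^+ 2.
        rewrite /L mulrAC ler_pdivlMr ?exprn_gt0 // -[X in _ <= X]mulrA -exprMn -sq.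
        rewrite ler_wpM2l ?mulr_ge0 //.
        by rewrite lerXn2r ?nnegrE ?cabs_ge0 // ltW.
      by lra.
    apply: (@le_trans _ _ ((e + L * cabs (w / z - 1) ^+ 2) * complex.Re (K d w))).
      by rewrite ler_wpM2r.
    by rewrite mulrDl lerD2l -(mulrA L (_ ^+ 2)) -(mulrA L 4) ler_wpM2l.
  exact: has_mean_le (ltW r0) bound hm hk.
have tail j n : (j <= n)%N -> cabs (S n - S j) <= 2 * M * (2^-1) ^+ j.
  move=> jn; rewrite /S -!(big_mkord xpredT (fun k => c k * z ^+ k)).
  rewrite (big_cat_nat (leq0n j) jn) /= [X in cabs X]addrAC subrr add0r.
  apply: le_trans (cabs_sum _ _ _) _.
  apply: le_trans (geometric_tail j n M0 (_ : 0 <= 2^-1 <= 2^-1)); last first.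
    by rewrite lexx invr_ge0 ler0n.
  by apply: ler_sum => k _; apply: term.
have cesaro d : (0 < d)%N -> cabs (d%:R^-1 * (\sum_(j < d) S j.+1) - S d) <= M * 2 / d%:R.
  move=> d0; have dn0 : d%:R != 0 :> C by rewrite pnatr_eq0 -lt0n.
  rewrite (_ : _ - _ = d%:R^-1 * \sum_(j < d) (S j.+1 - S d)); last first.
    by rewrite sumrB sumr_const card_ord -(mulr_natl (S d)); field.
  rewrite cabsM cabsV cabs_nat mulrC ler_wpM2r ?invr_ge0 //.
  apply: le_trans (cabs_sum _ _ _) _.
  apply: (@le_trans _ _ (\sum_(j < d) M * (2^-1) ^+ j)).
    apply: ler_sum => j _; rewrite cabsC; apply: le_trans (tail j.+1 d _) _ => //.
    by rewrite exprS le_eqVlt; apply/orP; left; apply/eqP; field.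
  rewrite -mulr_sumr ler_wpM2l //.
  apply: le_trans (geometric_le _ _) _; first by apply/andP; split; lra.
  by rewrite -[X in _ <= X]invrK lef_pV2 ?posrE; lra.
apply/cvgcP => e e0; have [|L L0 hL] := key (e / 2); first by rewrite divr_gt0.
have : (L + M * 2) / n%:R @[n --> \oo] --> (0 : R).
  rewrite -(mulr0 (L + M * 2)); apply: cvgMl_tmp; exact: cvg_natV.
move=> /cvgrPdistC_lt/(_ (e / 2)); rewrite divr_gt0 // => /(_ isT) [N _ hN].
exists N.+1 => // d /= Nd; have d0 : (0 < d)%N by apply: leq_ltn_trans Nd.
have := hN d (ltnW Nd); rewrite /= subr0 => /ltr_normlW h1.
have h2 := hL d d0; have h3 := cesaro d d0.
rewrite cabsC in h3.
have := cabs_triangle (d%:R^-1 * (\sum_(j < d) S j.+1)) (S d) (f z).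
by rewrite -/(S d); lra.
Qed.

End PowerSeries.

(** * Zeros and multiplicities *)

Section Zeros.
Context {R : realType}.
Local Notation C := R[i].
Local Notation Co := (R[i]^o).
Implicit Types (f g h : C -> C) (z w a : C).

Lemma cvgc_cabs_le (T : Type) (F : set_system T) {FF : ProperFilter F}
    (u : T -> C) (l a : C) (B : R) :
  (u x : Co) @[x --> F] --> (l : Co) -> (\forall x \near F, cabs (u x - a) <= B) ->
  cabs (l - a) <= B.
Proof.
move=> /cvgcP ul uB; apply/ler_addgt0Pr => e e0.
have [x [h1 h2]] := @filter_ex _ F FF _ (filterI (ul e e0) uB).
by have := cabs_triangle (u x) l a; rewrite (cabsC l (u x)); lra.
Qed.

Lemma entire_cdiff f z : entire f -> cdiff f z.
Proof. by move=> /entireP. Qed.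

Lemma entire_ccts f z : entire f -> ccts f z.
Proof. by move=> /entireP h; apply: cdiff_cts. Qed.

Lemma entire_taylor f : entire f -> exists c, taylor f c.
Proof.
by move=> fe; apply: power_series => [|z _]; [exact: entire_ccts | exact: entire_cdiff].
Qed.

Lemma taylor_coef0 f c : taylor f c -> c 0%N = f 0.
Proof.
move=> [_ _ /(_ 0) h]; apply/esym; apply: (@cvgc_unique R nat \oo _ _ _ _ h).
apply: cvg_near_cst; exists 1%N => // -[//|n] _ /=.
rewrite big_ord_recl big1 => [|i _]; last by rewrite exprS mul0r mulr0.
by rewrite expr0 mulr1 addr0.
Qed.

Lemma taylor_cauchy f c (r B : R) k : taylor f c -> 0 < r ->
  (forall w, cabs w = r -> cabs (f w) <= B) -> cabs (c k) * r ^+ k <= B.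
Proof.
move=> [cV _ _] r0 hB; rewrite -ler_pdivlMr ?exprn_gt0 //.
apply: has_mean_bound (cV r k r0); first exact: ltW.
move=> w wr; rewrite cabsM cabsV cabsX wr ler_wpM2r ?invr_ge0 ?exprn_ge0 ?(ltW r0) //.
exact: hB.
Qed.

(** By Cauchy's estimates the terms decrease at least as fast as the powers of
    [|z| / r <= 1/2]. *)
Lemma taylor_tail f c (r B : R) z n : taylor f c -> 0 < r ->
  (forall w, cabs w = r -> cabs (f w) <= B) -> cabs z <= r / 2 ->
  cabs (f z - \sum_(k < n) c k * z ^+ k) <= 2 * B * (cabs z / r) ^+ n.
Proof.
move=> tf r0 hB zr.
have B0 : 0 <= B.
  by have := taylor_cauchy 0 tf r0 hB; rewrite expr0 mulr1; apply/le_trans/cabs_ge0.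
pose q := cabs z / r.
have q0 : 0 <= q by rewrite divr_ge0 ?cabs_ge0 // ltW.
have q1 : q <= 2^-1 by rewrite ler_pdivrMr // mulrC.
pose S m := \sum_(k < m) c k * z ^+ k.
have bnd m : (n <= m)%N -> cabs (S m - S n) <= 2 * B * q ^+ n.
  move=> nm; rewrite /S -!(big_mkord xpredT (fun k => c k * z ^+ k)).
  rewrite (big_cat_nat (leq0n n) nm) /= [X in cabs X]addrAC subrr add0r.
  apply: le_trans (cabs_sum _ _ _) _.
  apply: le_trans (geometric_tail n m B0 (_ : 0 <= q <= 2^-1)); last by rewrite q0.
  apply: ler_sum => k _; rewrite cabsM cabsX /q expr_div_n mulrA ler_pdivlMr ?exprn_gt0 //.
  rewrite mulrAC ler_wpM2r ?exprn_ge0 ?cabs_ge0 //.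
  exact: taylor_cauchy tf r0 hB.
have [_ _ /(_ z) hz] := tf.
apply: (@cvgc_cabs_le nat \oo _ S) hz _.
by exists n => // m /= nm; apply: bnd.
Qed.

(** The remainder of order two bounds the error of linearization. *)
Lemma taylor_cdiff0 f c : (forall z, ccts f z) -> taylor f c -> cdiff f 0.
Proof.
move=> fc tf; have [B B0 hB] := cts_disc_bounded ltr01 fc.
apply/cdiff_local; exists (c 1%N) => e e0.
have B1 : 0 < 2 * B + 1 by rewrite ltr_wpDl // mulr_ge0.
exists (Num.min (2^-1) (e / (2 * B + 1))).
  by rewrite lt_min invr_gt0 ltr0n divr_gt0.
move=> w; rewrite subr0 lt_min => /andP[w1 w2].
have H : cabs (f w - \sum_(k < 2) c k * w ^+ k) <= 2 * B * cabs w ^+ 2.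
  rewrite -[cabs w in X in _ <= X]divr1; apply: (taylor_tail 2 tf ltr01).
    by move=> v v1; apply: hB; rewrite v1.
  by rewrite div1r ltW.
rewrite !big_ord_recr big_ord0 /= add0r expr0 mulr1 expr1 (taylor_coef0 tf) in H.
have -> : f w - f 0 - w * c 1%N = f w - (f 0 + c 1%N * w) by ring.
apply: le_trans H _; rewrite expr2 mulrA ler_wpM2r ?cabs_ge0 //.
move: w2; rewrite ltr_pdivlMr // => w2; have := cabs_ge0 w; nra.
Qed.

Lemma entireD f g : entire f -> entire g -> entire (fun w => f w + g w).
Proof. by move=> /entireP hf /entireP hg; apply/entireP => z; apply: cdiffD. Qed.

Lemma entireB f g : entire f -> entire g -> entire (fun w => f w - g w).
Proof. by move=> /entireP hf /entireP hg; apply/entireP => z; apply: cdiffB. Qed.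

Lemma entireM f g : entire f -> entire g -> entire (fun w => f w * g w).
Proof. by move=> /entireP hf /entireP hg; apply/entireP => z; apply: cdiffM. Qed.

Lemma entire_comp f g : entire f -> entire g -> entire (fun w => f (g w)).
Proof. by move=> /entireP hf /entireP hg; apply/entireP => z; apply: cdiff_comp. Qed.

Lemma entire_cst (c : C) : entire (fun=> c).
Proof. by apply/entireP => z; apply: cdiff_cst. Qed.

Lemma entire_id : entire (fun w : C => w).
Proof. by apply/entireP => z; apply: cdiff_id. Qed.

Lemma entire_conj f : entire f -> entire (fun w => (f w^*)^*).
Proof. by move=> /entireP hf; apply/entireP => z; apply: cdiff_conj. Qed.

Lemma entire_shift f a : entire f -> entire (fun w => f (a + w)).
Proof.
move=> fe; apply: (entire_comp fe); apply: entireD (entire_id).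
exact: entire_cst.
Qed.

(** The quotient is continuous at the zero, and [power_series] makes it
    differentiable there. *)
Lemma entire_div f a : entire f -> f a = 0 ->
  exists2 h, entire h & forall w, f w = (w - a) * h w.
Proof.
move=> fe fa0; have [p hp pE] := entire_cdiff a fe.
have fE w : f w = (w - a) * p w by rewrite pE fa0 add0r.
exists p; last by move=> w; exact: fE.
have dp z : z != a -> cdiff p z.
  move=> za; have D0 : 0 < cabs (z - a) by rewrite cabs_gt0 subr_eq0.
  apply: (@cdiff_near R (fun w => f w / (w - a))).
    apply/nbhscP; exists (cabs (z - a)) => // w wz.
    rewrite fE mulrC mulKf // subr_eq0; apply/eqP => wa.
    by move: wz; rewrite wa cabsC ltxx.
  apply: cdiffM; first exact: entire_cdiff.
  apply: cdiffV; first by rewrite subr_eq0.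
  by apply: cdiffB; [exact: cdiff_id | exact: cdiff_cst].
have pc z : ccts p z by have [->//|/dp/cdiff_cts] := eqVneq z a.
pose q w := p (a + w).
have sh z : cdiff (fun w => a + w) z by apply: cdiffD; [exact: cdiff_cst | exact: cdiff_id].
have qc z : ccts q z.
  by apply: ccts_comp (pc (a + z)); apply: cdiff_cts (sh z).
have dq z : z != 0 -> cdiff q z.
  by move=> z0; apply: cdiff_comp (sh z) _; apply: dp; rewrite -subr_eq0 addrC addKr.
have [c tq] := power_series (qc 0) dq.
have dq0 := taylor_cdiff0 qc tq.
apply/entireP => z; have [->|/dp//] := eqVneq z a.
apply: (@cdiff_near R (fun w => q (w - a))).
  by apply/nbhscP; exists 1 => // w _; rewrite /q addrC subrK.
apply: (@cdiff_comp R q (fun w => w - a)); last by rewrite subrr.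
by apply: cdiffB; [exact: cdiff_id | exact: cdiff_cst].
Qed.

Lemma taylor_div f h c : taylor f c -> entire h -> (forall w, f w = w * h w) ->
  taylor h (fun k => c k.+1).
Proof.
move=> [cV cM cS] he fE; have [d td] := entire_taylor he.
rewrite (_ : (fun k => _) = d) //; apply/funext => k.
case: td => dV _ _; apply: has_mean_unique (dV 1 k ltr01).
apply: has_mean_ext (cV 1 k.+1 ltr01) => // w w1.
have w0 : w != 0 by rewrite -cabs_gt0 w1.
by rewrite fE exprS invfM mulrACA divff // mul1r.
Qed.

(** Some Taylor coefficient at [a] is nonzero, and dividing out a zero shifts
    the coefficients. *)
Lemma entire_order f a : entire f -> (exists z, f z != 0) ->
  exists m h, [/\ entire h, h a != 0 & forall w, f w = (w - a) ^+ m * h w].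
Proof.
move=> fe [z0 fz0].
have [c tc] := entire_taylor (@entire_shift _ a fe).
have [m cm] : exists m, c m != 0.
  apply: contrapT => H; case/negP: fz0; apply/eqP.
  have c0 k : c k = 0 by apply/eqP; apply: contrapT => /negP ck; apply: H; exists k.
  have [_ _ /(_ (z0 - a))] := tc; rewrite (_ : a + (z0 - a) = z0); last by ring.
  move=> hz; apply: (@cvgc_unique R nat \oo _ _ _ _ hz).
  apply: (@cvgc_ext R nat \oo _ (fun=> 0)) => [n|]; last exact: cvgc_cst.
  by rewrite big1 // => i _; rewrite c0 mul0r.
elim: m f c fe tc cm {z0 fz0} => [|m IH] f c fe tc cm.
  exists 0%N, f; split=> // [|w]; last by rewrite expr0 mul1r.
  by rewrite -(addr0 a) -(taylor_coef0 tc).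
have [fa0|fa] := eqVneq (f a) 0; last first.
  by exists 0%N, f; split=> // w; rewrite expr0 mul1r.
have [h he fE] := entire_div fe fa0.
have th : taylor (fun w => h (a + w)) (fun k => c k.+1).
  by apply: taylor_div tc (@entire_shift _ a he) _ => w; rewrite fE addrC addKr.
have [n [g [ge ga hE]]] := IH h _ he th cm.
by exists n.+1, g; split=> // w; rewrite fE hE exprS mulrA.
Qed.

Lemma ccts_neq0 g z : ccts g z -> g z != 0 ->
  exists2 D : R, 0 < D & forall w, cabs (w - z) < D -> g w != 0.
Proof.
rewrite -cabs_gt0 => /cctsP gc gz; have [D D0 hD] := gc _ gz.
exists D => // w /hD; apply: contraTneq => ->.
by rewrite sub0r cabsN ltxx.
Qed.

(** If [m < n], dividing by [(w - a) ^+ m] off [a] and passing to the limit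
    gives [h a = 0]. *)
Lemma order_unique m n h g a : ccts h a -> ccts g a -> h a != 0 -> g a != 0 ->
  (forall w, (w - a) ^+ m * h w = (w - a) ^+ n * g w) -> m = n.
Proof.
wlog mn : m n h g / (m < n)%N.
  move=> H hc gc h0 g0 e; have [mn|nm|//] := ltngtP m n; first exact: (H m n h g).
  by apply/esym; apply: (H n m g h).
move=> hc gc h0 g0 e; exfalso; case/negP: h0; apply/eqP.
pose k w := (w - a) ^+ (n - m) * g w.
have kc : ccts k a.
  apply: cctsM gc; apply: cdiff_cts; apply: cdiffX.
  by apply: cdiffB; [exact: cdiff_id | exact: cdiff_cst].
have ka : k a = 0 by rewrite /k subrr expr0n subn_eq0 leqNgt mn mul0r.
have hk w : w != a -> h w = k w.
  move=> wa; have wa0 : (w - a) ^+ m != 0 by rewrite expf_neq0 // subr_eq0.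
  apply: (mulfI wa0); rewrite e /k mulrA -exprD subnKC // ltnW //.
apply/eqP; rewrite -cabs_eq0 eq_le cabs_ge0 andbT; apply/ler_addgt0Pr => e' e'0.
have e2 : 0 < e' / 2 by rewrite divr_gt0.
have /cctsP/(_ _ e2)[D1 D10 h1] := hc; have /cctsP/(_ _ e2)[D2 D20 h2] := kc.
have [t t0 [t1 t2]] : exists2 t : R, 0 < t & t < D1 /\ t < D2.
  exists (Num.min D1 D2 / 2); first by rewrite divr_gt0 // lt_min D10.
  by split; rewrite ltr_pdivrMr // mulr_natr; rewrite gt_min; apply/orP;
    [left|right]; rewrite mulr2n ltrDl.
have at0 : cabs (a + t%:C - a) = t by rewrite addrC addKr cabs_real gtr0_norm.
have na : a + t%:C != a by rewrite -subr_eq0 -cabs_gt0 at0.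
have := h1 (a + t%:C); have := h2 (a + t%:C); rewrite at0 ka subr0 -(hk _ na).
move=> /(_ t2) a2 /(_ t1) a1.
have := cabs_sub_ge (h a) (h (a + t%:C)); rewrite (cabsC (h a)); lra.
Qed.

Lemma mult_eq f a m h : entire h -> h a != 0 -> (forall w, f w = (w - a) ^+ m * h w) ->
  mult f a = m.
Proof.
move=> he h0 fE.
have : [set m | exists h : C -> C, [/\ entire h, h a != 0 &
    forall w, f w = (w - a) ^+ m * h w]] (mult f a).
  by apply: (@xgetPex _ 0%N); exists m, h.
move=> [g [ge g0 gE]]; apply: order_unique (entire_ccts a ge) (entire_ccts a he) g0 h0 _.
by move=> w; rewrite -gE -fE.
Qed.

Lemma multP f a : entire f -> (exists z, f z != 0) ->
  exists h, [/\ entire h, h a != 0 & forall w, f w = (w - a) ^+ mult f a * h w].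
Proof.
move=> fe fn; have [m [h [he h0 fE]]] := entire_order a fe fn.
by exists h; rewrite (mult_eq he h0 fE).
Qed.

Lemma mult0P f a : entire f -> (exists z, f z != 0) -> (mult f a == 0%N) = (f a != 0).
Proof.
move=> fe fn; have [h [he h0 fE]] := multP a fe fn.
rewrite fE subrr expr0n; case: (mult f a) => [|m] /=; first by rewrite mul1r h0.
by rewrite mul0r eqxx.
Qed.

Lemma entire_isolated f a : entire f -> (exists z, f z != 0) ->
  exists2 D : R, 0 < D & forall w, w != a -> cabs (w - a) < D -> f w != 0.
Proof.
move=> fe fn; have [h [he h0 fE]] := multP a fe fn.
have [D D0 hD] := ccts_neq0 (entire_ccts a he) h0; exists D => // w wa /hD hw.
by rewrite fE mulf_neq0 // expf_neq0 // subr_eq0.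
Qed.

Lemma multM f g a : entire f -> entire g -> (exists z, f z != 0) ->
  (exists z, g z != 0) -> mult (fun w => f w * g w) a = (mult f a + mult g a)%N.
Proof.
move=> fe ge fn gn.
have [h [he h0 fE]] := multP a fe fn; have [k [ke k0 gE]] := multP a ge gn.
apply: (mult_eq (h := fun w => h w * k w)); first exact: entireM.
  by rewrite mulf_neq0.
by move=> w; rewrite (fE w) (gE w) exprD mulrACA.
Qed.

Lemma mult_conj f a : entire f -> (exists z, f z != 0) ->
  mult (fun w => (f w^*)^*) a = mult f a^*.
Proof.
move=> fe fn; have [h [he h0 fE]] := multP a^* fe fn.
apply: (mult_eq (h := fun w => (h w^*)^*)); first exact: entire_conj.
  by rewrite -cabs_eq0 cabs_conj cabs_eq0.
by move=> w; rewrite (fE w^*) conjcM conjcX conjcD conjcN !conjcI.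
Qed.

Lemma mult_scale f (u : C) a : u != 0 -> entire f -> (exists z, f z != 0) ->
  mult (fun w => f (u * w)) a = mult f (u * a).
Proof.
move=> u0 fe fn; have [h [he h0 fE]] := multP (u * a) fe fn.
apply: (mult_eq (h := fun w => u ^+ mult f (u * a) * h (u * w))).
- apply: entireM; first exact: entire_cst.
  by apply: entire_comp he _; apply: entireM entire_id; apply: entire_cst.
- by rewrite mulf_neq0 // expf_neq0.
- by move=> w; rewrite (fE (u * w)) -mulrBr exprMn (mulrC (u ^+ _)) -mulrA.
Qed.

Lemma entire_factor f (s : seq C) : entire f -> (exists z, f z != 0) -> uniq s ->
  exists h, [/\ entire h, exists z, h z != 0,
    forall w, f w = \prod_(a <- s) (w - a) ^+ mult f a * h w &
    forall b, mult h b = if b \in s then 0%N else mult f b].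
Proof.
move=> fe fn; elim: s => [_|a s IH /= /andP[ans us]].
  by exists f; split=> // w; rewrite big_nil mul1r.
have [h [he hn fE hm]] := IH us.
have [g [ge ga hE]] := multP a he hn.
have ha : mult h a = mult f a by rewrite hm (negbTE ans).
have gn : exists z, g z != 0 by exists a.
exists g; split; [exact: ge | exact: gn | |].
  by move=> w; rewrite big_cons fE hE ha mulrA (mulrC (_ ^+ _)).
move=> b; rewrite inE; case: eqVneq => [->|ba] /=.
  by apply/eqP; rewrite mult0P.
rewrite -hm; apply/esym.
have [k [ke kb gE]] := multP b ge gn.
apply: (mult_eq (h := fun w => (w - a) ^+ mult h a * k w)).
- apply: entireM ke; apply/entireP => z; apply: cdiffX.
  by apply: cdiffB; [exact: cdiff_id | exact: cdiff_cst].
- by rewrite mulf_neq0 // expf_neq0 // subr_eq0.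
- by move=> w; rewrite (hE w) (gE w) mulrCA.
Qed.

Lemma entire_center_le f (r B : R) : entire f -> 0 < r ->
  (forall w, cabs w = r -> cabs (f w) <= B) -> cabs (f 0) <= B.
Proof.
move=> fe r0 hB; have [c tc] := entire_taylor fe.
by have := taylor_cauchy 0 tc r0 hB; rewrite expr0 mulr1 (taylor_coef0 tc).
Qed.

(** A crude form of Jensen's inequality. On the circle of radius [3 r] each
    factor [w - a] has modulus at least [2 r], and at the centre at most [r];
    so each zero costs a factor two in the bound of the quotient at the
    centre. *)
Lemma zero_count f (s : seq C) (r B : R) : entire f -> f 0 != 0 -> 0 < r -> uniq s ->
  (forall a, a \in s -> cabs a <= r) ->
  (forall w, cabs w = 3 * r -> cabs (f w) <= B) ->
  2 ^+ (\sum_(a <- s) mult f a) * cabs (f 0) <= B.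
Proof.
move=> fe f0 r0 us sr hB.
have [|h [he hn fE _]] := entire_factor fe _ us; first by exists 0.
pose N := (\sum_(a <- s) mult f a)%N.
have r20 : 0 < 2 * r by rewrite mulr_gt0.
have lo : cabs (\prod_(a <- s) (0 - a) ^+ mult f a) <= r ^+ N.
  rewrite cabs_prod /N expr_sum big_seq [X in _ <= X]big_seq; apply: ler_prod => a sa.
  by rewrite cabs_ge0 /= cabsX sub0r cabsN lerXn2r ?nnegrE ?cabs_ge0 ?(ltW r0) // sr.
have hi w : cabs w = 3 * r -> (2 * r) ^+ N <= cabs (\prod_(a <- s) (w - a) ^+ mult f a).
  move=> wr; rewrite cabs_prod /N expr_sum big_seq [X in _ <= X]big_seq.
  apply: ler_prod => a sa; rewrite exprn_ge0 ?(ltW r20) //= cabsX.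
  rewrite lerXn2r ?nnegrE ?cabs_ge0 ?(ltW r20) //.
  by move: (cabs_sub_ge w a) (sr a sa); rewrite wr; clear; lra.
have h0 : cabs (h 0) <= B / (2 * r) ^+ N.
  apply: (@entire_center_le h (3 * r)) => //; first by rewrite mulr_gt0.
  move=> w wr; rewrite ler_pdivlMr ?exprn_gt0 //.
  apply: le_trans (hB w wr); rewrite fE cabsM mulrC ler_wpM2r ?cabs_ge0 //.
  exact: hi.
rewrite fE cabsM; move: h0; rewrite ler_pdivlMr ?exprn_gt0 // exprMn => h0.
apply: le_trans h0; rewrite (mulrC (cabs (h 0))) mulrA -/N.
by rewrite ler_wpM2r ?cabs_ge0 // ler_wpM2l // exprn_ge0.
Qed.

End Zeros.

(** * Growth and summability of the zeros *)

Section ConvergenceExponent.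
Context {R : realType}.
Local Notation C := R[i].
Local Notation Co := (R[i]^o).
Implicit Types (f g : C -> C) (M : C -> nat).

(** Finite order with an integral exponent; the other constants of the
    definition are absorbed in [A], as [1 <= |z|]. *)
Definition growth f (q : nat) (A : R) : Prop :=
  forall z, 1 <= cabs z -> cabs (f z) <= expR (A * cabs z ^+ q).

Lemma finite_order_growth f : entire f -> finite_order f ->
  exists q A, 0 <= A /\ growth f q A.
Proof.
move=> fe [c [K [r [c0 hK]]]].
have [B B0 hB] := @cts_disc_bounded R f (Num.max r 1) ltac:(by rewrite lt_max ltr01 orbT)
  (fun z => entire_ccts z fe).
pose q := (Num.trunc c).+1.
pose A := ln (B + 1) + ln (`|K| + 1) + 1.
have lnB0 : 0 <= ln (B + 1) by apply: ln_ge0; rewrite lerDr.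
have lnK0 : 0 <= ln (`|K| + 1) by apply: ln_ge0; rewrite lerDr.
have A0 : 0 <= A by rewrite !addr_ge0.
exists q, A; split=> // z z1.
have zq : 1 <= cabs z ^+ q by rewrite exprn_ege1.
have [zr|/ltW rz] := leP (cabs z) (Num.max r 1).
  apply: le_trans (hB _ zr) _; apply: (@le_trans _ _ (expR (ln (B + 1)))).
    by rewrite lnK ?posrE ?ltr_wpDl // lerDl.
  rewrite ler_expR; apply: (@le_trans _ _ (A * 1)); last by rewrite ler_wpM2l.
  by rewrite mulr1 /A -addrA lerDl addr_ge0.
have rz' : r <= cabs z by apply: le_trans rz; rewrite le_max lexx.
apply: le_trans (hK z rz') _.
apply: (@le_trans _ _ ((`|K| + 1) * expR (cabs z `^ c))).
  by rewrite ler_wpM2r ?expR_ge0 // (le_trans (ler_norm K)) // lerDl.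
have -> : `|K| + 1 = expR (ln (`|K| + 1)) by rewrite lnK // posrE ltr_wpDl.
rewrite -expRD ler_expR.
have cq : cabs z `^ c <= cabs z ^+ q.
  rewrite -powR_mulrn ?cabs_ge0 //; apply: ler_powR => //.
  by have /andP[_ /ltW] := Num.Theory.trunc_itv (ltW c0).
have : ln (`|K| + 1) * 1 <= ln (`|K| + 1) * cabs z ^+ q by rewrite ler_wpM2l.
have : 0 <= ln (B + 1) * cabs z ^+ q by rewrite mulr_ge0 // exprn_ge0 ?cabs_ge0.
rewrite /A; move: cq; clear; lra.
Qed.

Definition zeros_sum M p (s : seq C) : R := \sum_(a <- s) (M a)%:R / cabs a ^+ p.+1.

(** The finiteness of [zero_sum] by bounds on finite sums, for any
    multiplicity function. The terms at the origin are zero, since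
    [0^-1 = 0]. *)
Definition summable_zeros M p : Prop :=
  exists B, forall s, uniq s -> zeros_sum M p s <= B.

Lemma zeros_sum_filter M p (s : seq C) :
  zeros_sum M p s = zeros_sum M p [seq a <- s | (M a != 0%N) && (a != 0)].
Proof.
rewrite /zeros_sum big_filter [RHS]big_mkcond; apply: eq_bigr => a _.
have [->|Ma] := eqVneq (M a) 0%N; first by rewrite mul0r.
by have [->|a0] := eqVneq a 0; rewrite // cabs0 exprS mul0r invr0 mulr0.
Qed.

Lemma zero_sumP f p : (zero_sum f p < +oo)%E <-> summable_zeros (mult f) p.
Proof.
rewrite /zero_sum; set S := [set a | _]; set F := fun a => _.
have F0 a : S a -> (0 <= F a)%E.
  by move=> _; rewrite lee_fin divr_ge0 // exprn_ge0 // cabs_ge0.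
have sumE (s : seq C) : uniq s -> [set` s] `<=` S ->
    (\sum_(a \in [set` s]) F a)%E = (zeros_sum (mult f) p s)%:E.
  move=> us sS; by rewrite -fsbig_seq //= sumEFin.
split=> [fin|[B hB]].
  have [b hb] : exists b : R, \esum_(a in S) F a = b%:E.
    exists (fine (\esum_(a in S) F a)); rewrite fineK // ge0_fin_numE //.
    exact: esum_ge0.
  exists b => s us; rewrite zeros_sum_filter; set t := (X in zeros_sum _ _ X).
  rewrite -lee_fin -hb -sumE; first last.
  - by move=> a /=; rewrite mem_filter => /andP[/andP[]].
  - exact: filter_uniq.
  apply: esum_ge; exists [set` t] => //; split; first exact: finite_seq.
  by move=> a /=; rewrite mem_filter => /andP[/andP[]].
apply: (@le_lt_trans _ _ B%:E); last exact: ltry.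
apply: ub_ereal_sup => _ [A [fA AS] <-].
rewrite fsbig_finite //= sumEFin lee_fin; exact: hB (fset_uniq _).
Qed.

Lemma genusP f : (exists p, summable_zeros (mult f) p) ->
  summable_zeros (mult f) (genus f).
Proof.
move=> [p /zero_sumP hp]; apply/zero_sumP; rewrite /genus.
have ex : exists p, `[< (zero_sum f p < +oo)%E >] by exists p; apply/asboolP.
case: (ex_minnP ex) => m /asboolP hm mmin.
have : [set p | (zero_sum f p < +oo)%E /\ forall q, (zero_sum f q < +oo)%E -> (p <= q)%N]
    (xget 0%N [set p | (zero_sum f p < +oo)%E /\
       forall q, (zero_sum f q < +oo)%E -> (p <= q)%N]).
  by apply: (@xgetPex _ 0%N); exists m; split=> // q /asboolP; apply: mmin.
by case.
Qed.

(** Up to constants, the logarithm of [zero_count] with the growth bound on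
    the circle of radius [3 r]. *)
Lemma growth_count f q A : entire f -> f 0 != 0 -> 0 <= A -> growth f q A ->
  exists2 K : R, 0 <= K & forall (s : seq C) (r : R), uniq s -> 1 <= r ->
    (forall a, a \in s -> cabs a <= r) -> (\sum_(a <- s) mult f a)%:R <= K * r ^+ q.
Proof.
move=> fe f0 A0 fg; have f00 : 0 < cabs (f 0) by rewrite cabs_gt0.
exists (2 * (A * 3 ^+ q + `|ln (cabs (f 0))|)) => [|s r us r1 sr].
  by rewrite mulr_ge0 // addr_ge0 // mulr_ge0 // exprn_ge0.
have r0 : 0 < r by apply: lt_le_trans r1.
have rq : 1 <= r ^+ q by rewrite exprn_ege1.
set N := (\sum_(a <- s) mult f a)%N.
have : 2 ^+ N * cabs (f 0) <= expR (A * (3 * r) ^+ q).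
  apply: (zero_count fe f0 r0 us sr) => w wr.
  by rewrite -wr; apply: fg; rewrite wr; move: r1; clear; lra.
rewrite -{1}(lnK (_ : cabs (f 0) \in Num.pos)) ?posrE // => H.
have : expR (N%:R / 2 + ln (cabs (f 0))) <= expR (A * (3 * r) ^+ q).
  apply: le_trans H; rewrite expRD ler_wpM2r ?expR_ge0 // expRM_natl.
  by rewrite lerXn2r ?nnegrE ?expR_ge0 // expR_half_le2.
rewrite ler_expR exprMn => {}H.
have : `|ln (cabs (f 0))| * 1 <= `|ln (cabs (f 0))| * r ^+ q by rewrite ler_wpM2l.
have := ler_norm (- ln (cabs (f 0))); rewrite normrN; move: H; clear; lra.
Qed.

(** In the dyadic annulus of outer radius [2 ^+ l] there are at most
    [K * 2 ^+ (l q)] zeros, each of which contributes about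
    [2 ^- (l (q + 1))]. *)
Lemma growth_summable f q A : entire f -> f 0 != 0 -> 0 <= A -> growth f q A ->
  summable_zeros (mult f) q.
Proof.
move=> fe f0 A0 fg; have [K K0 hK] := growth_count fe f0 A0 fg.
have [D' D'0 hD'] := ccts_neq0 (entire_ccts 0 fe) f0.
have [D [D0 D1] hD] : exists2 D : R, 0 < D /\ D <= 1 & forall a, mult f a != 0%N -> D <= cabs a.
  exists (Num.min D' 1); first by rewrite lt_min D'0 ltr01 ge_min lexx orbT.
  move=> a; rewrite mult0P //; last by exists 0.
  rewrite negbK => /eqP fa; rewrite ge_min; case: leP => //= aD.
  by have := hD' a; rewrite subr0 fa eqxx => /(_ aD).
pose E := (2 / D) ^+ q.+1.
have E0 : 0 <= E by rewrite exprn_ge0 // divr_ge0 // ltW.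
exists (E * K * 2) => s us.
have [L hL] : exists L, forall a, a \in s -> cabs a <= 2 ^+ L.
  have [B hB] : exists B : R, forall a, a \in s -> cabs a <= B.
    exists (\sum_(a <- s) cabs a) => a sa.
    by rewrite (big_rem a) //= lerDl; apply: sumr_ge0 => b _; apply: cabs_ge0.
  exists (Num.trunc B).+1 => a /hB le; apply: le_trans le _.
  have [B0|/ltW B0] := leP 0 B; last by apply: le_trans B0 _; rewrite exprn_ge0.
  have /andP[_ /ltW h] := Num.Theory.trunc_itv B0; apply: le_trans h _.
  by rewrite -natrX ler_nat ltnW // ltn_expl.
(* [t l a] counts the zero [a] in all the discs that contain it, so that a
   single bound of the zeros in a disc can be applied; the least such [l]
   gives the inequality [pt] *)
pose t l a : R := if cabs a <= 2 ^+ l then (mult f a)%:R else 0.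
have pt a : a \in s -> (mult f a)%:R / cabs a ^+ q.+1 <=
    \sum_(l < L.+1) E * (2 ^- l) ^+ q.+1 * t l a.
  move=> sa; have [m0|m0] := eqVneq (mult f a) 0%N.
    rewrite m0 mul0r; apply: sumr_ge0 => l _; rewrite mulr_ge0 //.
      by rewrite mulr_ge0 // exprn_ge0 // invr_ge0 exprn_ge0.
    by rewrite /t; case: ifP.
  have aD := hD a m0; have a0 : 0 < cabs a by apply: lt_le_trans aD.
  have ex : exists l, cabs a <= 2 ^+ l by exists L; apply: hL.
  case: (ex_minnP ex) => l al lmin.
  have lL : (l < L.+1)%N by rewrite ltnS; apply/lmin/hL.
  rewrite (bigD1 (Ordinal lL)) //= /t al; apply: ler_wpDr.
    apply: sumr_ge0 => k _; rewrite mulr_ge0 //; last by case: ifP.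
    by rewrite mulr_ge0 // exprn_ge0 // invr_ge0 exprn_ge0.
  rewrite mulrC ler_wpM2r // /E -exprMn -(exprVn (cabs a)) lerXn2r ?nnegrE ?invr_ge0 ?(ltW a0) //.
    by rewrite mulr_ge0 ?invr_ge0 ?exprn_ge0 // divr_ge0 // ltW.
  have [l0|l0] := posnP l.
    rewrite l0 expr0 invr1 mulr1; apply: (@le_trans _ _ D^-1).
      by rewrite lef_pV2 ?posrE.
    by rewrite ler_peMl ?invr_ge0 ?(ltW D0) // ler1n.
  have : 2 ^+ l.-1 < cabs a.
    by rewrite ltNge; apply/negP => /lmin; rewrite leqNgt prednK // leqnn.
  move=> h; apply: (@le_trans _ _ (2 ^- l.-1)).
    by rewrite lef_pV2 ?posrE ?exprn_gt0 // ltW.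
  rewrite -{2}(prednK l0) exprS invfM mulrA ler_peMl ?invr_ge0 ?exprn_ge0 //.
  by rewrite mulrAC divff // mul1r -[X in X <= _]invr1 lef_pV2 ?posrE.
apply: (@le_trans _ _ (\sum_(a <- s) \sum_(l < L.+1) E * (2 ^- l) ^+ q.+1 * t l a)).
  by rewrite /zeros_sum big_seq [X in _ <= X]big_seq; apply: ler_sum.
rewrite exchange_big /=.
apply: (@le_trans _ _ (\sum_(l < L.+1) E * K * (2^-1) ^+ l)).
  apply: ler_sum => l _; rewrite -mulr_sumr.
  have : \sum_(a <- s) t l a <= K * (2 ^+ l) ^+ q.
    rewrite /t -big_mkcond /= -big_filter -natr_sum; apply: hK.
    - exact: filter_uniq.
    - by rewrite exprn_ege1 // ler1n.
    - by move=> a; rewrite mem_filter => /andP[].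
  have e0 : 0 <= E * (2 ^- l) ^+ q.+1 by rewrite mulr_ge0 // exprn_ge0 // invr_ge0 exprn_ge0.
  move=> /(ler_wpM2l e0)/le_trans; apply.
  rewrite le_eqVlt; apply/orP; left; apply/eqP.
  have <- : (2 ^- l) ^+ q.+1 * (2 ^+ l) ^+ q = (2^-1) ^+ l :> R.
    by rewrite exprS -mulrA -exprMn mulVf ?expf_neq0 // expr1n mulr1 exprVn.
  by ring.
rewrite -mulr_sumr ler_wpM2l ?mulr_ge0 //.
apply: le_trans (geometric_le _ _) _; first by apply/andP; split; lra.
by rewrite -[X in _ <= X]invrK lef_pV2 ?posrE; lra.
Qed.

End ConvergenceExponent.

(** * Unordered sums and products *)

Section UnorderedProducts.
Context {R : realType}.
Local Notation C := R[i].
Local Notation Co := (R[i]^o).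
Implicit Types (F t : C -> C) (M : C -> nat).

#[global] Instance totally_proper (I : choiceType) : ProperFilter (@totally I).
Proof. exact: totally_filter. Qed.

Lemma near_totally (I : choiceType) (A0 : {fset I}) (P : {fset I} -> Prop) :
  (forall A, fsubset A0 A -> P A) -> \forall A \near totally, P A.
Proof. by move=> h; exists A0. Qed.

Lemma fset_big_split (T I : choiceType) (idx : T) (op : Monoid.com_law idx)
    (A0 A : {fset I}) (F : I -> T) : fsubset A0 A ->
  \big[op/idx]_(a <- A) F a =
    op (\big[op/idx]_(a <- A0) F a) (\big[op/idx]_(a <- (A `\` A0)%fset) F a).
Proof.
move=> sub; rewrite -big_cat; apply: perm_big; apply: uniq_perm.
- exact: fset_uniq.
- rewrite cat_uniq !fset_uniq andbT /=; apply/hasPn => a.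
  by rewrite in_fsetD => /andP[].
- move=> a; rewrite mem_cat in_fsetD.
  by case: (boolP (a \in A0)) => //= /(fsubsetP sub).
Qed.

Definition summable_norms (t : C -> R) : Prop :=
  exists B, forall s, uniq s -> \sum_(a <- s) t a <= B.

(** Some finite set comes within [e] of the supremum of the finite sums. *)
Lemma summable_tail (t : C -> R) : (forall a, 0 <= t a) -> summable_norms t ->
  forall e, 0 < e -> exists A0 : {fset C}, forall A, fsubset A0 A ->
    \sum_(a <- (A `\` A0)%fset) t a < e.
Proof.
move=> t0 [B hB] e e0.
pose S := [set x | exists A : {fset C}, x = \sum_(a <- A) t a].
have hS : has_sup S.
  split; first by exists (\sum_(a <- (fset0 : {fset C})) t a), fset0.
  by exists B => _ [A ->]; apply: hB; apply: fset_uniq.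
have [_ [A0 ->] h0] := sup_adherent e0 hS.
exists A0 => A sub.
have : \sum_(a <- A) t a <= sup S by apply: ub_le_sup; [exact: hS.2 | exists A].
by rewrite (fset_big_split _ _ sub) /=; lra.
Qed.

Lemma unordered_sum_cvg t : summable_norms (fun a => cabs (t a)) ->
  exists l : C, ((\sum_(a <- A) t a : C) : Co) @[A --> totally] --> (l : Co).
Proof.
move=> ht; apply: (@cauchyc_cvg R {fset C} totally _ (fun A => \sum_(a <- A) t a)) => e e0.
have [A0 hA0] := summable_tail (fun a => cabs_ge0 (t a)) ht e0.
exists A0; apply: (@near_totally _ A0) => A sub.
rewrite (fset_big_split _ _ sub) /= [X in cabs X]addrAC subrr add0r.
exact: le_lt_trans (cabs_sum _ _ _) (hA0 A sub).
Qed.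

Lemma cabs_prod_le (s : seq C) F :
  cabs (\prod_(a <- s) F a) <= expR (\sum_(a <- s) cabs (F a - 1)).
Proof.
rewrite cabs_prod expR_sum; apply: ler_prod => a _; rewrite cabs_ge0 /=.
apply: le_trans (expR_ge1Dx _).
by have := cabs_sub_ge (F a) 1; rewrite cabs1; lra.
Qed.

Lemma cabs_prod_sub1_le (s : seq C) F :
  cabs (\prod_(a <- s) F a - 1) <= expR (\sum_(a <- s) cabs (F a - 1)) - 1.
Proof.
elim: s => [|a s IH]; first by rewrite !big_nil subrr cabs0 expR0 subrr.
rewrite !big_cons; set P := \prod_(b <- s) _ in IH *; set E := \sum_(b <- s) _ in IH *.
have -> : F a * P - 1 = F a * (P - 1) + (F a - 1) by ring.
apply: le_trans (cabsD _ _) _; rewrite cabsM expRD.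
set u := cabs (F a - 1).
have h1 : cabs (F a) <= 1 + u by have := cabs_sub_ge (F a) 1; rewrite cabs1 -/u; lra.
have h2 := expR_ge1Dx u; have h3 := cabs_ge0 (P - 1); have h4 : 0 <= u := cabs_ge0 _.
have h5 : cabs (F a) * cabs (P - 1) <= (1 + u) * (expR E - 1).
  by apply: ler_pM; rewrite ?cabs_ge0.
have h6 : (1 + u) * expR E <= expR u * expR E by rewrite ler_wpM2r ?expR_ge0.
move: h1 h5 h6; clear; lra.
Qed.

Lemma expR_sub1_le (x : R) : 0 <= x <= 1 -> expR x - 1 <= 4 * x.
Proof.
move=> /andP[x0 x1]; have := @cexp_sub1_le_small R x%:C.
rewrite cabs_real ger0_norm // => /(_ x1); apply: le_trans.
by rewrite cexp_real; apply: le_trans (Re_le_cabs _).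
Qed.

(** The partial products are bounded, and enlarging a large set multiplies the
    product by a factor close to 1. *)
Lemma unordered_prod_cvg F : summable_norms (fun a => cabs (F a - 1)) ->
  exists l : C, ((\prod_(a <- A) F a : C) : Co) @[A --> totally] --> (l : Co).
Proof.
move=> hF; have [B hB] := hF.
apply: (@cauchyc_cvg R {fset C} totally _ (fun A => \prod_(a <- A) F a)) => e e0.
have EB : 0 < expR B by apply: expR_gt0.
pose d := Num.min 1 (e / (4 * expR B)).
have d0 : 0 < d by rewrite lt_min ltr01 divr_gt0 // mulr_gt0.
have [A0 hA0] := summable_tail (fun a => cabs_ge0 (F a - 1)) hF d0.
exists A0; apply: (@near_totally _ A0) => A sub.
rewrite (fset_big_split _ _ sub) /=; have := hA0 A sub.
set P0 := \prod_(a <- A0) _; set P1 := \prod_(a <- _) _; set s := \sum_(a <- _) _ => sd.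
have -> : P0 * P1 - P0 = P0 * (P1 - 1) by ring.
rewrite cabsM.
have hP0 : cabs P0 <= expR B.
  by apply: le_trans (cabs_prod_le _ _) _; rewrite ler_expR; apply: hB; apply: fset_uniq.
have hP1 : cabs (P1 - 1) <= 4 * s.
  apply: le_trans (cabs_prod_sub1_le _ _) _; apply: expR_sub1_le.
  rewrite sumr_ge0 => [|a _]; last exact: cabs_ge0.
  by rewrite ltW // (lt_le_trans sd) // ge_min lexx.
have sd' : s < e / (4 * expR B) by apply: lt_le_trans sd _; rewrite ge_min lexx orbT.
apply: (@le_lt_trans _ _ (expR B * (4 * s))).
  by apply: ler_pM; rewrite ?cabs_ge0.
by rewrite mulrCA mulrA -ltr_pdivlMl // mulrC; rewrite ?mulr_gt0.
Qed.

(** Each of these zeros contributes at least [r ^- p.+1] to the sums, which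
    are bounded; so a list of them of maximal length exists, and contains them
    all. *)
Lemma summable_zeros_finite M p (r : R) : 0 < r -> summable_zeros M p ->
  exists2 s : seq C, uniq s &
    forall a, a \in s = [&& M a != 0%N, a != 0 & cabs a <= r].
Proof.
move=> r0 [B hB].
pose P a := [&& M a != 0%N, a != 0 & cabs a <= r].
have bnd s : uniq s -> all P s -> (size s <= (Num.trunc (B * r ^+ p.+1)).+1)%N.
  move=> us /allP ps; have := hB s us.
  have : (size s)%:R / r ^+ p.+1 <= zeros_sum M p s.
    rewrite /zeros_sum -sum1_size natr_sum mulr_suml big_seq [X in _ <= X]big_seq.
    apply: ler_sum => a /ps /and3P[Ma a0 ar]; apply: ler_pM => //.
    - by rewrite invr_ge0 exprn_ge0 // ltW.
    - by rewrite ler1n lt0n.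
    - rewrite lef_pV2 ?posrE ?exprn_gt0 ?cabs_gt0 //.
      by rewrite lerXn2r ?nnegrE ?cabs_ge0 ?(ltW r0).
  move=> /le_trans h /h; rewrite ler_pdivrMr ?exprn_gt0 // => {}h.
  have B0 : 0 <= B * r ^+ p.+1 by apply: le_trans h.
  have /andP[_ h2] := Num.Theory.trunc_itv B0.
  by rewrite -(ler_nat R); apply: le_trans h _; apply: ltW.
pose Q n := `[< exists s, [/\ uniq s, all P s & size s = n] >].
have exQ : exists n, Q n by exists 0%N; apply/asboolP; exists [::].
have bQ n : Q n -> (n <= (Num.trunc (B * r ^+ p.+1)).+1)%N.
  by move=> /asboolP[s [us ps <-]]; apply: bnd.
case: (ex_maxnP exQ bQ) => n /asboolP[s [us ps sn]] nmax.
exists s => // a; apply/idP/idP => [/(allP ps)//|Pa].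
apply: contraT => nas; have := nmax n.+1; rewrite ltnn; apply.
apply/asboolP; exists (a :: s); split; rewrite /= ?nas ?sn //.
by rewrite ps andbT; exact: Pa.
Qed.

Lemma summable_norms_cofinite (t : C -> R) (s0 : seq C) : uniq s0 ->
  (exists B, forall s, uniq s -> (forall a, a \in s -> a \notin s0) ->
     \sum_(a <- s) t a <= B) -> (forall a, 0 <= t a) -> summable_norms t.
Proof.
move=> us0 [B hB] t0; exists (\sum_(a <- s0) t a + B) => s us.
rewrite (bigID (mem s0)) /=; apply: lerD.
  rewrite -big_filter (perm_big [seq a <- s0 | a \in s]).
    by rewrite big_filter [X in _ <= X](bigID (mem s)) /= lerDl sumr_ge0.
  apply: uniq_perm; rewrite ?filter_uniq // => a.
  by rewrite !mem_filter andbC.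
rewrite -big_filter; apply: hB; first exact: filter_uniq.
by move=> a; rewrite mem_filter => /andP[].
Qed.

(** As [z / 0 = 0], the factor is 1 at [a = 0] and wherever [M] vanishes, so
    that products of these factors need no condition on the index. *)
Definition zero_factor M p (z a : C) : C := primary_factor p (z / a) ^+ M a.

Lemma zero_factor1 M p z a : (M a == 0%N) || (a == 0) -> zero_factor M p z a = 1.
Proof.
rewrite /zero_factor => /orP[/eqP ->|/eqP ->]; first by rewrite expr0.
by rewrite invr0 mulr0 primary_factor_z0 expr1n.
Qed.

Lemma cabs_expn_sub1_le (x : C) n : cabs (x ^+ n - 1) <= expR (n%:R * cabs (x - 1)) - 1.
Proof.
have := cabs_prod_sub1_le (nseq n 0) (fun=> x).
by rewrite !big_nseq !iter_mulr_1 iter_addr addr0 mulr_natl.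
Qed.

(** For [2 |z| < |a|] the factor differs from 1 by
    [O (M a * |z / a| ^+ p.+1)]. *)
Lemma zero_factor_summable M p z : summable_zeros M p ->
  summable_norms (fun a => cabs (zero_factor M p z a - 1)).
Proof.
move=> sM; have [B hB] := sM.
have z0 := cabs_ge0 z; have r0 : 0 < 2 * cabs z + 1 by lra.
have [s0 us0 hs0] := summable_zeros_finite r0 sM.
apply: (@summable_norms_cofinite _ s0) => // [|a]; last exact: cabs_ge0.
pose W := 4 * cabs z ^+ p.+1.
have W0 : 0 <= W by rewrite mulr_ge0 // exprn_ge0.
have one a : a \notin s0 -> cabs (zero_factor M p z a - 1) <=
    expR (W * B) * (W * ((M a)%:R / cabs a ^+ p.+1)).
  have [h _|] := boolP ((M a == 0%N) || (a == 0)).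
    rewrite zero_factor1 // subrr cabs0 mulr_ge0 ?expR_ge0 // mulr_ge0 //.
    by rewrite divr_ge0 // exprn_ge0 // cabs_ge0.
  rewrite negb_or => /andP[Ma a0]; rewrite hs0 Ma a0 /= -ltNge => ar.
  have a1 : 0 < cabs a by rewrite cabs_gt0.
  have za : cabs (z / a) <= 2^-1.
    by rewrite cabsM cabsV ler_pdivrMr //; lra.
  set x := primary_factor p (z / a).
  have hx : (M a)%:R * cabs (x - 1) <= W * ((M a)%:R / cabs a ^+ p.+1).
    rewrite [X in _ <= X]mulrCA ler_wpM2l //.
    apply: le_trans (primary_factor_le_half p za) _.
    by rewrite cabsM cabsV exprMn exprVn mulrA.
  have hW : W * ((M a)%:R / cabs a ^+ p.+1) <= W * B.
    by rewrite ler_wpM2l //; have := hB [:: a] isT; rewrite /zeros_sum big_seq1.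
  apply: le_trans (cabs_expn_sub1_le _ _) _.
  set v := _ * cabs (x - 1) in hx *.
  have v0 : 0 <= v by rewrite mulr_ge0 ?cabs_ge0.
  have := @cexp_sub1_le R v%:C; rewrite cabs_real ger0_norm // cexp_real => h.
  apply: (@le_trans _ _ (v * expR v)).
    by apply: le_trans h; apply: le_trans (Re_le_cabs _).
  rewrite mulrC; apply: ler_pM; rewrite ?expR_ge0 // ler_expR.
  exact: le_trans hx hW.
exists (expR (W * B) * (W * B)) => s us ns.
apply: (@le_trans _ _ (\sum_(a <- s) expR (W * B) * (W * ((M a)%:R / cabs a ^+ p.+1)))).
  by rewrite big_seq [X in _ <= X]big_seq; apply: ler_sum => a /ns; apply: one.
rewrite -!mulr_sumr ler_wpM2l ?expR_ge0 // ler_wpM2l //; exact: hB.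
Qed.

Lemma canonical_cvg M p z : summable_zeros M p ->
  exists l : C, ((\prod_(a <- A) zero_factor M p z a : C) : Co) @[A --> totally] --> (l : Co).
Proof. by move=> sM; apply/unordered_prod_cvg/zero_factor_summable. Qed.

Lemma power_sum_cvg M p j : summable_zeros M p -> (p < j)%N ->
  exists l : C, ((\sum_(a <- A) (M a)%:R * a^-1 ^+ j : C) : Co) @[A --> totally] --> (l : Co).
Proof.
move=> sM pj; apply: unordered_sum_cvg; have [B hB] := sM.
have [s0 us0 hs0] := summable_zeros_finite ltr01 sM.
apply: (@summable_norms_cofinite _ s0) => // [|a]; last exact: cabs_ge0.
exists B => s us ns; apply: le_trans (hB s us).
rewrite /zeros_sum big_seq [X in _ <= X]big_seq; apply: ler_sum => a /ns.
rewrite hs0 cabsM cabs_nat cabsX cabsV.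
have [->|Ma] := eqVneq (M a) 0%N; first by rewrite !mul0r.
have [->|a0] := eqVneq a 0.
  by rewrite cabs0 invr0 -(prednK (leq_ltn_trans (leq0n p) pj)) !exprS !mul0r invr0.
rewrite /= -ltNge => a1; rewrite ler_wpM2l // exprVn lef_pV2 ?posrE ?exprn_gt0 ?cabs_gt0 //.
by rewrite ler_eXn2l.
Qed.

End UnorderedProducts.

(** * Power sums and coefficients of a polynomial *)

Section PowerSums.
Context {R : realType}.
Local Notation C := R[i].
Local Notation Co := (R[i]^o).
Implicit Types (bs : seq C) (c : nat -> C).

(** A polynomial with constant term 1, written by the inverses of its roots. *)
Definition rev_poly bs : {poly C} := \prod_(b <- bs) (1 - b *: 'X).

Definition power_sum bs (j : nat) : C := \sum_(b <- bs) b ^+ j.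

Lemma rev_poly_horner bs z : (rev_poly bs).[z] = \prod_(b <- bs) (1 - b * z).
Proof.
rewrite /rev_poly horner_prod; apply: eq_bigr => b _.
by rewrite !hornerE.
Qed.

Lemma coef_rev_polyS b (P : {poly C}) k :
  ((1 - b *: 'X) * P)`_k.+1 = P`_k.+1 - b * P`_k.
Proof. by rewrite mulrBl mul1r coefB -scalerAl coefZ coefXM. Qed.

Lemma coef_rev_poly0 bs : (rev_poly bs)`_0 = 1.
Proof.
rewrite -horner_coef0 rev_poly_horner big1 // => b _.
by rewrite mulr0 subr0.
Qed.

(** Newton's identities, by induction on the list: a new factor [1 - b X]
    changes both sides by terms in the powers of [b] that telescope. *)
Lemma newton bs k : k.+1%:R * (rev_poly bs)`_k.+1 =
  - \sum_(i < k.+1) (rev_poly bs)`_(k - i) * power_sum bs i.+1.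
Proof.
elim: bs k => [|b bs IH] k.
  rewrite /rev_poly big_nil coef1 mulr0 big1 ?oppr0 // => i _.
  by rewrite /power_sum big_nil mulr0.
have E : rev_poly (b :: bs) = (1 - b *: 'X) * rev_poly bs by rewrite /rev_poly big_cons.
set P := rev_poly bs in IH E *.
have P0 : P`_0 = 1 by apply: coef_rev_poly0.
have E0 : (rev_poly (b :: bs))`_0 = 1 by apply: coef_rev_poly0.
have pS i : power_sum (b :: bs) i = b ^+ i + power_sum bs i.
  by rewrite /power_sum big_cons.
pose Q k := (rev_poly (b :: bs))`_k.
have QS i : Q i.+1 = P`_i.+1 - b * P`_i by rewrite /Q E coef_rev_polyS.
rewrite -/(Q k.+1) QS.
have tele n : \sum_(i < n.+1) Q (n - i)%N * b ^+ i.+1 = b * P`_n.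
  elim: n => [|n IHn]; first by rewrite big_ord1 subnn /Q E0 P0 mul1r mulr1 expr1.
  rewrite big_ord_recl subn0 QS expr1.
  rewrite (eq_bigr (fun i : 'I_n.+1 => b * (Q (n - i)%N * b ^+ i.+1))); last first.
    by move=> i _; rewrite /= ?/bump /= ?add1n subSS (exprS b i.+1); ring.
  by rewrite -mulr_sumr IHn; ring.
rewrite (eq_bigr (fun i : 'I_k.+1 => Q (k - i)%N * b ^+ i.+1 +
    Q (k - i)%N * power_sum bs i.+1)); last by move=> i _; rewrite pS mulrDr.
rewrite big_split /= tele.
have -> : \sum_(i < k.+1) Q (k - i)%N * power_sum bs i.+1 =
    \sum_(i < k.+1) P`_(k - i) * power_sum bs i.+1
    - b * \sum_(i < k) P`_(k.-1 - i) * power_sum bs i.+1.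
  rewrite mulr_sumr !big_ord_recr /= subnn (_ : Q 0%N = 1) // P0 addrAC; congr (_ + _).
  rewrite -sumrB; apply: eq_bigr => i _.
  have -> : (k - i = (k.-1 - i).+1)%N.
    by move: (ltn_ord i) => ?; lia.
  by rewrite QS; ring.
rewrite mulrBr IH.
case: k => [|k] /=; first by rewrite !big_ord1 big_ord0 P0; ring.
have -> : \sum_(i < k.+1) P`_(k - i) * power_sum bs i.+1 = - (k.+1%:R * P`_k.+1).
  by rewrite IH opprK.
move: (\sum_(i < k.+2) P`_(k.+1 - i) * power_sum bs i.+1) => X.
rewrite (mulrSr 1 k.+1); ring.
Qed.

(** In Newton's identities the last power sum has coefficient 1. *)
Lemma power_sum_coef bs bs' N :
  (forall k, (k <= N)%N -> (rev_poly bs)`_k = (rev_poly bs')`_k) ->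
  forall j, (0 < j <= N)%N -> power_sum bs j = power_sum bs' j.
Proof.
move=> e; elim/ltn_ind => -[//|j] IH /= jN.
have eS : \sum_(i < j) (rev_poly bs)`_(j - i) * power_sum bs i.+1 =
    \sum_(i < j) (rev_poly bs')`_(j - i) * power_sum bs' i.+1.
  apply: eq_bigr => i _; rewrite e; last by rewrite (leq_trans (leq_subr _ _)) // ltnW.
  by rewrite IH //= ?ltnS ?(ltn_ord i) // (leq_trans _ jN) // ltnS ltnW.
have := newton bs j; rewrite (e _ jN) newton !big_ord_recr /= eS subnn !coef_rev_poly0.
by rewrite !mul1r => /oppr_inj/addrI.
Qed.

Lemma rev_poly_exists (P : {poly C}) : P`_0 = 1 -> exists bs, P = rev_poly bs /\
  forall b, b \in bs -> b != 0 /\ root P b^-1.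
Proof.
move=> P0; have [r Pr] := closed_field_poly_normal P.
set lc := lead_coef P in Pr.
have e1 : lc * \prod_(z <- r) - z = 1.
  have := horner_coef0 P; rewrite P0 {1}Pr hornerZ horner_prod => e.
  rewrite -[RHS]e; congr (_ * _).
  by apply: eq_bigr => z _; rewrite !hornerE.
have rn z : z \in r -> z != 0.
  have : \prod_(z <- r) - z != 0.
    by apply/eqP => p0; move/eqP: e1; rewrite p0 mulr0 eq_sym oner_eq0.
  by rewrite prodf_seq_neq0 => /allP h /h; rewrite /= oppr_eq0.
exists [seq z^-1 | z <- r]; split; last first.
  move=> _ /mapP[z zr ->]; rewrite invr_eq0 invrK rn //; split=> //.
  by rewrite Pr rootE hornerZ mulf_eq0 -[X in _ || X]rootE root_prod_XsubC zr orbT.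
have E : \prod_(z <- r) ('X - z%:P) =
    \prod_(z <- r) - z *: \prod_(z <- r) (1 - z^-1 *: 'X).
  rewrite -scaler_prod big_seq [RHS]big_seq; apply: eq_bigr => z /rn z0.
  by rewrite scalerBr scalerA mulNr divff // !scaleNr scale1r opprK addrC alg_polyC.
by rewrite {1}Pr E scalerA e1 scale1r /rev_poly big_map.
Qed.

End PowerSums.

(** * The Borel-Caratheodory inequality *)

Section BorelCaratheodory.
Context {R : realType}.
Local Notation C := R[i].
Local Notation Co := (R[i]^o).

(** Take the mean of the nonnegative function [2 (A - Re L)] against [w ^- k]:
    the constant and the conjugate of [L] contribute nothing, so the result is
    [- c], and its modulus is at most the mean of [2 (A - Re L) / r ^+ k]. *)
Lemma borel_caratheodory (L : C -> C) (r A : R) k (c : C) : 0 < r -> (0 < k)%N ->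
  has_mean L r 0 -> has_mean (fun w => L w / w ^+ k) r c ->
  has_mean (fun w => L w * w ^+ k) r 0 ->
  (forall w, cabs w = r -> complex.Re (L w) <= A) -> cabs c * r ^+ k <= 2 * A.
Proof.
move=> r0 k0 L0 Lc Lk LA.
have rk : 0 < r ^+ k by rewrite exprn_gt0.
have cnz w : cabs w = r -> w != 0 by move=> wr; rewrite -cabs_gt0 wr.
pose g w := ((A - complex.Re (L w))%:C * 2) / w ^+ k.
have sumJ (u : C) : u + u^* = 2 * (complex.Re u)%:C.
  by apply: eq_ReIm; rewrite ?ReD ?ImD ?Re_conj ?Im_conj ?ReM ?ImM /=; ring.
(* on the circle [w^-1] is [w^* / r ^+ 2], so the mean of [L^* / w ^+ k] is,
   up to a factor, conjugate to that of [L * w ^+ k] *)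
have mg : has_mean g r (- c).
  have h1 := has_meanZ (2 * A%:C) (has_mean_XnV r0 k0).
  have h2 := has_meanZ (-1) Lc.
  have h3 := has_meanZ (- (r ^+ 2)^-1%:C ^+ k) (has_mean_conj Lk).
  have := has_meanD (has_meanD h1 h2) h3.
  rewrite conjcZ0 !mulr0 add0r addr0 mulN1r; apply: has_mean_ext; first exact: ltW.
  move=> w wr; have wk : w ^+ k != 0 by rewrite expf_neq0 // cnz.
  have e : (w ^+ k)^-1 = (r ^+ 2)^-1%:C ^+ k * w^* ^+ k.
    rewrite -exprVn cmul_conj_circle ?wr ?gt_eqF // exprMn mulrC; congr (_ ^+ _ * _).
    by rewrite fmorphV.
  rewrite conjcM conjcX /g; set u := L w.
  have -> : (A - complex.Re u)%:C * 2 = 2 * A%:C - (u + u^*).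
    by rewrite sumJ rmorphB /=; ring.
  have -> : - (r ^+ 2)^-1%:C ^+ k * (u^* * w^* ^+ k) = - u^* * (w ^+ k)^-1.
    by rewrite e; ring.
  by ring.
pose b w := (A - complex.Re (L w)) * 2 / r ^+ k.
have mb : has_mean (fun w => (b w)%:C) r (A * 2 / r ^+ k)%:C.
  have h1 := has_meanD (has_mean_cst (2 * A)%:C r) (has_meanZ (-1) (has_meanD L0 (has_mean_conj L0))).
  have := has_meanZ (r ^+ k)^-1%:C h1.
  rewrite conjcZ0 !addr0 mulr0 addr0 realcM (_ : (r ^+ k)^-1 * (2 * A) = A * 2 / r ^+ k); last by ring.
  apply: has_mean_ext; first exact: ltW.
  move=> w _; rewrite sumJ /b.
  rewrite (_ : -1 * (2 * _) = (- (2 * complex.Re (L w)))%:C); last first.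
    by rewrite rmorphN rmorphM /= mulN1r rmorph_nat.
  by rewrite realcD realcM; congr (_%:C); ring.
have := has_mean_le (ltW r0) _ mg mb; rewrite cabsN /= => H.
rewrite -ler_pdivlMr // (mulrC 2); apply: H => w wr.
rewrite /g /b cabsM cabsV cabsX wr ler_wpM2r ?invr_ge0 ?(ltW rk) //.
rewrite (cabsM (_%:C)) cabs_real cabs_nat ger0_norm // subr_ge0; exact: LA.
Qed.

End BorelCaratheodory.

(** * Logarithms of zero-free polynomials *)

Section Logarithm.
Context {R : realType}.
Local Notation C := R[i].
Local Notation Co := (R[i]^o).
Implicit Types (bs : seq C) (c d : nat -> C).

(** Without constant term: these are the logarithms of functions with value 1
    at the origin. *)
Definition truncated_series d K (z : C) : C := \sum_(1 <= j < K.+1) d j * z ^+ j.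

Lemma truncated_series_mean d K i k (r : R) : 0 < r ->
  has_mean (fun w => truncated_series d K w * w ^+ i / w ^+ k) r
    (\sum_(1 <= j < K.+1) d j * ((j + i)%N == k)%:R).
Proof.
move=> r0.
have := @has_mean_sum R nat (index_iota 1 K.+1) (fun j w => d j * (w ^+ (j + i) / w ^+ k)) r
  (fun j => d j * ((j + i)%N == k)%:R) (ltW r0)
  (fun j => has_meanZ (d j) (has_mean_monomial (j + i) k r0)).
apply: has_mean_ext; first exact: ltW.
move=> w _; rewrite /truncated_series !mulr_suml; apply: eq_bigr => j _.
by rewrite exprD !mulrA.
Qed.

(** The coefficients of the logarithm of the product of the [1 - b z]. *)
Definition log_coef bs (j : nat) : C := - (power_sum bs j / j%:R).

Lemma truncated_logE bs K z :
  truncated_series (log_coef bs) K z = - \sum_(b <- bs) log_poly K (b * z).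
Proof.
rewrite /log_poly exchange_big /= -sumrN; apply: eq_bigr => j _.
rewrite /log_coef /power_sum mulNr mulrAC !mulr_suml; congr (- _).
by apply: eq_bigr => b _; rewrite exprMn.
Qed.

Lemma prod_log bs K z : \prod_(b <- bs) (1 - b * z) =
  \prod_(b <- bs) primary_factor K (b * z) * cexp (truncated_series (log_coef bs) K z).
Proof.
rewrite truncated_logE -sumrN cexp_sum -big_split /=; apply: eq_bigr => b _.
by rewrite primary_factorE -mulrA -cexpD subrr cexp0 mulr1.
Qed.

Lemma cvgc_prod (I : Type) (T : Type) (F : set_system T) {FF : Filter F} (s : seq I)
    (u : I -> T -> C) (l : I -> C) :
  (forall i, (u i x : Co) @[x --> F] --> (l i : Co)) ->
  ((\prod_(i <- s) u i x : C) : Co) @[x --> F] --> ((\prod_(i <- s) l i : C) : Co).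
Proof.
move=> hu; elim: s => [|i s IH].
  rewrite big_nil; apply: (@cvgc_ext _ _ F FF (fun=> 1)); last exact: cvgc_cst.
  by move=> x; rewrite big_nil.
rewrite big_cons; apply: (@cvgc_ext _ _ F FF) (cvgcM (hu i) IH) => x.
by rewrite big_cons.
Qed.

Lemma expR_mul_onem_ge1 (x : R) : 0 <= x <= 2^-1 -> 1 <= (1 - x) * expR (2 * x).
Proof.
move=> /andP[x0 x1]; have := expR_ge1Dx (2 * x) => h.
apply: (@le_trans _ _ ((1 - x) * (1 + 2 * x))); last by rewrite ler_wpM2l //; lra.
nra.
Qed.

(** On the circle the truncations of the logarithm of [T], the product of the
    [1 - b w], have real parts that exceed [log |T|] by arbitrarily little, as
    the primary factors of high degree are close to 1; the Borel-Caratheodory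
    inequality applies to them. *)
Lemma power_sum_le bs (rho A : R) j : 0 < rho ->
  (forall b, b \in bs -> cabs b * rho < 1) ->
  (forall w, cabs w = rho -> cabs (\prod_(b <- bs) (1 - b * w)) <= expR A) ->
  (0 < j)%N -> cabs (log_coef bs j) * rho ^+ j <= 2 * A.
Proof.
move=> rho0 hb hT j0.
(* the bound of [primary_factor_le] for [primary_factor K (b * w) - 1] *)
pose x K b := if b \in bs then (cabs b * rho) ^+ K.+1 * expR (cabs b * rho / (1 - cabs b * rho)) else 0 : R.
have x0 K b : 0 <= x K b.
  by rewrite /x; case: ifP => // _; rewrite mulr_ge0 ?expR_ge0 // exprn_ge0 // mulr_ge0 ?cabs_ge0 ?(ltW rho0).
have xlim b : x K b @[K --> \oo] --> (0 : R).
  have [bb|/negbTE bb] := boolP (b \in bs); rewrite /x bb; last exact: cvg_cst.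
  rewrite -(mul0r (expR (cabs b * rho / (1 - cabs b * rho)))); apply: cvgMr_tmp.
  have := @cvg_geometric0 R (cabs b * rho); rewrite mulr_ge0 ?cabs_ge0 ?(ltW rho0) //= => /(_ (hb b bb)).
  by rewrite -(cvg_shiftS (fun K => (cabs b * rho) ^+ K)).
have slim : \sum_(b <- bs) x K b @[K --> \oo] --> (0 : R).
  have : \sum_(b <- bs) x K b @[K --> \oo] --> \sum_(b <- bs) (0 : R).
    elim: (bs : seq C) => [|b s IH].
      by under eq_fun do rewrite big_nil; rewrite big_nil; apply: cvg_cst.
    by under eq_fun do rewrite big_cons; rewrite big_cons; apply: cvgD.
  by rewrite big1.
have bound K w : \sum_(b <- bs) x K b <= 2^-1 -> cabs w = rho ->
    complex.Re (truncated_series (log_coef bs) K w) <= A + 2 * \sum_(b <- bs) x K b.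
  move=> sx wr; rewrite -ler_expR -cabs_cexp expRD.
  have := hT w wr; rewrite (prod_log _ K) cabsM cabs_prod => H.
  set Lam := cexp _ in H *.
  have : 1 <= \prod_(b <- bs) cabs (primary_factor K (b * w)) * expR (2 * \sum_(b <- bs) x K b).
    rewrite mulr_sumr expR_sum -big_split /=.
    apply: (@le_trans _ _ (\prod_(b <- bs) (1 : R))); first by rewrite big1.
    rewrite big_seq [X in _ <= X]big_seq; apply: ler_prod => b bb; rewrite ler01 /=.
    have bw : cabs (b * w) = cabs b * rho by rewrite cabsM wr.
    have xb : cabs (primary_factor K (b * w) - 1) <= x K b.
      by have := @primary_factor_le R K (b * w); rewrite bw /x bb; apply; exact: hb.
    have xb2 : x K b <= 2^-1.
      apply: le_trans sx; rewrite (big_rem b) //= lerDl; apply: sumr_ge0 => ? _; exact: x0.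
    apply: le_trans (expR_mul_onem_ge1 (_ : 0 <= x K b <= 2^-1)) _; first by rewrite x0.
    rewrite ler_wpM2r ?expR_ge0 //.
    have := cabs_sub_ge 1 (primary_factor K (b * w)); rewrite cabs1 cabsC.
    move: xb; clear; lra.
  move=> h1; apply: (@le_trans _ _ (cabs Lam * (\prod_(b <- bs) cabs (primary_factor K (b * w)) *
    expR (2 * \sum_(b <- bs) x K b)))); first by rewrite ler_peMr ?cabs_ge0.
  by rewrite mulrA ler_wpM2r ?expR_ge0 // mulrC.
apply/ler_addgt0Pr => e e0.
have [K jK [K1 K2]] : exists2 K, (j <= K)%N & \sum_(b <- bs) x K b <= 2^-1 /\
    \sum_(b <- bs) x K b <= e / 4.
  have d0 : 0 < Num.min (2^-1) (e / 4) by rewrite lt_min invr_gt0 ltr0n divr_gt0.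
  have /cvgrPdistC_lt/(_ _ d0)[N _ hN] := slim.
  exists (maxn j N); first exact: leq_maxl.
  have := hN (maxn j N) (leq_maxr _ _); rewrite /= subr0 => /ltr_normlW.
  by rewrite lt_min => /andP[/ltW -> /ltW ->].
have H := @borel_caratheodory R (truncated_series (log_coef bs) K) rho
  (A + 2 * \sum_(b <- bs) x K b) j (log_coef bs j) rho0 j0 _ _ _ (fun w => @bound K w K1).
have {}H : cabs (log_coef bs j) * rho ^+ j <= 2 * (A + 2 * \sum_(b <- bs) x K b).
  apply: H.
  - have := truncated_series_mean (log_coef bs) K 0 0 rho0.
    rewrite big_nat big1 => [|i /andP[i0 _]]; last first.
      by rewrite addn0 eqn0Ngt i0 mulr0.
    by apply: has_mean_ext => [|w _]; [exact: ltW | rewrite !expr0 mulr1 divr1].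
  - have := truncated_series_mean (log_coef bs) K 0 j rho0.
    rewrite (big_nat_widenl 1 0) // big_mkord (bigD1 (Ordinal (jK : j < K.+1)%N)) //=.
    rewrite addn0 eqxx mulr1 big1 ?addr0 => [|i /andP[_ ij]].
      by apply: has_mean_ext => [|w _]; [exact: ltW | rewrite expr0 mulr1].
    by rewrite addn0 (_ : (i == j :> nat) = false) ?mulr0 //; apply/negbTE.
  - have := truncated_series_mean (log_coef bs) K j 0 rho0.
    rewrite big_nat big1 => [|i /andP[i0 _]]; last first.
      by rewrite eqn0Ngt addn_gt0 i0 mulr0.
    by apply: has_mean_ext => [|w _]; [exact: ltW | rewrite expr0 divr1].
move: H K2; clear; lra.
Qed.

(** Up to primary factors of degree [N], which tend to 1, the left-hand
    product is the exponential of the terms of degrees [K + 1] to [N] of the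
    logarithm, and [power_sum_le] bounds these. *)
Lemma poly_log bs (rho A : R) K z : 0 < rho ->
  (forall b, b \in bs -> cabs b * rho < 1) ->
  (forall w, cabs w = rho -> cabs (\prod_(b <- bs) (1 - b * w)) <= expR A) ->
  cabs z <= rho / 2 -> 4 * A * (cabs z / rho) ^+ K.+1 <= 1 ->
  cabs (\prod_(b <- bs) (1 - b * z) * cexp (- truncated_series (log_coef bs) K z) - 1)
    <= 16 * A * (cabs z / rho) ^+ K.+1.
Proof.
move=> rho0 hb hT zr small.
pose q := cabs z / rho.
have q0 : 0 <= q by rewrite divr_ge0 ?cabs_ge0 // ltW.
have q1 : q <= 2^-1 by rewrite ler_pdivrMr // mulrC.
have A0 : 0 <= 2 * A.
  have := @power_sum_le bs rho A 1 rho0 hb hT isT; apply: le_trans.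
  by rewrite mulr_ge0 ?cabs_ge0 // exprn_ge0 // ltW.
set Lam := truncated_series (log_coef bs); set V := _ * _.
have bz b : b \in bs -> cabs (b * z) < 1.
  move=> bb; rewrite cabsM; apply: le_lt_trans (hb b bb).
  by rewrite ler_wpM2l ?cabs_ge0 //; move: zr rho0; clear; lra.
pose P N := \prod_(b <- bs) primary_factor N (b * z).
have PN0 N : P N != 0.
  rewrite /P prodf_seq_neq0; apply/allP => b bb /=; rewrite primary_factor_eq0.
  by apply/eqP => e; have := bz b bb; rewrite e cabs1 ltxx.
have P1 : (P N : Co) @[N --> \oo] --> (1 : Co).
  rewrite [X in _ --> X](_ : _ = \prod_(b <- bs) 1); last by rewrite big1.
  pose u b N : C := if b \in bs then primary_factor N (b * z) else 1.
  apply: (@cvgc_ext R nat \oo _ (fun N => \prod_(b <- bs) u b N)) => [N|].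
    by rewrite /P big_seq [RHS]big_seq; apply: eq_bigr => b bb; rewrite /u bb.
  apply: (@cvgc_prod C nat \oo _ bs u (fun=> 1)) => b.
  have [bb|/negbTE bb] := boolP (b \in bs); rewrite /u bb; last exact: cvgc_cst.
  exact: cvg_primary_factor (bz b bb).
have uN N : cexp (Lam N z - Lam K z) = V * (P N)^-1.
  by rewrite /V (prod_log bs N z) cexpD -/(P N); field.
have PV := @cvgcV R nat \oo eventually_filter _ _ (oner_neq0 _) P1.
have uV := @cvgcM R nat \oo eventually_filter _ _ _ _
  (@cvgc_cst R nat \oo eventually_filter V) PV.
rewrite invr1 mulr1 in uV.
apply: (@cvgc_cabs_le R nat \oo _ _ V 1 _ uV).
exists K => // N /= KN; rewrite -uN.
have diff : Lam N z - Lam K z = \sum_(K.+1 <= j < N.+1) log_coef bs j * z ^+ j.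
  rewrite /Lam /truncated_series (big_cat_nat _ (_ : (K.+1 <= N.+1)%N)) //=.
  by rewrite [LHS]addrAC subrr add0r.
have le : cabs (Lam N z - Lam K z) <= 4 * A * q ^+ K.+1.
  rewrite diff; apply: le_trans (cabs_sum _ _ _) _.
  have -> : 4 * A = 2 * (2 * A) by ring.
  apply: le_trans (geometric_tail K.+1 N.+1 A0 (_ : 0 <= q <= 2^-1)); last by rewrite q0.
  rewrite big_nat [X in _ <= X]big_nat; apply: ler_sum => j /andP[Kj _].
  rewrite cabsM cabsX /q expr_div_n mulrA ler_pdivlMr ?exprn_gt0 // mulrAC.
  rewrite ler_wpM2r ?exprn_ge0 ?cabs_ge0 //.
  by apply: power_sum_le => //; apply: leq_ltn_trans Kj.
apply: le_trans (cexp_sub1_le_small (le_trans le small)) _.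
by move: le; rewrite /q; clear; lra.
Qed.

End Logarithm.

(** * Logarithms of zero-free entire functions *)

Section EntireLogarithm.
Context {R : realType}.
Local Notation C := R[i].
Local Notation Co := (R[i]^o).
Implicit Types (bs : seq C) (c d : nat -> C) (f h : C -> C).

Definition taylor_poly c N : {poly C} := \poly_(k < N.+1) c k.

(** The Taylor coefficient of order [j] of [log f], for a function with Taylor
    coefficients [c] and [c 0 = 1]. It is computed on the Taylor polynomial of
    degree [j]; by Newton's identities ([formal_logE]) any Taylor polynomial
    of larger degree gives the same value. *)
Definition formal_log c (j : nat) : C :=
  log_coef (xget [::] [set bs | taylor_poly c j = rev_poly bs]) j.

Lemma formal_logE c bs N j : c 0%N = 1 ->
  (forall k, (k <= N)%N -> (rev_poly bs)`_k = c k) -> (0 < j <= N)%N ->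
  log_coef bs j = formal_log c j.
Proof.
move=> c0 e jN; have jN' : (j <= N)%N by case/andP: jN.
have [bs' [T' _]] : exists bs', taylor_poly c j = rev_poly bs' /\
    forall b, b \in bs' -> b != 0 /\ root (taylor_poly c j) b^-1.
  by apply: rev_poly_exists; rewrite coef_poly.
have ex : [set bs | taylor_poly c j = rev_poly bs] (xget [::] [set bs | taylor_poly c j = rev_poly bs]).
  by apply: xgetPex; exists bs'.
rewrite /formal_log /log_coef; congr (- (_ / _)).
apply: (@power_sum_coef R _ _ j); last by case/andP: jN => -> _ /=.
by move=> k kj; rewrite -ex coef_poly ltnS kj e // (leq_trans kj).
Qed.

Lemma disc_min h (rho : R) : 0 < rho -> (forall z, ccts h z) ->
  (forall z, cabs z <= rho -> h z != 0) ->
  exists2 d : R, 0 < d & forall z, cabs z <= rho -> d <= cabs (h z).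
Proof.
move=> rho0 hc h0.
have [|B hB] := @disc_bounded R (fun w => (cabs (h w))^-1) rho rho0.
  move=> z; have [zr|rz] := leP (cabs z) rho.
    have hz : 0 < cabs (h z) by rewrite cabs_gt0 h0.
    have hz2 : 0 < cabs (h z) / 2 by rewrite divr_gt0.
    have /cctsP/(_ _ hz2)[D D0 hD] := hc z; exists D => //.
    exists (cabs (h z) / 2)^-1 => w /hD wz wr.
    rewrite lef_pV2 ?posrE ?cabs_gt0 ?h0 //.
    have := cabs_sub_ge (h z) (h w); rewrite cabsC; move: wz; clear; lra.
  exists (cabs z - rho); first by rewrite subr_gt0.
  exists 0 => w wz wr; have := cabs_sub_ge z w; rewrite cabsC.
  move: wz wr; clear; lra.
have B0 : 0 < `|B| + 1 by rewrite ltr_wpDl.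
exists (`|B| + 1)^-1; first by rewrite invr_gt0.
move=> z zr; have hz : 0 < cabs (h z) by rewrite cabs_gt0 h0.
rewrite -[X in _ <= X]invrK lef_pV2 ?posrE ?invr_gt0 //.
by apply: le_trans (hB z zr) _; have := ler_norm B; clear; lra.
Qed.

Lemma truncated_series_eq c d K z : (forall j, (0 < j <= K)%N -> c j = d j) ->
  truncated_series c K z = truncated_series d K z.
Proof.
move=> e; rewrite /truncated_series big_nat [RHS]big_nat.
by apply: eq_bigr => j /andP[j0 jK]; rewrite e // j0.
Qed.

(** Transferred from the Taylor polynomials, which for large degrees inherit
    both the bound on the circle and the absence of zeros in the disc. *)
Lemma entire_log h c (rho A : R) K z : entire h -> taylor h c -> h 0 = 1 ->
  0 < rho -> 0 <= A -> (forall w, cabs w <= rho -> h w != 0) ->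
  (forall w, cabs w = rho -> cabs (h w) <= expR A) ->
  cabs z <= rho / 2 -> 4 * (A + 1) * (cabs z / rho) ^+ K.+1 <= 1 ->
  cabs (h z * cexp (- truncated_series (formal_log c) K z) - 1)
    <= 16 * (A + 1) * (cabs z / rho) ^+ K.+1.
Proof.
move=> he th h01 rho0 A0 hn0 hA zr small.
have hc w : ccts h w by apply: entire_ccts.
have [d d0 hd] := disc_min rho0 hc hn0.
have [|B B0 hB] := @cts_disc_bounded R h (2 * rho) _ hc; first by rewrite mulr_gt0.
have c0 : c 0%N = 1 by rewrite (taylor_coef0 th).
pose T N := (taylor_poly c N).[z].
have TE N w : (taylor_poly c N).[w] = \sum_(k < N.+1) c k * w ^+ k.
  by rewrite horner_poly.
have close N w : cabs w <= rho ->
    cabs (h w - (taylor_poly c N).[w]) <= 2 * B * (2^-1) ^+ N.+1.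
  move=> wr; rewrite TE; apply: le_trans (@taylor_tail R h c (2 * rho) B w N.+1 th _ _ _) _.
  - by rewrite mulr_gt0.
  - by move=> v v2; apply: hB; rewrite v2.
  - by apply: le_trans wr _; move: rho0; clear; lra.
  rewrite ler_wpM2l ?mulr_ge0 // lerXn2r ?nnegrE ?divr_ge0 ?cabs_ge0 ?invr_ge0 ?mulr_ge0 ?(ltW rho0) //.
  by rewrite ler_pdivrMr ?mulr_gt0 //; move: wr; clear; lra.
have lim0 : 2 * B * (2^-1) ^+ N.+1 @[N --> \oo] --> (0 : R).
  rewrite -(mulr0 (2 * B)); apply: cvgMl_tmp.
  have := @cvg_geometric0 R (2^-1); rewrite invr_ge0 ler0n invf_lt1 // ltr1n => /(_ isT).
  by rewrite -(cvg_shiftS (fun N => (2^-1 : R) ^+ N : R)).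
have z_rho : cabs z <= rho by apply: le_trans zr _; move: rho0; clear; lra.
have key : \forall N \near \oo,
    cabs (T N * cexp (- truncated_series (formal_log c) K z) - 1)
    <= 16 * (A + 1) * (cabs z / rho) ^+ K.+1.
  (* the first bound excludes zeros of [taylor_poly c N] in the disc, the
     second one bounds it on the circle *)
  have e0 : 0 < Num.min (d / 2) 1 by rewrite lt_min divr_gt0 // ltr01.
  have /cvgrPdistC_lt/(_ _ e0)[N0 _ hN0] := lim0.
  exists (maxn N0 K) => // N /= NK.
  have NN0 : (N0 <= N)%N by apply: leq_trans (leq_maxl _ _) NK.
  have KN : (K <= N)%N by apply: leq_trans (leq_maxr _ _) NK.
  have := hN0 N NN0; rewrite /= subr0 => /ltr_normlW; rewrite lt_min => /andP[s1 s2].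
  have [bs [Tbs hbs]] : exists bs, taylor_poly c N = rev_poly bs /\
      forall b, b \in bs -> b != 0 /\ root (taylor_poly c N) b^-1.
    by apply: rev_poly_exists; rewrite coef_poly.
  have brho b : b \in bs -> cabs b * rho < 1.
    move=> /hbs[b0 /rootP rb].
    have b1 : 0 < cabs b by rewrite cabs_gt0.
    rewrite mulrC -ltr_pdivlMr // div1r -cabsV ltNge; apply/negP => le.
    have := close N _ le; rewrite rb subr0; have := hd _ le; move: s1 d0; clear; lra.
  have bA w : cabs w = rho -> cabs (\prod_(b <- bs) (1 - b * w)) <= expR (A + 1).
    move=> wr; rewrite -rev_poly_horner -Tbs.
    have := @close N w; rewrite wr lexx => /(_ isT).
    have := cabs_sub_ge (taylor_poly c N).[w] (h w); rewrite (cabsC _ (h w)).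
    have := hA w wr; rewrite expRD.
    have : 1 <= expR A by rewrite -expR0 ler_expR.
    have : 2 * expR A <= expR A * expR 1.
      by rewrite mulrC ler_wpM2l ?expR_ge0 //; have := @expR_ge1Dx R 1; clear; lra.
    move: s2; clear; lra.
  have := @poly_log R bs rho (A + 1) K z rho0 brho bA zr small.
  rewrite -rev_poly_horner -Tbs -/(T N) (@truncated_series_eq (log_coef bs) (formal_log c)) //.
  move=> j /andP[j0 jK]; apply: (@formal_logE c bs N) => //.
    by move=> k kN; rewrite -Tbs coef_poly ltnS kN.
  by rewrite j0 (leq_trans jK).
have Th : (T N : Co) @[N --> \oo] --> (h z : Co).
  apply: (@cvgc_squeeze R nat \oo _ _ _ (fun N => 2 * B * (2^-1) ^+ N.+1)) => //.
  by apply: nearW => N; rewrite cabsC; apply: close.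
have lim := @cvgcM R nat \oo eventually_filter _ _ _ _ Th
  (@cvgc_cst R nat \oo eventually_filter (cexp (- truncated_series (formal_log c) K z))).
exact: (@cvgc_cabs_le R nat \oo _ _ _ 1 _ lim key).
Qed.

Lemma taylor_linear_factor f h c c' b : taylor f c -> taylor h c' ->
  (forall w, f w = (1 - b * w) * h w) ->
  c 0%N = c' 0%N /\ forall k, c k.+1 = c' k.+1 - b * c' k.
Proof.
move=> tf th fE; split.
  by rewrite (taylor_coef0 tf) (taylor_coef0 th) fE mulr0 subr0 mul1r.
case: tf th => fV _ _ [hV _ _] k; apply: has_mean_unique (fV 1 k.+1 ltr01) _.
have := has_meanD (hV 1 k.+1 ltr01) (has_meanZ (- b) (hV 1 k ltr01)).
rewrite mulNr; apply: has_mean_ext; first exact: ler01.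
move=> w w1; have w0 : w != 0 by rewrite -cabs_gt0 w1.
by rewrite fE exprS; field; rewrite w0 expf_neq0.
Qed.

Lemma formal_log_linear f h c c' b j : taylor f c -> taylor h c' -> h 0 = 1 ->
  (forall w, f w = (1 - b * w) * h w) -> (0 < j)%N ->
  formal_log c j = formal_log c' j - b ^+ j / j%:R.
Proof.
move=> tf th h0 fE j0.
have [c0 cS] := taylor_linear_factor tf th fE.
have c'0 : c' 0%N = 1 by rewrite (taylor_coef0 th).
have [bs [Tbs _]] : exists bs, taylor_poly c' j = rev_poly bs /\
    forall b, b \in bs -> b != 0 /\ root (taylor_poly c' j) b^-1.
  by apply: rev_poly_exists; rewrite coef_poly.
have e1 k : (k <= j)%N -> (rev_poly bs)`_k = c' k.
  by move=> kj; rewrite -Tbs coef_poly ltnS kj.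
rewrite -(@formal_logE c' bs j) ?j0 ?leqnn // -(@formal_logE c (b :: bs) j) ?j0 ?leqnn //.
- rewrite /log_coef /power_sum big_cons mulrDl opprD addrC //.
- by rewrite c0.
case=> [_|k kj]; first by rewrite coef_rev_poly0 c0.
have -> : rev_poly (b :: bs) = (1 - b *: 'X) * rev_poly bs by rewrite /rev_poly big_cons.
by rewrite coef_rev_polyS cS !e1 // ltnW.
Qed.

Lemma formal_log_factors f h c c' (bs : seq C) j : entire h -> taylor f c -> taylor h c' ->
  h 0 = 1 -> (forall w, f w = \prod_(b <- bs) (1 - b * w) * h w) -> (0 < j)%N ->
  formal_log c j = formal_log c' j + log_coef bs j.
Proof.
move=> he; elim: bs f c => [|b bs IH] f c tf th h0 fE j0.
  have cc : c = c'.
    apply/funext => k; case: tf th => fV _ _ [hV _ _].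
    apply: has_mean_unique (fV 1 k ltr01) _.
    by apply: has_mean_ext (hV 1 k ltr01) => // w _; rewrite fE big_nil mul1r.
  by rewrite cc /log_coef /power_sum big_nil mul0r oppr0 addr0.
pose g w := \prod_(b <- bs) (1 - b * w) * h w.
have ge : entire g.
  apply: entireM he; apply/entireP => w; apply: cdiff_prod => a.
  apply: cdiffB; first exact: cdiff_cst.
  by apply: cdiffM; [exact: cdiff_cst | exact: cdiff_id].
have [d td] := entire_taylor ge.
have g0 : g 0 = 1.
  by rewrite /g h0 mulr1 big1 // => a _; rewrite mulr0 subr0.
rewrite (@formal_log_linear f g c d b j tf td g0 _ j0); last first.
  by move=> w; rewrite fE big_cons mulrA.
rewrite (IH g d td th h0 _ j0) //.
by rewrite /log_coef /power_sum big_cons mulrDl opprD (addrC (- (b ^+ j / _))) addrA.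
Qed.

End EntireLogarithm.

(** * Hadamard's factorization theorem *)

Section Hadamard.
Context {R : realType}.
Local Notation C := R[i].
Local Notation Co := (R[i]^o).
Implicit Types (f h : C -> C) (z w a : C).

Lemma cvgc_cexp (T : Type) (F : set_system T) {FF : Filter F} (u : T -> C) (l : C) :
  (u x : Co) @[x --> F] --> (l : Co) -> (cexp (u x) : Co) @[x --> F] --> (cexp l : Co).
Proof.
move=> /cvgcP ul; apply/cvgcP => e e0.
have /cctsP/(_ _ e0)[D D0 hD] := cdiff_cts (cdiff_cexp l).
by apply: filterS (ul D D0) => x /hD.
Qed.

(** The finite sets of the exhaustion eventually contain those that matter in
    any given finite set. *)
Lemma cvg_totally_exhaustion (idx : C) (op : Monoid.com_law idx) (F : C -> C) (l : C)
    (s : nat -> seq C) :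
  ((\big[op/idx]_(a <- A) F a : C) : Co) @[A --> totally] --> (l : Co) ->
  (forall N, uniq (s N)) ->
  (forall a, F a != idx -> \forall N \near \oo, a \in s N) ->
  ((\big[op/idx]_(a <- s N) F a : C) : Co) @[N --> \oo] --> (l : Co).
Proof.
move=> /cvgcP hl us hs; apply/cvgcP => e e0.
have [A0 _ hA0] := hl e e0.
have sub : \forall N \near \oo, forall a, a \in enum_fset A0 -> F a != idx -> a \in s N.
  elim: (enum_fset A0) => [|a t IH]; first by apply: nearW.
  have [Fa|Fa] := eqVneq (F a) idx.
    apply: filterS IH => N h b; rewrite inE => /orP[/eqP -> |]; last exact: h.
    by rewrite Fa eqxx.
  apply: filterS2 IH (hs a Fa) => N h ha b; rewrite inE => /orP[/eqP -> _ //|]; exact: h.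
apply: filterS sub => N hN.
pose B := [fset x in s N]%fset.
have sB : \big[op/idx]_(a <- B) F a = \big[op/idx]_(a <- s N) F a.
  apply: perm_big; apply: uniq_perm; [exact: fset_uniq | exact: us |].
  by move=> a; rewrite !inE.
have <- : \big[op/idx]_(a <- (B `|` A0)%fset) F a = \big[op/idx]_(a <- s N) F a.
  rewrite (fset_big_split op F (fsubsetUl B A0)) sB.
  rewrite [X in op _ X](_ : _ = idx) ?Monoid.mulm1 // big_seq big1 // => a.
  rewrite in_fsetD in_fsetU => /andP[nB]; rewrite (negbTE nB) /= => aA.
  by apply/eqP; apply: contraNT nB => /(hN a aA) ha; rewrite inE.
by apply: hA0 => /=; apply: fsubsetUr.
Qed.

Lemma near_ball_nat a : \forall N \near \oo, cabs a <= N.+1%:R.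
Proof.
exists (Num.trunc (cabs a)).+1 => // N /= aN.
have /andP[_ /ltW h] := Num.Theory.trunc_itv (cabs_ge0 a); apply: le_trans h _.
by rewrite ler_nat ltnW // ltnS.
Qed.

(** Let [h] be the quotient of [f] by the linear factors [1 - w / a] of its
    zeros in a disc of radius [rho]. By [entire_log] and the growth of [f], in
    a fixed disc [h] is the exponential of its truncated logarithm of degree
    [K] up to a factor that tends to 1 with [rho]. In this truncation the
    terms of degree greater than [p] that come from the linear factors tend to
    sums over all zeros; the terms of degree at most [p] turn the linear
    factors into primary factors. *)
Lemma hadamard1 f q (A : R) p : entire f -> f 0 = 1 -> 0 <= A -> growth f q A ->
  summable_zeros (mult f) p ->
  exists Q : {poly C}, forall z l,
    ((\prod_(a <- A) zero_factor (mult f) p z a : C) : Co) @[A --> totally] --> (l : Co) ->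
    f z = cexp Q.[z] * l.
Proof.
move=> fe f0 A0 fg sp.
have fn : exists z, f z != 0 by exists 0; rewrite f0 oner_neq0.
have [c tc] := entire_taylor fe.
(* with [q <= K] the error of [entire_log], of order [rho ^ (q - (K + 1))],
   tends to zero *)
pose K := maxn q p.
have rho0 N : 0 < N.+1%:R :> R by rewrite ltr0n.
have rho1 N : 1 <= N.+1%:R :> R by rewrite ler1n.
have [s hs] := choice (fun N => let: ex_intro2 s us e := summable_zeros_finite (rho0 N) sp in
  ex_intro (fun s => uniq s /\ forall a, a \in s = [&& mult f a != 0%N, a != 0 & cabs a <= N.+1%:R])
    s (conj us e)).
have us N : uniq (s N) by case: (hs N).
have {hs} sE N a : a \in s N = [&& mult f a != 0%N, a != 0 & cabs a <= N.+1%:R].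
  by case: (hs N).
(* the power sums of the inverse zeros in the disc of radius [N.+1] *)
pose S N j : C := \sum_(a <- s N) (mult f a)%:R * a^-1 ^+ j.
have [t ht] : exists t : nat -> C, forall j, (p < j)%N ->
    (S N j : Co) @[N --> \oo] --> (t j : Co).
  have ex j : exists tj : C, (p < j)%N -> (S N j : Co) @[N --> \oo] --> (tj : Co).
    case: (ltnP p j) => pj; last by exists 0.
    have [l hl] := power_sum_cvg sp pj; exists l => _.
    apply: (@cvg_totally_exhaustion 0 +%R (fun a => (mult f a)%:R * a^-1 ^+ j)) => // a.
    have [->|a0] := eqVneq a 0.
      by rewrite invr0 -(prednK (leq_ltn_trans (leq0n p) pj)) exprS mul0r mulr0 eqxx.
    have [->|ma _] := eqVneq (mult f a) 0%N; first by rewrite mul0r eqxx.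
    by apply: filterS (near_ball_nat a) => N aN; rewrite sE ma a0.
  by have [t ht] := choice ex; exists t.
pose bs N := flatten [seq nseq (mult f a) a^-1 | a <- s N].
have prod_bs N (F : C -> C) : \prod_(b <- bs N) F b = \prod_(a <- s N) F a^-1 ^+ mult f a.
  rewrite /bs big_flatten big_map; apply: eq_bigr => a _.
  by rewrite big_nseq iter_mulr_1.
have log_bs N j : log_coef (bs N) j = - (S N j / j%:R).
  rewrite /log_coef /power_sum /bs big_flatten big_map; congr (- (_ / _)).
  by apply: eq_bigr => a _; rewrite big_nseq iter_addr addr0 mulr_natl.
(* the exponent that remains when the zeros of the disc have been collected in
   primary factors of degree [p]; it converges with [S] *)
pose X N z := truncated_series (formal_log c) K z + \sum_(p.+1 <= j < K.+1) S N j / j%:R * z ^+ j.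
pose Aq := A * 2 ^+ q + 2.
have Aq0 : 0 <= Aq by rewrite addr_ge0 // mulr_ge0 // exprn_ge0.
pose err N z := 16 * (Aq * cabs z ^+ K.+1 * N.+1%:R^-1).
have main N z : cabs z <= N.+1%:R / 2 -> err N z <= 4 ->
    exists2 eta : C, cabs (eta - 1) <= err N z &
      f z = \prod_(a <- s N) zero_factor (mult f) p z a * eta * cexp (X N z).
  move=> zN eN; set rho : R := N.+1%:R.
  have [h' [he' _ fE' hm]] := entire_factor fe fn (us N).
  pose h w := \prod_(a <- s N) (- a) ^+ mult f a * h' w.
  have an a : a \in s N -> a != 0 by rewrite sE => /and3P[].
  have fE w : f w = \prod_(b <- bs N) (1 - b * w) * h w.
    rewrite prod_bs /h mulrA -big_split /= fE'; congr (_ * _).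
    rewrite big_seq [RHS]big_seq; apply: eq_bigr => a /an a0.
    by rewrite -exprMn; congr (_ ^+ _); field.
  have he : entire h by apply: entireM he'; apply: entire_cst.
  have [ch th] := entire_taylor he.
  have h0 : h 0 = 1.
    have := fE 0; rewrite f0 big1 ?mul1r // => b _; by rewrite mulr0 subr0.
  have h'n : exists z, h' z != 0.
    by exists 0; apply: contra_eq_neq h0 => e; rewrite /h e mulr0 eq_sym oner_neq0.
  have hn w : cabs w <= rho -> h w != 0.
    move=> wr; rewrite mulf_neq0 //.
      by rewrite prodf_seq_neq0; apply/allP => a /an a0; rewrite /= expf_neq0 ?oppr_eq0.
    rewrite -mult0P // hm; case: ifPn => //; rewrite sE wr andbT negb_and negbK.
    by case/orP => //; rewrite negbK => /eqP ->; rewrite mult0P // f0 oner_neq0.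
  (* on the circle of radius [2 rho] each linear factor has modulus at least
     1 *)
  have b1 w : cabs w = 2 * rho -> 1 <= cabs (\prod_(b <- bs N) (1 - b * w)).
    move=> wr; rewrite prod_bs cabs_prod.
    apply: (@le_trans _ _ (\prod_(a <- s N) (1 : R))); first by rewrite big1.
    rewrite big_seq [X in _ <= X]big_seq; apply: ler_prod => a sa; rewrite ler01 /= cabsX.
    apply: exprn_ege1; have := sa; rewrite sE => /and3P[_ a0 ar].
    have a1 : 0 < cabs a by rewrite cabs_gt0.
    have := cabs_sub_ge (a^-1 * w) 1; rewrite cabs1 cabsC cabsM cabsV wr => le.
    have : 2 <= (cabs a)^-1 * (2 * rho).
      by rewrite mulrC ler_pdivlMr // ler_wpM2l.
    by move: le; clear; lra.
  have hB w : cabs w = 2 * rho -> cabs (h w) <= expR (A * (2 * rho) ^+ q).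
    move=> wr; apply: (@le_trans _ _ (cabs (f w))).
      rewrite (fE w) (cabsM (\prod_(b <- bs N) (1 - b * w)) (h w)).
      by rewrite ler_peMl ?cabs_ge0 // b1.
    by rewrite -wr; apply: fg; rewrite wr; have := rho1 N; rewrite -/rho; clear; lra.
  have rho0' : 0 < rho by apply: rho0.
  (* a weak maximum principle: the remainder of order 0 of the Taylor series
     costs a factor 2, absorbed by [+ 1] *)
  have hC w : cabs w = rho -> cabs (h w) <= expR (A * (2 * rho) ^+ q + 1).
    move=> wr; have r20 : 0 < 2 * rho by rewrite mulr_gt0.
    have := taylor_tail 0 th r20 hB (_ : cabs w <= 2 * rho / 2).
    rewrite wr big_ord0 subr0 expr0 mulr1 => H.
    have {H} : cabs (h w) <= 2 * expR (A * (2 * rho) ^+ q) by apply: H; clear; lra.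
    move/le_trans; apply; rewrite expRD mulrC ler_wpM2l ?expR_ge0 //.
    by have := @expR_ge1Dx R 1; clear; lra.
  have A'0 : 0 <= A * (2 * rho) ^+ q + 1.
    by rewrite addr_ge0 // mulr_ge0 // exprn_ge0 // mulr_ge0 // ltW.
  have errle : (A * (2 * rho) ^+ q + 1 + 1) * (cabs z / rho) ^+ K.+1 <=
      Aq * cabs z ^+ K.+1 * rho^-1.
    have rq : rho ^+ q <= rho ^+ K by rewrite ler_weXn2l ?rho1 // leq_maxl.
    have rK : 1 <= rho ^+ K by rewrite exprn_ege1 // rho1.
    have -> : (cabs z / rho) ^+ K.+1 = (rho ^+ K)^-1 * (cabs z ^+ K.+1 * rho^-1).
      by rewrite expr_div_n (exprSr rho) invfM; ring.
    rewrite mulrA -[X in _ <= X]mulrA ler_wpM2r //.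
      by rewrite mulr_ge0 ?exprn_ge0 ?cabs_ge0 // invr_ge0 ltW.
    rewrite ler_pdivrMr ?exprn_gt0 // exprMn /Aq mulrDl.
    have : A * 2 ^+ q * rho ^+ q <= A * 2 ^+ q * rho ^+ K.
      by rewrite ler_wpM2l // mulr_ge0 // exprn_ge0.
    move: rK; clear; lra.
  have small : 4 * (A * (2 * rho) ^+ q + 1 + 1) * (cabs z / rho) ^+ K.+1 <= 1.
    rewrite -mulrA; apply: (@le_trans _ _ (4 * (Aq * cabs z ^+ K.+1 * rho^-1))).
      by rewrite ler_wpM2l.
    by move: eN; rewrite /err -/rho; move: (_ * rho^-1); clear => ?; lra.
  have := entire_log he th h0 rho0' A'0 hn hC zN small.
  set eta := h z * _ => heta; exists eta.
    by apply: le_trans heta _; rewrite /err -/rho -mulrA ler_wpM2l.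
  have tb (a b : nat) : (a <= b)%N -> truncated_series (log_coef (bs N)) b z =
      truncated_series (log_coef (bs N)) a z + \sum_(a.+1 <= j < b.+1) log_coef (bs N) j * z ^+ j.
    by move=> ab; rewrite /truncated_series (big_cat_nat (_ : (1 <= a.+1)%N) (_ : (a.+1 <= b.+1)%N)).
  have tadd : truncated_series (formal_log c) K z =
      truncated_series (formal_log ch) K z + truncated_series (log_coef (bs N)) K z.
    rewrite /truncated_series -big_split /= big_nat [RHS]big_nat; apply: eq_bigr => j /andP[j0 _].
    by rewrite (formal_log_factors he tc th h0 fE j0) mulrDl.
  (* in terms of the logarithm of [h], with the linear factors truncated at
     [p] *)
  have XE : X N z = truncated_series (formal_log ch) K z + truncated_series (log_coef (bs N)) p z.
    rewrite /X tadd (tb p K) ?leq_maxr // -!addrA; congr (_ + _).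
    rewrite -[RHS]addr0; congr (_ + _); rewrite -big_split /= big1 // => j _.
    by rewrite log_bs; ring.
  rewrite (fE z) (prod_log _ p) prod_bs XE cexpD /eta cexpN.
  have -> : \prod_(a <- s N) primary_factor p (a^-1 * z) ^+ mult f a =
            \prod_(a <- s N) zero_factor (mult f) p z a.
    by apply: eq_bigr => a _; rewrite /zero_factor mulrC.
  have e0 := cexp_neq0 (truncated_series (formal_log ch) K z).
  move: e0; move: (cexp _) => e; move: (cexp _) => e'; move: (\prod_(a <- s N) _) (h z) => u v e0.
  by field.
pose qc j : C := if j == 0%N then 0 else formal_log c j + (if (p < j)%N then t j / j%:R else 0).
pose Q : {poly C} := \poly_(j < K.+1) qc j.
exists Q => z l hl.
have Xlim : (X N z : Co) @[N --> \oo] --> (Q.[z] : Co).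
  have QE : Q.[z] = truncated_series (formal_log c) K z + \sum_(p.+1 <= j < K.+1) t j / j%:R * z ^+ j.
    rewrite /Q horner_poly -(big_mkord xpredT (fun j => qc j * z ^+ j)) big_ltn //.
    rewrite {1}/qc eqxx mul0r add0r /truncated_series.
    rewrite (big_nat_widenl p.+1 1) // [X in _ = _ + X]big_mkcond -big_split /=.
    rewrite big_nat [RHS]big_nat; apply: eq_bigr => j /andP[j0 _].
    rewrite /qc eqn0Ngt j0 /= mulrDl; congr (_ + _).
    by case: ifP; rewrite // mul0r.
  rewrite QE; apply: (@cvgcD R nat \oo); first exact: (@cvgc_cst R nat \oo).
  rewrite big_seq; apply: (@cvgc_ext R nat \oo _ (fun N => \sum_(j <- index_iota p.+1 K.+1)
      (if (p < j)%N then S N j / j%:R * z ^+ j else 0))) => [N|].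
    by rewrite big_nat [RHS]big_nat; apply: eq_bigr => j /andP[-> _].
  rewrite -big_seq (eq_big_seq (fun j => if (p < j)%N then t j / j%:R * z ^+ j else 0)).
    apply: (@cvgc_sum R nat nat \oo) => j; case: ifP => pj; last exact: (@cvgc_cst R nat \oo).
    apply: (@cvgcM R nat \oo); last exact: (@cvgc_cst R nat \oo).
    by apply: (@cvgcM R nat \oo); [exact: ht | exact: (@cvgc_cst R nat \oo)].
  by move=> j; rewrite mem_index_iota => /andP[-> _].
have Plim : ((\prod_(a <- s N) zero_factor (mult f) p z a : C) : Co) @[N --> \oo] --> (l : Co).
  apply: (@cvg_totally_exhaustion 1 *%R (zero_factor (mult f) p z) l s hl us) => a za.
  have [/zero_factor1 e|] := boolP ((mult f a == 0%N) || (a == 0)); first by rewrite e eqxx in za.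
  rewrite negb_or => /andP[ma a0]; apply: filterS (near_ball_nat a) => N aN.
  by rewrite sE ma a0.
have errlim : err N z @[N --> \oo] --> (0 : R).
  rewrite -(mulr0 16); apply: cvgMl_tmp; rewrite -(mulr0 (Aq * cabs z ^+ K.+1)); apply: cvgMl_tmp.
  exact: cvg_harmonic.
have near_main : \forall N \near \oo, exists2 eta : C, cabs (eta - 1) <= err N z &
    f z = \prod_(a <- s N) zero_factor (mult f) p z a * eta * cexp (X N z).
  have h1 : \forall N \near \oo, cabs z <= N.+1%:R / 2.
    apply: filterS (near_ball_nat (2 * z)) => N.
    by rewrite cabsM cabs_nat ler_pdivlMr // mulrC.
  have h2 : \forall N \near \oo, err N z <= 4.
    have /cvgrPdistC_lt/(_ 4 ltac:(by [])) := errlim.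
    by apply: filterS => N; rewrite subr0 => /ltr_normlW/ltW.
  by apply: filterS2 h1 h2 => N; apply: main.
(* for small [N] the relation may fail, and any value will do *)
have ex N : exists e : C, (exists2 eta : C, cabs (eta - 1) <= err N z &
    f z = \prod_(a <- s N) zero_factor (mult f) p z a * eta * cexp (X N z)) ->
    cabs (e - 1) <= err N z /\
    f z = \prod_(a <- s N) zero_factor (mult f) p z a * e * cexp (X N z).
  have [[e h1 h2]|nex] := pselect (exists2 eta : C, cabs (eta - 1) <= err N z &
    f z = \prod_(a <- s N) zero_factor (mult f) p z a * eta * cexp (X N z)); first by exists e.
  by exists 0 => ex; case: nex.
have [eta heta] := choice ex.
have etalim : (eta N : Co) @[N --> \oo] --> (1 : Co).
  apply: (@cvgc_squeeze R nat \oo _ _ _ (fun N => err N z)) => //.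
  by apply: filterS near_main => N /heta[].
have lim := @cvgcM R nat \oo eventually_filter _ _ _ _
  (@cvgcM R nat \oo eventually_filter _ _ _ _ Plim etalim)
  (@cvgc_cexp nat \oo eventually_filter _ _ Xlim).
rewrite mulr1 mulrC in lim.
apply: (@cvgc_unique R nat \oo _ _ _ _ _ lim).
apply: cvg_near_cst; apply: filterS near_main => N /heta[_ <-] //.
Qed.

End Hadamard.

Section HadamardGeneral.
Context {R : realType}.
Local Notation C := R[i].
Local Notation Co := (R[i]^o).
Implicit Types (f g h : C -> C) (z w a : C) (M : C -> nat).

Lemma entire_normalize f : entire f -> (exists z, f z != 0) -> finite_order f ->
  exists f1 (c : C), [/\ entire f1, f1 0 = 1, c != 0,
    forall w, f w = c * w ^+ mult f 0 * f1 w &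
    (exists q (A : R), 0 <= A /\ growth f1 q A) /\
    forall a, a != 0 -> mult f1 a = mult f a].
Proof.
move=> fe fn fo; have [h [he h0 fE]] := multP 0 fe fn.
pose f1 w := (h 0)^-1 * h w.
have f1e : entire f1 by apply: entireM he; apply: entire_cst.
have f10 : f1 0 = 1 by rewrite /f1 mulVf.
have f1n : exists z, f1 z != 0 by exists 0; rewrite f10 oner_neq0.
have f1E w : f w = h 0 * w ^+ mult f 0 * f1 w.
  by rewrite /f1 fE subr0 mulrACA divff // mul1r.
exists f1, (h 0); split=> //; split.
  have [q [A [A0 fg]]] := finite_order_growth fe fo.
  exists q, (A + `|ln (cabs (h 0))|); split; first by rewrite addr_ge0.
  move=> z z1; have zq : 1 <= cabs z ^+ q by rewrite exprn_ege1.
  have hz : 0 < cabs (h 0) by rewrite cabs_gt0.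
  have le : cabs (h 0) * cabs (f1 z) <= expR (A * cabs z ^+ q).
    apply: le_trans (fg z z1).
    rewrite f1E (cabsM (h 0 * _)) (cabsM (h 0)) cabsX mulrAC ler_peMr ?mulr_ge0 ?cabs_ge0 //.
    by rewrite exprn_ege1.
  have E : cabs (h 0) = expR (ln (cabs (h 0))) by rewrite lnK ?posrE.
  have {}le : cabs (f1 z) <= expR (A * cabs z ^+ q - ln (cabs (h 0))).
    by rewrite expRB -E ler_pdivlMr // mulrC.
  apply: le_trans le _; rewrite ler_expR mulrDl lerD2l.
  apply: (@le_trans _ _ (`|ln (cabs (h 0))| * 1)); last by rewrite ler_wpM2l.
  by rewrite mulr1 -normrN ler_norm.
move=> a a0; have [k [ke ka f1k]] := multP a f1e f1n.
apply/esym; apply: (mult_eq (h := fun w => h 0 * w ^+ mult f 0 * k w)).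
- apply: entireM ke; apply/entireP => z; apply: cdiffM; first exact: cdiff_cst.
  by apply: cdiffX; apply: cdiff_id.
- by rewrite !mulf_neq0 // expf_neq0.
- by move=> w; rewrite f1E f1k mulrCA.
Qed.

Lemma zeros_sum_eq M M' p s : (forall a, a != 0 -> M a = M' a) ->
  zeros_sum M p s = zeros_sum M' p s :> R.
Proof.
move=> e; apply: eq_bigr => a _; have [->|a0] := eqVneq a 0; last by rewrite e.
by rewrite cabs0 exprS mul0r invr0 !mulr0.
Qed.

Lemma finite_order_summable f : entire f -> (exists z, f z != 0) -> finite_order f ->
  exists p, summable_zeros (mult f) p.
Proof.
move=> fe fn fo.
have [f1 [c [f1e f10 c0 f1E [[q [A [A0 fg]]] hm]]]] := entire_normalize fe fn fo.
have f1n0 : f1 0 != 0 by rewrite f10 oner_neq0.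
have [B hB] := growth_summable f1e f1n0 A0 fg.
by exists q, B => s us; rewrite -(zeros_sum_eq _ _ hm); apply: hB.
Qed.

(** The zero at the origin and the value of the quotient there reduce the
    general case to [hadamard1]. *)
Theorem hadamard f p : entire f -> (exists z, f z != 0) -> finite_order f ->
  summable_zeros (mult f) p ->
  exists Q : {poly C}, forall z l,
    ((\prod_(a <- A) zero_factor (mult f) p z a : C) : Co) @[A --> totally] --> (l : Co) ->
    f z = cexp Q.[z] * (z ^+ mult f 0 * l).
Proof.
move=> fe fn fo [B hB].
have [f1 [c [f1e f10 c0 f1E [[q [A [A0 fg]]] hm]]]] := entire_normalize fe fn fo.
have sp : summable_zeros (mult f1) p.
  by exists B => s us; rewrite (zeros_sum_eq _ _ hm); apply: hB.
have [Q hQ] := hadamard1 f1e f10 A0 fg sp.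
have [c' cE] := clog_exists c0.
exists (Q + c'%:P) => z l hl.
have eq1 a : zero_factor (mult f1) p z a = zero_factor (mult f) p z a.
  have [->|a0] := eqVneq a 0; first by rewrite !zero_factor1 ?eqxx ?orbT.
  by rewrite /zero_factor hm.
have hl1 : ((\prod_(a <- A) zero_factor (mult f1) p z a : C) : Co) @[A --> totally] --> (l : Co).
  apply: (@cvgc_ext R {fset C} totally _ _ _ _ _ hl) => A'.
  by apply: eq_bigr => a _; rewrite eq1.
rewrite (f1E z) (hQ z l hl1) hornerD hornerC cexpD cE.
by rewrite mulrACA [c * _]mulrC.
Qed.

(** * Symmetry of the zeros *)

(** The functions [f f^#] and [g g^#] coincide on the real line, hence
    everywhere. *)
Lemma mult_sym_real f g : entire f -> entire g -> (exists z, f z != 0) ->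
  (exists z, g z != 0) -> (forall t : R, cabs (f t%:C) = cabs (g t%:C)) ->
  forall z, (mult f z + mult f z^* = mult g z + mult g z^*)%N.
Proof.
move=> fe ge fn gn fg z.
pose F w := f w * (f w^*)^*; pose G w := g w * (g w^*)^*.
have conjn (k : C -> C) : (exists z, k z != 0) -> exists z : C, (k z^*)^* != 0.
  by move=> [v kv]; exists v^*; rewrite conjcI -cabs_gt0 cabs_conj cabs_gt0.
have FG : F = G.
  apply/funext => w; apply/eqP; rewrite -subr_eq0; apply: contraT => FGw.
  have FGe : entire (fun w => F w - G w).
    exact: entireB (entireM fe (entire_conj fe)) (entireM ge (entire_conj ge)).
  have [|D D0 hD] := @entire_isolated R _ 0 FGe; first by exists w.
  have t0 : 0 < D / 2 by rewrite divr_gt0.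
  have at0 : cabs (D / 2)%:C = D / 2 by rewrite cabs_real gtr0_norm.
  have := hD (D / 2)%:C; rewrite subr0 at0 -cabs_gt0 at0 t0 => /(_ isT) H.
  have : F (D / 2)%:C - G (D / 2)%:C != 0 by apply: H; move: D0; clear; lra.
  by rewrite /F /G !conjcR !mul_conj_cabs fg subrr eqxx.
have := multM z fe (entire_conj fe) fn (conjn f fn).
rewrite -/F FG /G (multM z ge (entire_conj ge) gn (conjn g gn)).
by rewrite !mult_conj // => ->.
Qed.

(** Apply [mult_sym_real] to [f (u w)] and [g (u w)]. *)
Lemma mult_sym_line f g (u : C) : cabs u = 1 -> entire f -> entire g ->
  (exists z, f z != 0) -> (exists z, g z != 0) ->
  (forall t : R, cabs (f (u * t%:C)) = cabs (g (u * t%:C))) ->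
  forall z, (mult f z + mult f (u ^+ 2 * z^*)%R = mult g z + mult g (u ^+ 2 * z^*)%R)%N.
Proof.
move=> u1 fe ge fn gn fg z.
have u0 : u != 0 by rewrite -cabs_gt0 u1.
have sc (k : C -> C) : entire k -> entire (fun w => k (u * w)).
  by move=> ke; apply: (entire_comp ke); apply: entireM entire_id; apply: entire_cst.
have nz (k : C -> C) : (exists z, k z != 0) -> exists z, k (u * z) != 0.
  by move=> [v kv]; exists (u^-1 * v); rewrite mulVKf.
have := mult_sym_real (sc f fe) (sc g ge) (nz f fn) (nz g gn) fg (u^-1 * z).
rewrite !mult_scale // mulVKf //.
have -> : u * (u^-1 * z)^* = u ^+ 2 * z^*.
  rewrite conjcM conjcV mulrA; congr (_ * _).
  have uc : u^-1 = u^* by rewrite cmul_conj_circle u1 ?oner_eq0 // expr1n divr1.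
  by rewrite -uc invrK expr2.
by [].
Qed.

End HadamardGeneral.

(** * The group of rotations and its sector *)

Section RotationGroup.
Context {R : realType}.
Local Notation C := R[i].
Variables (theta : R) (n m : nat).
Hypotheses (n0 : (0 < n)%N) (m0 : (0 < m)%N) (nm : theta * n%:R = pi * m%:R)
  (cmn : coprime m n).
Implicit Types (a b z : C) (j k : nat).

Definition turn k : C := cexp ((2 * theta * k%:R) *i).

Lemma iter_rotation k a : iter k (rotation (2 * theta)) a = turn k * a.
Proof.
elim: k => [|k IH]; first by rewrite /turn mulr0 (_ : 0 *i = 0) ?cexp0 ?mul1r.
rewrite iterS IH /turn /rotation mulrA -cexpD -imagD.
by congr (cexp (_ *i) * _); rewrite -(natr1 k) [RHS]mulrDr mulr1 addrC.
Qed.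

Lemma turnD j k : turn (j + k) = turn j * turn k.
Proof. by rewrite /turn -cexpD -imagD natrD mulrDr. Qed.

Lemma cabs_turn k : cabs (turn k) = 1.
Proof. exact: cabs_cexp_i. Qed.

Lemma turn_neq0 k : turn k != 0.
Proof. by rewrite -cabs_gt0 cabs_turn. Qed.

Lemma turn0 : turn 0 = 1.
Proof. by have := iter_rotation 0 1; rewrite mulr1. Qed.

Let nR : n%:R != 0 :> R.
Proof. by rewrite pnatr_eq0 -lt0n. Qed.

Lemma turnE k : turn k = cexp ((2 * pi * (m * k)%:R / n%:R) *i).
Proof.
rewrite /turn; have -> : theta = pi * m%:R / n%:R by rewrite -nm mulfK.
congr (cexp (_ *i)); rewrite natrM.
by move: nR; generalize (n%:R : R) => N N0; field.
Qed.

Lemma unity_mod k : cexp ((2 * pi * k%:R / n%:R) *i) =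
  cexp ((2 * pi * (k %% n)%:R / n%:R) *i) :> C.
Proof.
rewrite {1}(divn_eq k n) natrD natrM.
have -> : 2 * pi * ((k %/ n)%:R * n%:R + (k %% n)%:R) / n%:R =
    2 * pi * (k %/ n)%:R + 2 * pi * (k %% n)%:R / n%:R :> R.
  by rewrite mulrDr mulrDl [_ * n%:R]mulrC mulrCA [n%:R * _]mulrC mulfK // mulrA.
by rewrite imagD cexpD cexp_2pi_nat mul1r.
Qed.

Lemma unity_eq1 k : cexp ((2 * pi * k%:R / n%:R) *i) = 1 :> C -> (n %| k)%N.
Proof.
rewrite unity_mod /dvdn => e; apply: contraT; rewrite -lt0n => k0.
have p0 := pi_gt0 R; have nR0 : 0 < n%:R :> R by rewrite ltr0n.
have : cexp ((2 * pi * (k %% n)%:R / n%:R) *i) != 1 :> C.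
  apply: cexp_i_neq1; rewrite divr_gt0 ?mulr_gt0 ?ltr0n //=.
  by rewrite ltr_pdivrMr // ltr_pM2l ?mulr_gt0 // ltr_nat ltn_pmod.
by rewrite e eqxx.
Qed.

Lemma turn_eq1 k : (turn k == 1) = (n %| k)%N.
Proof.
apply/eqP/idP => [|/dvdnP[j ->]].
  by rewrite turnE => /unity_eq1; rewrite Gauss_dvdr // coprime_sym.
by rewrite turnE unity_mod mulnA modnMl mulr0 mul0r (_ : 0 *i = 0) ?cexp0.
Qed.

Lemma turnn : turn n = 1.
Proof. by apply/eqP; rewrite turn_eq1. Qed.

Lemma turnXn k : turn k ^+ n = 1.
Proof.
have -> : turn k ^+ n = turn (n * k).
  elim: {1 2}n => [|l IH]; first by rewrite turn0.
  by rewrite exprS IH mulSn turnD.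
by apply/eqP; rewrite turn_eq1 dvdn_mulr.
Qed.

Lemma turn_inj j k : (0 < j <= n)%N -> (0 < k <= n)%N -> turn j = turn k -> j = k.
Proof.
wlog le : j k / (j <= k)%N.
  move=> H hj hk e; have [le|/ltnW le] := leqP j k; first exact: H.
  by apply/esym; apply: H.
move=> /andP[j0 jn] /andP[k0 kn] e.
have /eqP : turn (k - j) = 1.
  by apply: (mulfI (turn_neq0 j)); rewrite -turnD subnKC // -e mulr1.
rewrite turn_eq1 => /dvdn_leq; case: (posnP (k - j)) => [|_ /(_ isT)]; lia.
Qed.

Lemma turn_conj k : (k <= n)%N -> (turn k)^* = turn (n - k).
Proof.
move=> kn; apply: (mulfI (turn_neq0 k)).
by rewrite -turnD subnKC // turnn mul_conj_cabs cabs_turn expr1n.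
Qed.

(** As [m] is invertible modulo [n], the powers of the rotation by [2 theta]
    are all the rotations by multiples of [2 pi / n]. *)
Lemma unity_turn j : exists2 k, (0 < k <= n)%N &
  turn k = cexp ((2 * pi * j%:R / n%:R) *i).
Proof.
have [u v uv _] := egcdnP n m0; rewrite (eqP cmn) in uv.
have tj : turn (u * j) = cexp ((2 * pi * j%:R / n%:R) *i).
  rewrite turnE unity_mod [in RHS]unity_mod mulnA [(m * u)%N]mulnC uv mulnDl mul1n.
  by rewrite mulnAC modnMDl.
have modt l : turn (l %% n) = turn l.
  rewrite {2}(divn_eq l n) turnD (_ : turn (l %/ n * n) = 1) ?mul1r //.
  by apply/eqP; rewrite turn_eq1 dvdn_mull.
have [r0|r0] := posnP ((u * j) %% n).
  by exists n; rewrite ?n0 ?leqnn // turnn -tj -modt r0 turn0.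
by exists ((u * j) %% n)%N; rewrite ?r0 ?(ltnW (ltn_pmod _ n0)) // modt.
Qed.

(** Half-open, with angle [2 pi / n]: a fundamental domain of the rotations of
    order [n]. *)
Definition in_sector a : Prop := - (pi / n%:R) < carg a <= pi / n%:R.

(** Turn back by the multiple of [2 pi / n] that is nearest to the
    argument. *)
Lemma sector_exists b : b != 0 -> exists a k,
  [/\ a != 0, in_sector a, (0 < k <= n)%N & b = turn k * a].
Proof.
move=> b0; have p0 := pi_gt0 R.
have nR0 : 0 < n%:R :> R by rewrite ltr0n.
have n1 : 1 <= n%:R :> R by rewrite ler1n.
have [t1 t2] := andP (carg_range b0).
(* shifted so that the multiple [j] below is a natural number *)
pose t := carg b + 2 * pi.
(* rounding with ties downwards: [j] is the least integer with
   [t n / (2 pi) <= j + 1/2] *)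
pose y := t * n%:R / (2 * pi) - 2^-1.
have y0 : 0 <= y.
  rewrite subr_ge0 ler_pdivlMr ?mulr_gt0 // mulKf ?pnatr_eq0 //.
  by apply: (@le_trans _ _ (t * 1)); [rewrite /t; lra|rewrite ler_pM2l // /t; lra].
have ex : exists j : nat, y <= j%:R.
  by exists (Num.trunc y).+1; have /andP[_ /ltW] := Num.Theory.trunc_itv y0.
case: (ex_minnP ex) => j yj jmin.
have jy : j%:R - 1 < y.
  case: j yj jmin => [|j] yj jmin; first by rewrite sub0r; lra.
  rewrite -natr1 addrK ltNge; apply/negP => /jmin; by rewrite ltnn.
pose s := t - 2 * pi * j%:R / n%:R.
have sE : s = 2 * (pi / n%:R) * (y + 2^-1 - j%:R).
  have alg (T J N P : R) : N != 0 -> P != 0 -> T - 2 * P * J / N =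
      2 * (P / N) * (T * N / (2 * P) - 2^-1 + 2^-1 - J).
    by move=> N0 P0; field; rewrite N0 P0.
  exact: alg (lt0r_neq0 nR0) (lt0r_neq0 p0).
have q0 : 0 < pi / n%:R :> R by rewrite divr_gt0.
have q1 : pi / n%:R <= pi :> R by rewrite ler_pdivrMr // ler_peMr // ltW.
have s1 : - (pi / n%:R) < s.
  have : (pi / n%:R) * 0 < (pi / n%:R) * (y + 1 - j%:R) by rewrite ltr_pM2l //; lra.
  by rewrite sE; lra.
have s2 : s <= pi / n%:R.
  have : (pi / n%:R) * (y - j%:R) <= (pi / n%:R) * 0 by rewrite ler_pM2l //; lra.
  by rewrite sE; lra.
have r0 : 0 < cabs b by rewrite cabs_gt0.
have [k kn kE] := unity_turn j.
exists ((cabs b)%:C * cexp (s *i)), k; split=> //.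
- by rewrite mulf_neq0 ?cexp_neq0 // -cabs_gt0 cabs_real gtr0_norm.
- by rewrite /in_sector carg_unique ?s1 ?s2 //; lra.
rewrite kE mulrCA -cexpD -imagD /s [_ / _ + _]addrC subrK /t imagD cexpD cexp_2pi mulr1.
exact: cexp_carg.
Qed.

(** The [n]-th powers of both points agree, and their arguments, [n] times
    those of the points, differ by less than [2 pi]. *)
Lemma sector_unique a a' k : a != 0 -> a' != 0 -> in_sector a -> in_sector a' ->
  a = turn k * a' -> a = a'.
Proof.
move=> a0 a'0 /andP[s1 s2] /andP[s1' s2'] e.
have nR0 : 0 < n%:R :> R by rewrite ltr0n.
have ra : cabs a = cabs a' by rewrite e (cabsM (turn k)) cabs_turn mul1r.
have r0 : (cabs a)%:C != 0 :> C by rewrite -cabs_gt0 cabs_real gtr0_norm cabs_gt0.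
have ec : cexp ((carg a) *i) = turn k * cexp ((carg a') *i).
  apply: (mulfI r0); rewrite -cexp_carg // mulrCA ra -cexp_carg //.
have : cexp ((n%:R * carg a) *i) = cexp ((n%:R * carg a') *i) :> C.
  by rewrite -!imagMn -!cexpX ec exprMn turnXn mul1r.
have pn : pi = n%:R * (pi / n%:R) :> R by rewrite mulrCA divff ?mulr1.
move=> en; suff /(mulfI nR) st : n%:R * carg a = n%:R * carg a'.
  by rewrite (cexp_carg a0) (cexp_carg a'0) ra st.
apply: cexp_i_inj en.
have h1 : n%:R * - (pi / n%:R) < n%:R * carg a by rewrite ltr_pM2l.
have h2 : n%:R * carg a <= n%:R * (pi / n%:R) by rewrite ler_pM2l.
have h3 : n%:R * - (pi / n%:R) < n%:R * carg a' by rewrite ltr_pM2l.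
have h4 : n%:R * carg a' <= n%:R * (pi / n%:R) by rewrite ler_pM2l.
by move: h1 h2 h3 h4; rewrite !mulrN -pn; lra.
Qed.

Lemma turn_prod_shift (G : nat -> C) : G n = G 0%N ->
  \prod_(1 <= k < n.+1) G k = \prod_(0 <= k < n) G k.
Proof.
move=> e; rewrite big_add1 /=; case: n n0 e => // l _ e.
by rewrite big_nat_recr //= e mulrC -(big_nat_recl l 0 G).
Qed.

(** Rotation permutes the group, and so does conjugation in
    [turn_prod_conj]. *)
Lemma turn_prod_rot (H : C -> C) :
  \prod_(1 <= k < n.+1) H (turn 1 * turn k) = \prod_(1 <= k < n.+1) H (turn k).
Proof.
under eq_bigr => k _ do rewrite -turnD.
rewrite (@turn_prod_shift (fun k => H (turn (1 + k)))); first by rewrite [RHS]big_add1.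
by rewrite turnD turnn addn0 mulr1.
Qed.

Lemma turn_prod_conj (H : C -> C) :
  \prod_(1 <= k < n.+1) H (turn k)^* = \prod_(1 <= k < n.+1) H (turn k).
Proof.
rewrite (@turn_prod_shift (fun k => H (turn k))) ?turnn ?turn0 // big_add1 big_nat_rev /=.
rewrite [LHS]big_nat [RHS]big_nat; apply: eq_bigr => k /andP[_ kn].
by rewrite turn_conj; [congr (H (turn _)); lia|lia].
Qed.

End RotationGroup.

(** * Grouping an unordered product *)

Section Regrouping.
Context {R : realType}.
Local Notation C := R[i].
Local Notation Co := (R[i]^o).

Lemma uniq_flatten_map (O : C -> seq C) (s : seq C) : uniq s ->
  (forall a, a \in s -> uniq (O a)) ->
  (forall a a' b, a \in s -> a' \in s -> b \in O a -> b \in O a' -> a = a') ->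
  uniq (flatten (map O s)).
Proof.
elim: s => //= a s IH /andP[na us] hu hd; rewrite cat_uniq hu ?mem_head //=.
rewrite IH ?andbT // => [|a' a's|a1 a2 b h1 h2]; last first.
- by apply: hd; rewrite inE ?h1 ?h2 orbT.
- by apply: hu; rewrite inE a's orbT.
apply/hasPn => b /flattenP[_ /mapP[a' a's ->] ba']; apply/negP => ba.
have e : a = a' by apply: (hd a a' b); rewrite ?mem_head // inE a's orbT.
by move: na; rewrite e a's.
Qed.

(** Once the representatives of all the blocks that meet a large finite set
    are present, the blocks together with this set form a larger finite set
    with the same product. *)
Lemma regroup_cvg (S : set C) (O : C -> seq C) (F : C -> C) (l : C) :
  ((\prod_(a <- A) F a : C) : Co) @[A --> totally] --> (l : Co) ->
  (forall a, S a -> uniq (O a)) ->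
  (forall a a' b, S a -> S a' -> b \in O a -> b \in O a' -> a = a') ->
  (forall b, F b != 1 -> exists2 a, S a & b \in O a) ->
  ((\prod_(a <- A | a \in S) \prod_(b <- O a) F b : C) : Co) @[A --> totally] --> (l : Co).
Proof.
move=> /cvgcP hl hu hd hc; apply/cvgcP => e e0.
have [A0 _ hA0] := hl e e0.
have [A1 hA1] : exists A1 : {fset C}, forall b, b \in enum_fset A0 -> F b != 1 ->
    exists a, [/\ a \in A1, S a & b \in O a].
  elim: (enum_fset A0) => [|b t [A1 IH]]; first by exists fset0.
  have [Fb|Fb] := eqVneq (F b) 1.
    exists A1 => c; rewrite inE => /orP[/eqP ->|]; last exact: IH.
    by rewrite Fb eqxx.
  have [a Sa ba] := hc b Fb.
  exists (a |` A1)%fset => c; rewrite inE => /orP[/eqP -> _|ct Fc].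
    by exists a; rewrite fset1U1.
  have [a' [h1 h2 h3]] := IH c ct Fc.
  by exists a'; rewrite fset1Ur.
exists A1 => // A /fsubsetP sub /=.
pose L := flatten (map O [seq a <- A | a \in S]).
have uL : uniq L.
  apply: uniq_flatten_map; first by rewrite filter_uniq // fset_uniq.
    by move=> a; rewrite mem_filter => /andP[/set_mem Sa _]; apply: hu.
  move=> a a' b; rewrite !mem_filter => /andP[/set_mem Sa _] /andP[/set_mem Sa' _].
  exact: hd.
pose B := [fset x in L]%fset.
have LE : \prod_(a <- A | a \in S) \prod_(b <- O a) F b = \prod_(b <- B) F b.
  rewrite -big_filter -(big_map O xpredT (fun s => \prod_(b <- s) F b)) -big_flatten.
  apply: perm_big; apply: uniq_perm; [exact: uL|exact: fset_uniq|].
  by move=> b; rewrite !inE.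
rewrite LE -[X in X - l](_ : \prod_(b <- (B `|` A0)%fset) F b = _); last first.
  rewrite (fset_big_split _ F (fsubsetUl B A0)) /=.
  rewrite [X in _ * X](_ : _ = 1) ?mulr1 // big_seq big1 // => b.
  rewrite in_fsetD in_fsetU => /andP[nB]; rewrite (negbTE nB) /= => bA.
  apply/eqP; apply: contraNT nB => Fb.
  have [a [aA1 Sa ba]] := hA1 b bA Fb; rewrite inE.
  by apply/flattenP; exists (O a) => //; apply: map_f; rewrite mem_filter mem_set // sub.
by apply: hA0 => /=; apply: fsubsetUr.
Qed.

End Regrouping.

(** * Factorization along the orbits *)

Section Factorization.
Context {R : realType}.
Local Notation C := R[i].
Local Notation Co := (R[i]^o).
Implicit Types (M : C -> nat) (z a b : C) (tau : C -> C).

Lemma zero_factorD M M1 M2 p z a : (forall b, M b = M1 b + M2 b)%N ->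
  zero_factor M p z a = zero_factor M1 p z a * zero_factor M2 p z a.
Proof. by move=> e; rewrite /zero_factor e exprD. Qed.

Lemma summable_zeros_le M M' p : (forall a, M' a <= M a)%N ->
  @summable_zeros R M p -> summable_zeros M' p.
Proof.
move=> le [B hB]; exists B => s us; apply: le_trans (hB s us).
by apply: ler_sum => a _; rewrite ler_wpM2r ?ler_nat // invr_ge0 exprn_ge0 ?cabs_ge0.
Qed.

Lemma summable_zerosD M M1 M2 p : (forall a, M a <= M1 a + M2 a)%N ->
  @summable_zeros R M1 p -> @summable_zeros R M2 p -> summable_zeros M p.
Proof.
move=> le [B1 h1] [B2 h2]; exists (B1 + B2) => s us.
apply: le_trans (lerD (h1 s us) (h2 s us)); rewrite /zeros_sum -big_split /=.
apply: ler_sum => a _; rewrite -mulrDl -natrD ler_wpM2r ?ler_nat //.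
by rewrite invr_ge0 exprn_ge0 ?cabs_ge0.
Qed.

Lemma summable_zeros_isometry M tau p : involutive tau -> (forall a, cabs (tau a) = cabs a) ->
  @summable_zeros R M p -> summable_zeros (M \o tau) p.
Proof.
move=> tauK tauc [B hB]; exists B => s us.
have us' : uniq (map tau s) by rewrite map_inj_uniq //; apply: inv_inj.
apply: le_trans (hB _ us'); rewrite /zeros_sum big_map.
by apply: ler_sum => a _; rewrite tauc.
Qed.

Variables (f g : C -> C).

Lemma partial_prod_common z (A : {fset C}) :
  partial_prod (common_support f g) (common_factor f g z) A =
  \prod_(a <- A) zero_factor (mult_common f g) (genus f) z a.
Proof.
rewrite /partial_prod big_mkcond; apply: eq_bigr => a _.
case: ifPn => // /negP na; rewrite zero_factor1 //.
apply: contraT; rewrite negb_or => /andP[h1 h2]; case: na; exact: mem_set.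
Qed.

Lemma mult_split z : mult f z = (mult_common f g z + mult_diff f g z)%N.
Proof. rewrite /mult_common /mult_diff; lia. Qed.

Variables (theta : R) (n m : nat).
Hypotheses (n0 : (0 < n)%N) (m0 : (0 < m)%N) (nm : theta * n%:R = pi * m%:R)
  (cmn : coprime m n).
Local Notation turn := (turn theta).

Lemma unity_root_turnB j k : (k <= n)%N -> turn j / turn k = turn (j + (n - k)).
Proof.
move=> kn; apply: (mulIf (turn_neq0 theta k)); rewrite divfK ?turn_neq0 //.
by rewrite -turnD -addnA subnK // turnD (turnn n0 nm cmn) mulr1.
Qed.

(** The case of [f] and that of [g] differ only by the map [tau] that carries
    the orbits of zeros of [f] to those of the function at hand: the identity
    or the conjugation. The latter maps a rotation to its inverse, hence the
    hypothesis [tau_turn]. *)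
Variable tau : C -> C.
Hypotheses (tauK : involutive tau) (tau_abs : forall a, cabs (tau a) = cabs a)
  (tau_turn : forall k a, (0 < k <= n)%N ->
     exists2 j, (0 < j <= n)%N & tau (turn k * a) = turn j * tau a)
  (diff_turn : forall k a, mult_diff f g (turn k * a) = mult_diff f g a).

Let orbit a : seq C := [seq turn k * tau a | k <- index_iota 1 n.+1].

Let orbitP b a : reflect (exists2 k, (0 < k <= n)%N & b = turn k * tau a) (b \in orbit a).
Proof.
apply: (iffP mapP) => -[k]; rewrite ?mem_index_iota => h ->; exists k => //.
by rewrite mem_index_iota.
Qed.

Let tau_neq0 a : (tau a != 0) = (a != 0).
Proof. by rewrite -!cabs_gt0 tau_abs. Qed.

Let orbit_factorE z a : orbit_factor f g theta n tau z a =
  \prod_(b <- orbit a) zero_factor (mult_diff f g \o tau) (genus f) z b.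
Proof.
rewrite /orbit_factor big_map [LHS]big_nat [RHS]big_nat; apply: eq_bigr => k /andP[k1 kn].
rewrite iter_rotation /zero_factor /=.
have [|j _ ->] := @tau_turn k (tau a); first by rewrite k1.
by rewrite tauK diff_turn.
Qed.

(** The orbits of the points [tau a], for [a] in the sector, are disjoint and
    cover the support. *)
Lemma sector_product_cvg z (l : C) :
  ((\prod_(a <- A) zero_factor (mult_diff f g \o tau) (genus f) z a : C) : Co)
    @[A --> totally] --> (l : Co) ->
  partial_prod (diff_sector f g n) (orbit_factor f g theta n tau z) @ totally --> (l : Co).
Proof.
move=> hl; have E (A : {fset C}) : \prod_(a <- A | a \in diff_sector f g n)
      \prod_(b <- orbit a) zero_factor (mult_diff f g \o tau) (genus f) z b =
    partial_prod (diff_sector f g n) (orbit_factor f g theta n tau z) A.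
  by apply: eq_bigr => a _; rewrite orbit_factorE.
apply: (@cvgc_ext R {fset C} totally _ _ _ _ E); apply: regroup_cvg hl _ _ _.
- move=> a [_ a0 _]; rewrite map_inj_in_uniq ?iota_uniq // => j k.
  have ta0 : tau a != 0 by rewrite tau_neq0.
  by rewrite !mem_index_iota => hj hk /(mulIf ta0) /(turn_inj n0 m0 nm cmn hj hk).
- move=> a a' b [_ a0 sa] [_ a'0 sa'] /orbitP[j hj ->] /orbitP[k hk] /(congr1 tau).
  have [j' /andP[_ hj'] ->] := tau_turn (tau a) hj.
  have [k' _ ->] := tau_turn (tau a') hk; rewrite !tauK => e.
  apply: (@sector_unique R theta n m n0 nm cmn a a' (k' + (n - j'))) => //.
  by rewrite -unity_root_turnB // mulrAC -e mulrAC divff ?turn_neq0 ?mul1r.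
- move=> b Fb; have /norP[/= Mb b0] : ~~ ((mult_diff f g (tau b) == 0%N) || (b == 0)).
    by apply: contra Fb => h; rewrite zero_factor1.
  have [|a [k [a0 sa hk e]]] := sector_exists n0 m0 nm cmn (b := tau b).
    by rewrite tau_neq0.
  exists a; first by split=> //; rewrite -(diff_turn k) -e.
  have [j hj e'] := tau_turn a hk; apply/orbitP; exists j => //.
  by rewrite -e' -e tauK.
Qed.

Lemma factors_as_hadamard h (Q : {poly C}) :
  (forall z, mult h z = mult_common f g z + mult_diff f g (tau z))%N ->
  mult h 0 = mult f 0 -> summable_zeros (mult f) (genus f) ->
  (forall z l,
    ((\prod_(a <- A) zero_factor (mult h) (genus f) z a : C) : Co) @[A --> totally] --> (l : Co) ->
    h z = cexp Q.[z] * (z ^+ mult h 0 * l)) ->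
  factors_as f g theta n tau Q h.
Proof.
move=> hs h0 sf hQ z.
have sc : summable_zeros (mult_common f g) (genus f).
  by apply: summable_zeros_le sf => a; apply: geq_minl.
have sd : summable_zeros (mult_diff f g \o tau) (genus f).
  apply: summable_zeros_isometry => //; apply: summable_zeros_le sf => a; exact: leq_subr.
have [lc hc] := canonical_cvg z sc; have [ld hd] := canonical_cvg z sd.
have cc : partial_prod (common_support f g) (common_factor f g z) @ totally --> (lc : Co).
  exact: (@cvgc_ext R {fset C} totally _ _ _ _ (fun A => esym (partial_prod_common z A)) hc).
have cd := sector_product_cvg hd.
split; [exact: cvgP cc|exact: cvgP cd|].
rewrite /common_product /infprod (cvgc_lim cc) (cvgc_lim cd) -mulrA.
rewrite (hQ z (lc * ld)); first by rewrite h0 !mulrA.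
apply: (@cvgc_ext R {fset C} totally _ _ _ _ _ (@cvgcM R {fset C} totally _ _ _ _ _ hc hd)) => A.
by rewrite -big_split; apply: eq_bigr => a _; apply/esym/zero_factorD.
Qed.

End Factorization.

(** * Moduli on the two lines *)

Section TwoLines.
Context {R : realType}.
Local Notation C := R[i].
Local Notation Co := (R[i]^o).
Implicit Types (z w a u : C) (f g : C -> C) (q : {poly C}).

Lemma primary_factor_conj p w : primary_factor p w^* = (primary_factor p w)^*.
Proof.
rewrite /primary_factor conjcM conjcD conjcN conjcO1 -cexp_conj conjc_sum.
congr (_ * cexp _); apply: eq_bigr => j _.
by rewrite conjcM conjcV conjcX (rmorph_nat (@conjc R)).
Qed.

Lemma Re_horner_line q u (x : R) :
  complex.Re q.[u * x%:C] = (\poly_(k < size q) complex.Re (q`_k * u ^+ k)).[x].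
Proof.
rewrite horner_coef Re_sum horner_poly; apply: eq_bigr => k _.
by rewrite exprMn -rmorphXn mulrA [LHS]ReM /= mulr0 subr0.
Qed.

(** On the line the real part is a real polynomial, and a nonzero one has
    finitely many roots. *)
Lemma Re_line_coef q u (D : R) : 0 < D ->
  (forall x, 0 < x < D -> complex.Re q.[u * x%:C] = 0) ->
  forall k, complex.Re (q`_k * u ^+ k) = 0.
Proof.
move=> D0 hq k.
pose r := \poly_(k < size q) complex.Re (q`_k * u ^+ k).
have r0 : r = 0.
  apply/eqP; apply: contraT => rn.
  pose rs := [seq D / j.+2%:R | j <- iota 0 (size r)].
  have urs : uniq rs.
    rewrite map_inj_in_uniq ?iota_uniq // => i j _ _.
    by move=> /(mulfI (lt0r_neq0 D0)) /invr_inj /eqP; rewrite eqr_nat => /eqP [].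
  have rrs : all (root r) rs.
    apply/allP => _ /mapP[j _ ->]; rewrite rootE -Re_horner_line hq //.
    by rewrite divr_gt0 //= gtr_pMr // invf_lt1 // ltr1n.
  by have := max_poly_roots rn rrs urs; rewrite size_map size_iota ltnn.
have := congr1 (fun s : {poly R} => s`_k) r0; rewrite coef_poly coef0.
by case: ltnP => // sk _; rewrite nth_default // mul0r.
Qed.

Lemma Re_line_eq0 q u (x : R) : (forall k, complex.Re (q`_k * u ^+ k) = 0) ->
  complex.Re q.[u * x%:C] = 0.
Proof.
by move=> e; rewrite Re_horner_line horner_poly big1 // => k _; rewrite e mul0r.
Qed.

(** A common divisor of [m] and [n] could be cancelled, against the minimality
    of [n]. *)
Lemma coprime_of_min (theta : R) n m : (0 < n)%N -> (0 < m)%N ->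
  theta * n%:R = pi * m%:R ->
  (forall k, (0 < k)%N -> (exists m, (0 < m)%N /\ theta * k%:R = pi * m%:R) -> (n <= k)%N) ->
  coprime m n.
Proof.
move=> n0 m0 nm nmin; set d := gcdn m n.
have d0 : (0 < d)%N by rewrite gcdn_gt0 m0.
have dm : (d %| m)%N by apply: dvdn_gcdl.
have dn : (d %| n)%N by apply: dvdn_gcdr.
have : (n <= n %/ d)%N.
  apply: nmin; first by rewrite divn_gt0 // dvdn_leq.
  exists (m %/ d)%N; split; first by rewrite divn_gt0 // dvdn_leq.
  have dR : d%:R != 0 :> R by rewrite pnatr_eq0 -lt0n.
  by apply: (mulIf dR); rewrite -!mulrA -!natrM !divnK.
rewrite /coprime -/d; case: (ltngtP d 1) => // [|d1].
  by rewrite ltnS leqn0 eqn0Ngt d0.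
by rewrite leqNgt ltn_Pdiv.
Qed.

Variables (theta : R) (n m : nat).
Hypotheses (n0 : (0 < n)%N) (m0 : (0 < m)%N) (nm : theta * n%:R = pi * m%:R)
  (cmn : coprime m n).
Local Notation rot := (turn theta).
Local Notation u := (cexp (theta *i)).

Lemma sqr_line : u ^+ 2 = rot 1.
Proof. by rewrite cexpX imagMn /turn mulr1. Qed.

Let u_abs : cabs u = 1. Proof. exact: cabs_cexp_i. Qed.

(** Each line is the fixed set of a reflection; this is all that the products
    over orbits see of it. *)
Definition on_lines z := z^* = z \/ z = rot 1 * z^*.

Lemma line_real (t : R) : on_lines t%:C.
Proof. by left; rewrite conjcR. Qed.

Lemma line_turn (t : R) : on_lines (u * t%:C).
Proof.
right; rewrite conjcM conjcR mulrA -sqr_line expr2 -(mulrA u u) mul_conj_cabs u_abs.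
by rewrite expr1n mulr1.
Qed.

(** Conjugating the factor of [rho^k (a^* )] at [z] gives that of [rho^- k a]
    at [z^*]. On the lines [z^*] is [z] up to a rotation of the group, and
    these changes permute the factors. *)
Lemma orbit_factor_line f g z a : on_lines z ->
  orbit_factor f g theta n (@conjc R) z a = (orbit_factor f g theta n id z a)^*.
Proof.
move=> hz; rewrite /orbit_factor conjc_prod; set M := mult_diff f g a.
pose H w := (primary_factor (genus f) (z^* / (w * a)) ^+ M)^*.
have -> : \prod_(1 <= k < n.+1)
    primary_factor (genus f) (z / iter k (rotation (2 * theta)) a^*) ^+ M =
    \prod_(1 <= k < n.+1) H (rot k)^*.
  apply: eq_bigr => k _; rewrite iter_rotation /H conjcX -primary_factor_conj.
  by rewrite conjcM conjcV conjcM !conjcI.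
rewrite (turn_prod_conj n0 m0 nm cmn).
under [RHS]eq_bigr => k _ do rewrite iter_rotation.
case: hz => hz; first by rewrite /H hz.
rewrite -(turn_prod_rot n0 nm cmn (fun w => (primary_factor (genus f) (z / (w * a)) ^+ M)^*)).
apply: eq_bigr => k _; rewrite /H (_ : z / (rot 1 * rot k * a) = z^* / (rot k * a)) //.
by rewrite {1}hz -(mulrA (rot 1) (rot k)) -mulf_div divff ?turn_neq0 // mul1r.
Qed.

(** The common value [X] is the modulus of the products, which are conjugate
    for [f] and [g]. *)
Lemma factors_line f g Qf Qg z : factors_as f g theta n id Qf f ->
  factors_as f g theta n (@conjc R) Qg g -> on_lines z ->
  exists X : R, cabs (f z) = cabs (cexp Qf.[z]) * X /\ cabs (g z) = cabs (cexp Qg.[z]) * X.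
Proof.
move=> /(_ z)[_ /cvg_ex[l hl] fE] /(_ z)[_ _ gE] hz.
have hg : partial_prod (diff_sector f g n) (orbit_factor f g theta n (@conjc R) z) @ totally
    --> (l^* : Co).
  have E (A : {fset C}) : (partial_prod (diff_sector f g n) (orbit_factor f g theta n id z) A)^* =
      partial_prod (diff_sector f g n) (orbit_factor f g theta n (@conjc R) z) A.
    by rewrite /partial_prod conjc_prod; apply: eq_bigr => a _; rewrite orbit_factor_line.
  exact: (@cvgc_ext R {fset C} totally _ _ _ _ E (@cvgc_conj R {fset C} totally _ _ _ hl)).
exists (cabs (common_product f g z) * cabs l).
move: fE gE; rewrite /infprod (cvgc_lim hl) (cvgc_lim hg) => -> ->.
move: (cexp _) (cexp _) (common_product f g z) => x y c.
by rewrite (cabsM (x * c)) (cabsM (y * c)) (cabsM x) (cabsM y) cabs_conj !mulrA.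
Qed.

(** For imaginary [q_k] the second condition says that [q_k = 0] or [u ^+ k]
    is real; as [|u| = 1], the latter means that the square [u ^+ 2 k] is 1,
    i.e., that [n] divides [k]. *)
Lemma line_coefP q :
  (forall k, complex.Re q`_k = 0) /\ (forall k, ~~ (n %| k)%N -> complex.Im q`_k = 0) <->
  (forall k, complex.Re q`_k = 0) /\ (forall k, complex.Re (q`_k * u ^+ k) = 0).
Proof.
have uk k : (u ^+ k) ^+ 2 = rot k.
  by rewrite -exprM cexpX imagMn /turn natrM; congr (cexp (_ *i)); ring.
have ReE k : complex.Re q`_k = 0 -> complex.Re (q`_k * u ^+ k) =
    - (complex.Im q`_k * complex.Im (u ^+ k)).
  by move=> e; rewrite ReM e mul0r sub0r.
have Im0 k : complex.Im (u ^+ k) = 0 <-> (n %| k)%N.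
  rewrite -(turn_eq1 n0 nm cmn) -uk; split=> [e|].
    have : complex.Re (u ^+ k) ^+ 2 = 1.
      have := sqr_cabs (u ^+ k); rewrite cabsX u_abs !expr1n e.
      by rewrite expr0n /= addr0 => <-.
    rewrite expr2 => e1; apply/eqP; apply: eq_ReIm.
      by rewrite expr2 ReM e mulr0 subr0 e1.
    by rewrite expr2 ImM e mulr0 mul0r addr0.
  rewrite sqrf_eq1 => /orP[] /eqP -> //=.
  by rewrite oppr0.
split=> -[h1 h2]; split=> // k.
  rewrite ReE //; have [/Im0 -> |/h2 ->] := boolP (n %| k)%N; first by rewrite mulr0 oppr0.
  by rewrite mul0r oppr0.
move=> nk; have /eqP := h2 k; rewrite ReE // oppr_eq0 mulf_eq0 => /orP[/eqP //|/eqP /Im0].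
by rewrite (negbTE nk).
Qed.

End TwoLines.

(** * Pairs of entire functions with equal moduli on two lines *)

Theorem theorem8 (R : realType) (theta : R) (n : nat) (f g : R[i] -> R[i])
    (theta_rat : exists q : rat, theta = pi * ratr q)
    (theta_range : 0 < theta <= pi / 2)
    (n_gt0 : (0 < n)%N)
    (n_pi : exists m : nat, (0 < m)%N /\ theta * n%:R = pi * m%:R)
    (n_min : forall k : nat, (0 < k)%N ->
       (exists m : nat, (0 < m)%N /\ theta * k%:R = pi * m%:R) -> (n <= k)%N)
    (f_entire : entire f) (g_entire : entire g)
    (f_order : finite_order f) (g_order : finite_order g)
    (f_neq0 : exists z, f z != 0) (g_neq0 : exists z, g z != 0) :
  (forall z : R[i],
     (exists t : R, z = t%:C \/ z = cexp (theta *i) * t%:C) ->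
     cabs (f z) = cabs (g z))
  <->
  (exists (d : nat) (Qf Qg : {poly R[i]}),
    [/\ (size Qf <= d.+1)%N /\ (size Qg <= d.+1)%N,
        forall k : nat, complex.Re Qf`_k = complex.Re Qg`_k,
        forall k : nat, ~~ (n %| k)%N -> complex.Im Qf`_k = complex.Im Qg`_k,
        factors_as f g theta n id Qf f
      & factors_as f g theta n (@conjc R) Qg g]).
Proof.
have [m [m_gt0 nm]] := n_pi; have cmn := coprime_of_min n_gt0 m_gt0 nm n_min.
set u := cexp (theta *i).
have coefB (Qf Qg : {poly R[i]}) k : (Qf - Qg)`_k = Qf`_k - Qg`_k by rewrite coefB.
split=> [fg|[d [Qf [Qg [_ eqRe eqIm Ff Fg]]]] z [t zt]]; last first.
  have [hRe hline] : (forall k, complex.Re (Qf - Qg)`_k = 0) /\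
      (forall k, complex.Re ((Qf - Qg)`_k * u ^+ k) = 0).
    apply/(line_coefP n_gt0 nm cmn); split=> k.
      by rewrite coefB ReB eqRe subrr.
    by move=> nk; rewrite coefB ImB eqIm // subrr.
  have [z_line Rez] : on_lines theta z /\ complex.Re (Qf - Qg).[z] = 0.
    case: zt => ->; last by split; [exact: line_turn|exact: Re_line_eq0].
    split; first exact: line_real.
    by rewrite -[t%:C]mul1r; apply: Re_line_eq0 => k; rewrite expr1n mulr1.
  have [X [-> ->]] := factors_line n_gt0 m_gt0 nm cmn Ff Fg z_line.
  move: Rez; rewrite hornerD hornerN ReB => /eqP; rewrite subr_eq0 => /eqP e.
  by rewrite !cabs_cexp e.
have fgR t : cabs (f t%:C) = cabs (g t%:C) by apply: fg; exists t; left.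
have fgU t : cabs (f (u * t%:C)) = cabs (g (u * t%:C)) by apply: fg; exists t; right.
have sym := mult_sym_real f_entire g_entire f_neq0 g_neq0 fgR.
have symU := mult_sym_line (cabs_cexp_i theta) f_entire g_entire f_neq0 g_neq0 fgU.
(* two reflections make a rotation, and each of them changes the sign of
   [M_f - M_g] *)
have diff_turn k a : mult_diff f g (turn theta k * a) = mult_diff f g a.
  elim: k a => [|k IH] a; first by rewrite turn0 mul1r.
  rewrite -addn1 turnD -mulrA IH -sqr_line /mult_diff.
  have := sym a; have := symU a^*; rewrite conjcI -/u; lia.
have g_split a : mult g a = (mult_common f g a + mult_diff f g a^*)%N.
  have := sym a; rewrite /mult_common /mult_diff; lia.
have g0 : mult g 0 = mult f 0 by have := sym 0; rewrite conjcZ0 !addnn => /double_inj ->.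
have sf : summable_zeros (mult f) (genus f).
  exact: genusP (finite_order_summable f_entire f_neq0 f_order).
have conjI : involutive (@conjc R) by move=> a; apply: conjcI.
(* the zeros of [g] are among those of [f] and their conjugates *)
have sg : summable_zeros (mult g) (genus f).
  apply: (summable_zerosD _ sf (summable_zeros_isometry conjI (@cabs_conj R) sf)) => a.
  by rewrite [leqRHS]sym leq_addr.
have [Qf hQf] := hadamard f_entire f_neq0 f_order sf.
have [Qg hQg] := hadamard g_entire g_neq0 g_order sg.
have Ff : factors_as f g theta n id Qf f.
  apply: (factors_as_hadamard n_gt0 m_gt0 nm cmn _ _ _ diff_turn _ _ sf hQf) => //.
    by move=> k a kn; exists k.
  by move=> a; apply: mult_split.
have Fg : factors_as f g theta n (@conjc R) Qg g.
  apply: (factors_as_hadamard n_gt0 m_gt0 nm cmn conjI (@cabs_conj R) _ diff_turn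
    g_split g0 sf hQg) => k a /andP[k_gt0 kn].
  change (exists2 j, (0 < j <= n)%N & (turn theta k * a)^* = turn theta j * a^*).
  rewrite conjcM (turn_conj n_gt0 nm cmn kn).
  have [->|ltkn] := eqVneq k n; last by exists (n - k)%N => //; lia.
  by exists n; rewrite ?n_gt0 ?leqnn // subnn turn0 (turnn n_gt0 nm cmn).
have [D D_gt0 fD] := entire_isolated 0 f_entire f_neq0.
have ReQ v : cabs v = 1 -> (forall t, on_lines theta (v * t%:C)) ->
    (forall t, cabs (f (v * t%:C)) = cabs (g (v * t%:C))) ->
    forall k, complex.Re ((Qf - Qg)`_k * v ^+ k) = 0.
  move=> v1 v_line fgv; apply: (Re_line_coef D_gt0) => x /andP[x0 xD].
  have cvx : cabs (v * x%:C) = x by rewrite cabsM v1 mul1r cabs_real gtr0_norm.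
  have fvx : f (v * x%:C) != 0 by apply: fD; rewrite ?subr0 -?cabs_gt0 cvx.
  have [X [fX gX]] := factors_line n_gt0 m_gt0 nm cmn Ff Fg (v_line x).
  have X0 : X != 0 by apply: contraNneq fvx => X0; rewrite -cabs_eq0 fX X0 mulr0.
  have := fgv x; rewrite fX gX => /(mulIf X0); rewrite !cabs_cexp => /expR_inj e.
  by rewrite hornerD hornerN ReB e subrr.
have Re1 k : complex.Re (Qf - Qg)`_k = 0.
  rewrite -[_`_k]mulr1 -(expr1n _ k); apply: (ReQ 1); rewrite ?cabs1 // => t;
    by rewrite mul1r //; exact: line_real.
have Reu := ReQ u (cabs_cexp_i theta) (line_turn theta) fgU.
have [_ Im0] : (forall k, complex.Re (Qf - Qg)`_k = 0) /\
    (forall k, ~~ (n %| k)%N -> complex.Im (Qf - Qg)`_k = 0).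
  by apply/(line_coefP n_gt0 nm cmn).
exists (maxn (size Qf) (size Qg)), Qf, Qg; split=> //.
- by split; apply: leqW; rewrite leq_max leqnn ?orbT.
- by move=> k; apply/eqP; rewrite -subr_eq0 -ReB -coefB Re1.
- by move=> k nk; apply/eqP; rewrite -subr_eq0 -ImB -coefB Im0.
Qed.
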